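(* Let $L\colon TM\to\mathbb{R}$ be a Lagrangian satisfying conditions (S) and (G), let $p,q\in M$, and let $z$ be a critical point of the action functional $\mathcal{A}\colon\Omega^{1,2}_{p,q}\to\mathbb{R}$, $\mathcal{A}(z)=\int_0^1L(z,\dot z)\,ds$. Then both $z$ and $\partial_vL(z,\dot z)$ are of class $C^1$; the Euler-Lagrange equation holds in classical sense, namely in natural local coordinates, for all $i\in\{0,\dots,m\}$, $$\frac{\partial L}{\partial x^i}\big(z(s),\dot z(s)\big)=\frac{d}{ds}\left(\frac{\partial L}{\partial v^i}\big(z(s),\dot z(s)\big)\right)\quad\text{for all }s\in[0,1];$$ and $z$ satisfies the conservation law $\partial_vL(z,\dot z)[\dot z]-L(z,\dot z)=E$ for some constant $E\in\mathbb{R}$.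
   Context: $M$ is a smooth connected manifold of dimension $m+1$, $m\ge 1$, with a fixed auxiliary complete Riemannian metric $g$ and norm $\|v\|=\sqrt{g(v,v)}$. For a function $L$ on $TM$: $\partial_vL(x,v)[w]:=\frac{d}{ds}L(x,v+sw)|_{s=0}$; in natural coordinates $(x^0,\dots,x^m,v^0,\dots,v^m)$ of $TM$, $\partial_xL(x,v)[w]:=\sum_i\frac{\partial L}{\partial x^i}(x,v)w^i$; $\|\partial_vL(x,v)\|$, $\|\partial_xL(x,v)\|$ are the norms of these linear forms with respect to $g_x$. Since $\partial_xL$ depends on coordinates, bounds on $\|\partial_xL\|$ are read in local charts (the locally bounded function $C$ in the bound may depend on the chart). Condition (S): (i) $L\in C^1(TM)$; (ii) there is a $C^1$ vector field $K$ on $M$ such that $L$ is invariant under the local flow $\psi$ of $K$, i.e. $L(\psi(t,x),\partial_x\psi(t,x)[v])=L(x,v)$ whenever defined, and the Noether charge $N(x,v):=\partial_vL(x,v)[K_x]$ has the form $N(x,v)=Q_x(v)+d(x)$ with $Q$ a $C^1$ one-form and $d$ a $C^1$ function on $M$; (iii) $d$ is invariant by the flow of $K$ and $Q_x(K)<0$ for all $x\in M$. Put $L_c(x,v):=L(x,v)-\frac{Q_x(v)^2}{Q_x(K)}$. Condition (G): there are continuous functions $C,\lambda\colon M\to(0,+\infty)$ such that, for all $x\in M$ and $v,v_1,v_2\in T_xM$: $L_c(x,v)\le C(x)(\|v\|^2+1)$; $\|\partial_xL_c(x,v)\|\le C(x)(\|v\|^2+1)$; $\|\partial_vL_c(x,v)\|\le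 C(x)(\|v\|+1)$; $(\partial_vL_c(x,v_2)-\partial_vL_c(x,v_1))[v_2-v_1]\ge\lambda(x)\|v_2-v_1\|^2$. $\Omega^{1,2}_{p,q}$ is the Hilbert manifold of absolutely continuous curves $z\colon[0,1]\to M$ with $\int_0^1g(\dot z,\dot z)\,ds<+\infty$, $z(0)=p$, $z(1)=q$; its tangent space at $z$ consists of the $W^{1,2}$ vector fields $\xi$ along $z$ vanishing at the endpoints. $\mathcal{A}$ is $C^1$ with $d\mathcal{A}(z)[\xi]=\int_0^1(\partial_xL(z,\dot z)[\xi]+\partial_vL(z,\dot z)[\dot\xi])\,ds$ (integrand in local coordinates), and $z$ is critical if $d\mathcal{A}(z)=0$. *)

(* Defs.v *)
From HB Require Import structures.
From mathcomp Require Import all_boot all_order all_algebra.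
From mathcomp Require Import all_classical all_reals all_analysis.

Set Implicit Arguments.
Unset Strict Implicit.
Unset Printing Implicit Defensive.

Import Order.TTheory GRing.Theory Num.Theory numFieldNormedType.Exports.

Local Open Scope classical_set_scope.
Local Open Scope ring_scope.

(* C^k maps on an open set A, between finite-dimensional normed spaces:
   continuity of all iterated directional derivatives. *)
Fixpoint Ck_on (R : realType) (V W : normedModType R) (k : nat)
    (A : set V) (f : V -> W) : Prop :=
  match k with
  | 0%N => forall x, A x -> {for x, continuous f}
  | k'.+1 => (forall x, A x -> differentiable f x) /\
             forall v, Ck_on k' A (fun x => 'D_v f x)
  end.

Definition smooth_on (R : realType) (V W : normedModType R)
    (A : set V) (f : V -> W) := forall k, Ck_on k A f.

(* Derivative relative to [0, 1]: one-sided at 0 and at 1. *)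
Definition diff_quot (R : realType) (V : normedModType R) (f : R -> V) (s : R) :
    set_system V :=
  (t - s)^-1 *: (f t - f s) @[t --> within `[0, 1] s^'].

Definition derivable01 (R : realType) (V : normedModType R) (f : R -> V) (s : R) :=
  cvg (diff_quot f s).

Definition deriv01 (R : realType) (V : normedModType R) (f : R -> V) (s : R) : V :=
  lim (diff_quot f s).

(* C^1 on a relatively open subset J of [0, 1]. *)
Definition C1_on01 (R : realType) (V : normedModType R) (J : set R) (f : R -> V) :=
  forall s, J s ->
    derivable01 f s /\
    (deriv01 f t @[t --> within `[0, 1] (nbhs s)] --> deriv01 f s).

Definition abs_cont (R : realType) (V : normedModType R) (a b : R) (f : R -> V) :=
  forall eps : R, 0 < eps -> exists2 delta : R, 0 < delta &
    forall (k : nat) (u v : 'I_k -> R),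
      (forall i, [/\ a <= u i, u i <= v i & v i <= b]) ->
      (forall i j, i != j -> v i <= u j \/ v j <= u i) ->
      \sum_(i < k) (v i - u i) < delta ->
      \sum_(i < k) `|f (v i) - f (u i)| < eps.

(* Smooth n-manifold given by an atlas.  The charts [phi a] and their inverses
   [phi_inv a] are total functions, meaningful on [dom a] and on its image
   only.  As every atlas is allowed, so is the maximal one.  [chart_at]
   selects a chart around each point. *)
Record manifold (R : realType) (n : nat) := Manifold {
  carrier :> topologicalType;
  hausdorff_carrier : hausdorff_space carrier;
  second_countable_carrier : @second_countable carrier;
  chart : Type;
  dom : chart -> set carrier;
  phi : chart -> carrier -> 'rV[R]_n;
  phi_inv : chart -> 'rV[R]_n -> carrier;
  dom_open : forall a, open (dom a);
  img_open : forall a, open (phi a @` dom a);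
  phiK : forall a x, dom a x -> phi_inv a (phi a x) = x;
  phi_continuous : forall a x, dom a x -> {for x, continuous (phi a)};
  phi_inv_continuous : forall a y,
    (phi a @` dom a) y -> {for y, continuous (phi_inv a)};
  transition_smooth : forall a b,
    smooth_on (phi a @` (dom a `&` dom b)) (phi b \o phi_inv a);
  chart_at : carrier -> chart;
  chart_at_dom : forall x, dom (chart_at x) x }.

Definition img (R : realType) (n : nat) (M : manifold R n) (a : chart M) :
  set 'rV[R]_n := phi a @` dom a.

(* T_x M, through the coordinates of tangent vectors in [chart_at x]. *)
Definition tangent (R : realType) (n : nat) (M : manifold R n) (x : M) :
  normedModType R := 'rV[R]_n.

Section Manifold.
Variables (R : realType) (n : nat) (M : manifold R n).
Implicit Types (a b : chart M) (x : M).

(* Coordinates in the chart a of a tangent vector v at x. *)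
Definition coord a x (v : tangent x) : 'rV[R]_n :=
  'D_v (phi a \o phi_inv (chart_at x)) (phi (chart_at x) x).

(* The tangent vector with coordinates w in the chart a, at the point with
   coordinates y in the chart a. *)
Definition of_coord a (y w : 'rV[R]_n) : tangent (phi_inv a y) :=
  'D_w (phi (chart_at (phi_inv a y)) \o phi_inv a) y.

Definition tangent_map (f : M -> M) x (v : tangent x) : tangent (f x) :=
  'D_v (phi (chart_at (f x)) \o f \o phi_inv (chart_at x)) (phi (chart_at x) x).

Definition C1_function (f : M -> R) :=
  forall a, Ck_on 1 (img a) (f \o phi_inv a).

Definition C1_vector_field (K : forall x, tangent x) :=
  forall a, Ck_on 1 (img a) (fun y => coord a (K (phi_inv a y))).

Definition C1_one_form (Q : forall x, tangent x -> R) :=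
  (forall x, scalar (@Q x)) /\
  forall a w, Ck_on 1 (img a) (fun y => Q (phi_inv a y) (of_coord a y w)).

(* Expression of a function on TM in the natural coordinates of a. *)
Definition in_chart (L : forall x, tangent x -> R) a (y w : 'rV[R]_n) : R :=
  L (phi_inv a y) (of_coord a y w).

Definition C1_TM (L : forall x, tangent x -> R) :=
  forall a, Ck_on 1 [set yw : 'rV[R]_n * 'rV[R]_n | img a yw.1]
                    (fun yw => in_chart L a yw.1 yw.2).

Definition d_v (L : forall x, tangent x -> R) x (v w : tangent x) : R :=
  'D_w (@L x) v.

(* The partial derivatives in x and in v of the coordinate expression of L,
   at the point (y, w) in the direction u. *)
Definition d_x_chart (L : forall x, tangent x -> R) a (y w u : 'rV[R]_n) : R :=
  'D_u (fun y' => in_chart L a y' w) y.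

Definition d_v_chart (L : forall x, tangent x -> R) a (y w u : 'rV[R]_n) : R :=
  'D_u (in_chart L a y) w.

Definition velocity (z : R -> M) (s : R) : tangent (z s) :=
  deriv01 (phi (chart_at (z s)) \o z) s.

Definition C1_curve (z : R -> M) :=
  {within `[0, 1], continuous z} /\
  forall a, C1_on01 [set s | 0 <= s <= 1 /\ dom a (z s)] (phi a \o z).

Section Metric.
Variable g : forall x, tangent x -> tangent x -> R.

Definition riemannian_metric :=
  [/\ forall x (u : tangent x), scalar (g u),
      forall x (u v : tangent x), g u v = g v u,
      forall x (u : tangent x), u != 0 -> 0 < g u u
    & forall a u w, smooth_on (img a)
        (fun y => g (of_coord a y u) (of_coord a y w))].

Definition gnorm x (v : tangent x) : R := Num.sqrt (g v v).

Definition dual_norm x (l : tangent x -> R) : \bar R :=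
  ereal_sup [set (`|l w|)%:E | w in [set w | gnorm w <= 1]].

Definition curve_length (z : R -> M) : \bar R :=
  (\int[lebesgue_measure]_(s in `[0%R, 1%R]) (gnorm (velocity z s))%:E)%E.

Definition rdist (x y : M) : \bar R :=
  ereal_inf [set curve_length z | z in
    [set z : R -> M | [/\ C1_curve z, z 0 = x & z 1 = y]]].

Definition complete_metric :=
  forall u : nat -> M,
    (forall eps : R, 0 < eps -> exists N : nat, forall i j : nat,
        (N <= i)%N -> (N <= j)%N -> (rdist (u i) (u j) < eps%:E)%E) ->
    exists x : M, u @ \oo --> x.

End Metric.

(* f is the local flow of K, defined on the open neighbourhood D of {0} x M,
   which is star-shaped in time.  The C^1 dependence on (t, x) holds for the
   flow of any C^1 field. *)
Definition local_flow (K : forall x, tangent x) (D : set (R * M))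
    (f : R -> M -> M) :=
  [/\ open D,
      forall x, D (0, x) /\ f 0 x = x,
      forall t x r, D (t, x) -> 0 <= r <= 1 -> D (r * t, x),
      forall t x, D (t, x) ->
        is_derive t 1 (fun t' => phi (chart_at (f t x)) (f t' x)) (K (f t x))
    & (forall tx, D tx -> {for tx, continuous (fun ty : R * M => f ty.1 ty.2)}) /\
      forall a b, Ck_on 1
        [set ty : R * 'rV[R]_n | [/\ img a ty.2, D (ty.1, phi_inv a ty.2)
                                   & dom b (f ty.1 (phi_inv a ty.2))]]
        (fun ty => phi b (f ty.1 (phi_inv a ty.2)))].

Record cond_S (L : forall x, tangent x -> R) (K : forall x, tangent x)
    (D : set (R * M)) (f : R -> M -> M)
    (Q : forall x, tangent x -> R) (d : M -> R) : Prop := CondS {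
  S_L_C1 : C1_TM L;
  S_K_C1 : C1_vector_field K;
  S_flow : local_flow K D f;
  S_L_invariant : forall t x (v : tangent x), D (t, x) ->
    L (f t x) (tangent_map (f t) v) = L x v;
  S_Q_C1 : C1_one_form Q;
  S_d_C1 : C1_function d;
  S_noether : forall x (v : tangent x), d_v L v (K x) = Q x v + d x;
  S_d_invariant : forall t x, D (t, x) -> d (f t x) = d x;
  S_QK_lt0 : forall x, Q x (K x) < 0 }.

Definition L_c (L : forall x, tangent x -> R) (K : forall x, tangent x)
    (Q : forall x, tangent x -> R) x (v : tangent x) : R :=
  L x v - Q x v ^+ 2 / Q x (K x).

(* The bound on d_x Lc depends on the chart, through a locally bounded Ca. *)
Definition cond_G (g : forall x, tangent x -> tangent x -> R)
    (Lc : forall x, tangent x -> R) :=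
  exists C lambda : M -> R,
    [/\ continuous C /\ (forall x, 0 < C x),
        continuous lambda /\ (forall x, 0 < lambda x),
        forall x (v : tangent x), Lc x v <= C x * (gnorm g v ^+ 2 + 1),
        forall a, exists2 Ca : M -> R,
          (forall x, dom a x -> exists B, \forall x' \near x, Ca x' <= B) &
          forall x (v : tangent x), dom a x ->
            (dual_norm g (fun w : tangent x =>
               d_x_chart Lc a (phi a x) (coord a v) (coord a w))
             <= (Ca x * (gnorm g v ^+ 2 + 1))%:E)%E
      & (forall x (v : tangent x),
          (dual_norm g (d_v Lc v) <= (C x * (gnorm g v + 1))%:E)%E) /\
        forall x (v1 v2 : tangent x),
          lambda x * gnorm g (v2 - v1) ^+ 2 <=
          d_v Lc v2 (v2 - v1) - d_v Lc v1 (v2 - v1)].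

(* z maps [s, t], contained in [0, 1], into the domain of the chart a. *)
Definition segment_in (z : R -> M) a (s t : R) :=
  [/\ 0 <= s, s <= t, t <= 1 & forall r, s <= r <= t -> dom a (z r)].

Definition Omega12 (g : forall x, tangent x -> tangent x -> R) (p q : M)
    (z : R -> M) :=
  [/\ z 0 = p, z 1 = q, {within `[0, 1], continuous z},
      forall a s t, segment_in z a s t -> abs_cont s t (phi a \o z)
    & (\int[lebesgue_measure]_(s in `[0%R, 1%R])
         (g (z s) (velocity z s) (velocity z s))%:E < +oo)%E].

Definition field_coord (z : R -> M) (xi : forall s, tangent (z s)) a (s : R) :
  'rV[R]_n := coord a (xi s).

Definition Omega12_tangent (z : R -> M) (xi : forall s, tangent (z s)) :=
  [/\ xi 0 = 0, xi 1 = 0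
    & forall a s t, segment_in z a s t ->
        abs_cont s t (field_coord xi a) /\
        (\int[lebesgue_measure]_(r in `[s, t])
           (`|deriv01 (field_coord xi a) r| ^+ 2)%:E < +oo)%E].

(* The integrand, in the coordinates of a, of the differential of
   z |-> \int_0^1 L(z, z'); it does not depend on the chart a around z s. *)
Definition dA_density (L : forall x, tangent x -> R) (z : R -> M)
    (xi : forall s, tangent (z s)) a (s : R) : R :=
  let y := phi a (z s) in
  let w := deriv01 (phi a \o z) s in
  d_x_chart L a y w (field_coord xi a s) +
  d_v_chart L a y w (deriv01 (field_coord xi a) s).

(* dA(z)[xi]: integral over the full-measure set of the s in [0, 1] where z and
   xi are differentiable. *)
Definition dA (L : forall x, tangent x -> R) (z : R -> M)
    (xi : forall s, tangent (z s)) : \bar R :=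
  (\int[lebesgue_measure]_(s in
       [set s : R | [/\ 0 <= s <= 1,
                        derivable01 (phi (chart_at (z s)) \o z) s
                      & derivable01 (field_coord xi (chart_at (z s))) s]%R])
     (dA_density L xi (chart_at (z s)) s)%:E)%E.

Definition critical_point (L : forall x, tangent x -> R) (z : R -> M) :=
  forall xi : forall s, tangent (z s), Omega12_tangent xi -> dA L xi = 0%E.

(* s |-> (dL / dv^i) (z s, z' s) in the natural coordinates of a. *)
Definition momentum (L : forall x, tangent x -> R) (z : R -> M) a (i : 'I_n)
    (s : R) : R :=
  d_v_chart L a (phi a (z s)) (deriv01 (phi a \o z) s) (delta_mx 0 i).

End Manifold.

(* Main.v *)
Require Import Defs.
From HB Require Import structures.
From mathcomp Require Import all_boot all_order all_algebra.
From mathcomp Require Import all_classical all_reals all_analysis.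
From mathcomp Require Import measurable_realfun ring lra.

Set Implicit Arguments.
Unset Strict Implicit.
Unset Printing Implicit Defensive.

Import Order.TTheory GRing.Theory Num.Theory numFieldNormedType.Exports.

Local Open Scope classical_set_scope.
Local Open Scope ring_scope.

(** Reduction to charts: no flow is needed, only the Noether identity
    dL/dv(x, v)[K] = Q(v) + d.

    Testing the criticality of z against fields which in a chart are a trapezoid
    times a constant vector, and shrinking the slopes of the trapezoid, gives
    p(r) = c + \int dL/dx for almost every r, where p is the momentum
    dL/dv(z, z'). As L = L_c + Q^2 / Q(K), the Noether identity writes the fibre
    derivative of L_c as a function of (x, p) alone; its strong monotonicity in v
    thus makes the Legendre transform v |-> p expansive, hence injective with a
    continuous inverse. Since p has a continuous version, so has z', and z and p
    are C^1.

    As z'' need not exist, the energy E = p(z') - L cannot be differentiated.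
    Convexity of L_c in v gives instead, for fixed s,
    E(t) >= p_t(v) - L(z_t, v) + (Q(v) - (p_t(K) - d))^2 / Q(K),  v = z'(s),
    with equality at t = s, where the right-hand side has derivative 0. A
    continuous function with such lower tangents everywhere is constant. *)

(** * Absolutely continuous functions as primitives *)

(** Expansiveness replaces both: near a time where the equation for p is not known, the values of z'
    at good times are bounded, and a cluster point of them solves it.

    The growth conditions bear on [L_c]. They pass to [L] because Q^2 / Q(K) is quadratic in v with
    locally bounded coefficients; as z' is square integrable, dL/dx and p are then integrable along
    z.

    Since Q(K) < 0, the correction in the lower bound for the energy has the unfavourable sign. It
    is harmless because it is a square that vanishes at s, and that square is differentiable because
    p_t(K) - d stands for Q(z'(t)): p, K and d are C^1 along z, whereas z' is merely continuous.

    The integrals in [Omega12] and [dA] have integrands or domains not known to be measurable; they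
    are compared almost everywhere with integrals of a Borel version of z'. *)

Section clamp.
Context {R : realType}.
Implicit Types a b x y : R.

(** Precomposition with [clamp a b] extends a function on [[a, b]] to the line by its boundary
    values. It keeps continuity, monotonicity and absolute continuity, so that statements about
    functions on the whole line apply to curves on a segment. *)
Definition clamp a b x := Num.max a (Num.min x b).

Lemma clamp_itv a b x : a <= b -> a <= clamp a b x <= b.
Proof. by move=> ab; rewrite /clamp le_max lexx/= ge_max ab ge_min lexx orbT. Qed.

Lemma clamp_id a b x : a <= x <= b -> clamp a b x = x.
Proof. by rewrite /clamp => /andP[ax xb]; rewrite (min_idPl xb) (max_idPr ax). Qed.

Lemma clamp_nondecreasing a b : {homo clamp a b : x y / x <= y}.
Proof.
move=> x y xy; rewrite /clamp ge_max le_max lexx/= le_max le_min !ge_min xy lexx.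
by rewrite !orbT.
Qed.

Lemma clamp_lipschitz a b x y : x <= y -> clamp a b y - clamp a b x <= y - x.
Proof.
move=> xy; rewrite /clamp.
by case: (leP y b) => ?; case: (leP x b) => ?; rewrite /Order.max; do !case: ifPn; rewrite -?leNgt => *; lra.
Qed.

Lemma clamp_dist a b x y : `|clamp a b x - clamp a b y| <= `|x - y|.
Proof.
have [xy|yx] := leP x y.
  rewrite ler0_norm ?subr_le0 ?clamp_nondecreasing//.
  by rewrite ler0_norm ?subr_le0// !opprB; exact: clamp_lipschitz.
rewrite ger0_norm ?subr_ge0 ?clamp_nondecreasing ?(ltW yx)//.
by rewrite ger0_norm ?subr_ge0 ?(ltW yx)//; apply/clamp_lipschitz/ltW.
Qed.

Lemma clamp_continuous a b : continuous (clamp a b).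
Proof.
move=> x; apply/cvgrPdist_lt => e e0; near=> y.
by apply: le_lt_trans (clamp_dist _ _ _ _) _; near: y; exact: cvgr_dist_lt.
Unshelve. all: by end_near. Qed.

Lemma continuous_comp_clamp (T : topologicalType) a b (f : R -> T) : a <= b ->
  {within `[a, b], continuous f} -> continuous (f \o clamp a b).
Proof.
move=> ab /subspace_continuousP cf x.
have cx : `[a, b]%classic (clamp a b x) by rewrite /= in_itv/=; exact: clamp_itv.
apply: cvg_comp (cf _ cx) => P wP.
have /= cwP := @clamp_continuous a b x _ wP.
have {}cwP : \forall y \near x, clamp a b y \in `[a, b] -> P (clamp a b y) by exact: cwP.
suff : \forall y \near x, P (clamp a b y) by [].
apply: filterS cwP => y /=; apply.
by rewrite in_itv/=; exact: clamp_itv.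
Qed.

End clamp.

Section absolute_continuity.
Context {R : realType}.
Notation mu := (@lebesgue_measure R).

Definition nonoverlapping : rel (R * R) :=
  fun p q => (p.2 <= q.1) || (q.2 <= p.1).

(* [abs_cont] over sequences of intervals: unlike families over ['I_k], these
   can be filtered and concatenated. *)
Definition abs_cont_on_seqs (V : normedModType R) (a b : R) (f : R -> V) :=
  forall eps, 0 < eps -> exists2 delta, 0 < delta &
  forall l : seq (R * R),
    {in l, forall p, [/\ a <= p.1, p.1 <= p.2 & p.2 <= b]} ->
    pairwise nonoverlapping l ->
    \sum_(p <- l) (p.2 - p.1) < delta ->
    \sum_(p <- l) `|f p.2 - f p.1| < eps.

Lemma abs_cont_seq (V : normedModType R) (a b : R) (f : R -> V) :
  abs_cont a b f -> abs_cont_on_seqs a b f.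
Proof.
move=> acf eps eps0; have [delta delta0 acd] := acf _ eps0.
exists delta => // l lab lno; rewrite !(big_nth (0, 0)) !big_mkord => ld.
apply: (acd _ (fun i : 'I_(size l) => (nth (0, 0) l i).1) (fun i => (nth (0, 0) l i).2)) => //.
  by move=> i; apply: lab; apply: mem_nth.
move=> i j ij; have /pairwiseP-/(_ (0, 0)) lnoP := lno.
have [ij'|ij'|ij'] := ltngtP i j; last by rewrite (val_inj ij') eqxx in ij.
  by have /orP[] := lnoP i j (ltn_ord i) (ltn_ord j) ij'; [left|right].
by have /orP[] := lnoP j i (ltn_ord j) (ltn_ord i) ij'; [right|left].
Qed.

Lemma lebesgue_stieltjes_itv_oo (F : cumulative R R) (u v : R) : u <= v ->
  (lebesgue_stieltjes_measure F `]u, v[%classic <= (F v - F u)%:E)%E.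
Proof.
move=> uv; have -> : (F v - F u)%:E = lebesgue_stieltjes_measure F `]u, v]%classic.
  rewrite /lebesgue_stieltjes_measure /measure_extension measurable_mu_extE/=; last exact: is_ocitv.
  by rewrite wlength_itv_bnd.
by apply: le_measure; rewrite ?inE//; exact: subset_itv_oo_oc.
Qed.

(** A Lebesgue-null set lies in an open set of measure less than delta. That set is a disjoint union
    of open intervals; any finitely many of them have F-increments of sum less than eps, and so the
    whole union has F-measure at most eps. *)
Lemma abs_cont_dominated (F : cumulative R R) :
  (forall eps, 0 < eps -> exists2 delta, 0 < delta &
    forall l : seq (R * R),
      {in l, forall p, p.1 <= p.2} -> pairwise nonoverlapping l ->
      \sum_(p <- l) (p.2 - p.1) < delta ->
      \sum_(p <- l) (F p.2 - F p.1) < eps) ->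
  lebesgue_stieltjes_measure F `<< mu.
Proof.
move=> acF; apply/null_content_dominatesP => A mA muA0.
apply/eqP; rewrite eq_le measure_ge0 andbT.
apply/lee_addgt0Pr => eps eps0; rewrite add0e.
have [delta delta0 acd] := acF _ eps0.
have [|U [oU AU muUA]] := @lebesgue_regularity_outer R A delta mA _ delta0.
  by rewrite muA0.
have muU : (mu U < delta%:E)%E.
  have mU : measurable U by exact: open_measurable.
  rewrite -(setDUK AU) measureU//; [|exact: measurableD|by rewrite setDE setICA setICr setI0].
  by rewrite muA0 add0e.
apply: (@le_trans _ _ (lebesgue_stieltjes_measure F U)).
  by apply: le_measure; rewrite ?inE//; exact: open_measurable.
pose I := open_disjoint_itv oU.
have mI i : measurable (I i : set (measurableTypeR R)) by apply: open_measurable; exact: open_disjoint_itv_open.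
have tI : trivIset setT I by exact: open_disjoint_itv_trivIset.
have UI : U = \bigcup_i I i by exact: open_disjoint_itv_bigcup.
have muI i : (mu (I i) < delta%:E)%E.
  apply: le_lt_trans muU; apply: le_measure; rewrite ?inE//; [exact: open_measurable|].
  by rewrite UI; exact: bigcup_sup.
have /choice[p pP] : forall i, exists p : R * R, p.1 <= p.2 /\ I i = `]p.1, p.2[%classic.
  move=> i.
  have [I0|/set0P I0] := eqVneq (I i) set0.
    by exists (0, 0); split => //=; rewrite I0 set_itvoo0.
  have iI : is_interval (I i) := @open_disjoint_itv_is_interval R U oU i.
  have oI : open (I i) := @open_disjoint_itv_open R U oU i.
  (* A component of measure less than delta is bounded, hence is the open interval between its
     infimum and its supremum. *)
  have Ile x y : I i x -> I i y -> x <= y -> y - x <= delta.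
    move=> Ix Iy xy; rewrite -lee_fin EFinB; apply: le_trans (ltW (muI i)).
    have -> : (y%:E - x%:E)%E = mu `[x, y]%classic.
      rewrite lebesgue_measure_itv/= lte_fin; case: ltgtP xy => // -> _.
      by rewrite subee.
    apply: le_measure; rewrite ?inE// => t /= ; rewrite in_itv/= => /andP[xt ty].
    by apply: (iI x y) => //; rewrite xt.
  case: I0 => x0 Ix0.
  have bI : has_ubound (I i).
    exists (x0 + delta) => y Iy; have [xy|yx] := leP x0 y.
      by rewrite addrC -lerBlDr; exact: Ile.
    by rewrite (le_trans (ltW yx))// lerDl ltW.
  have lI : has_lbound (I i).
    exists (x0 - delta) => y Iy; have [yx|xy] := leP y x0.
      by rewrite lerBlDr addrC -lerBlDr; exact: Ile.
    by rewrite (le_trans _ (ltW xy))// gerBl ltW.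
  exists (inf (I i), sup (I i)) => /=; split.
    by rewrite (le_trans (ge_inf lI Ix0))// ub_le_sup.
  by rewrite -interval_bounded_interior//; exact/esym/interior_id.
have pno i j : p i != p j -> i != j by apply: contra => /eqP ->.
have nuI i : (lebesgue_stieltjes_measure F (I i) <= (F (p i).2 - F (p i).1)%:E)%E.
  by rewrite (pP i).2; apply: lebesgue_stieltjes_itv_oo; exact: (pP i).1.
have lI i : mu (I i) = ((p i).2 - (p i).1)%:E.
  rewrite (pP i).2 lebesgue_measure_itv/= lte_fin -EFinB.
  by have := (pP i).1; case: ltgtP => // -> _; rewrite subrr.
rewrite UI measure_bigcup//=.
apply: lime_le; first by apply: is_cvg_nneseries => *; exact: measure_ge0.
near=> n.
(* An empty component is represented by a degenerate pair such as [(0, 0)], which may lie inside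
   another interval. Only nondegenerate pairs are kept, so that the family is nonoverlapping. *)
pose l := [seq p i | i <- iota 0 n & (p i).1 < (p i).2].
apply: (@le_trans _ _ (\sum_(q <- l) (F q.2 - F q.1))%:E).
  rewrite /l big_map big_filter -[in X in (_ <= X)%E](subn0 n) -/(index_iota 0 n) -sumEFin.
  rewrite [in X in (_ <= X)%E]big_mkcond [in X in (X <= _)%E]big_mkcond/=.
  apply: lee_sum => i _; rewrite in_setT (le_trans (nuI i))//.
  case: ifPn => //; rewrite -leNgt => qi.
  by have := (pP i).1; rewrite le_eqVlt ltNge qi orbF => /eqP ->; rewrite subrr.
rewrite lee_fin; apply/ltW/acd.
- by move=> q /mapP[i _ ->]; exact: (pP i).1.
- rewrite /l pairwise_map.
  have : uniq [seq i <- iota 0 n | (p i).1 < (p i).2] by rewrite filter_uniq// iota_uniq.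
  rewrite uniq_pairwise.
  apply: (sub_in_pairwise (P := fun i => (p i).1 < (p i).2)); last exact: filter_all.
  move=> i j pi pj /= ij.
  apply/contraT => /norP[]; rewrite -!ltNge => ji {}ij'.
  have Iij : (I i `&` I j) !=set0.
    exists ((Num.max (p i).1 (p j).1 + Num.min (p i).2 (p j).2) / 2).
    rewrite (pP i).2 (pP j).2 /= !in_itv/=.
    have H : Num.max (p i).1 (p j).1 < Num.min (p i).2 (p j).2.
      by rewrite gt_max !lt_min ji ij' !andbT; exact/andP.
    split; apply/andP; split.
    - by rewrite (le_lt_trans _ (midf_lt H).1)// le_max lexx.
    - by rewrite (lt_le_trans (midf_lt H).2)// ge_min lexx.
    - by rewrite (le_lt_trans _ (midf_lt H).1)// le_max lexx orbT.
    - by rewrite (lt_le_trans (midf_lt H).2)// ge_min lexx orbT.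
  by have := tI _ _ Logic.I Logic.I Iij => /eqP; rewrite (negbTE ij).
- rewrite -lte_fin; apply: le_lt_trans muU.
  rewrite [in X in (_ <= X)%E]UI [leRHS]measure_bigcup//=.
  apply: le_trans (nneseries_lim_ge n _); last by move=> *; exact: measure_ge0.
  rewrite /l big_map big_filter -[in X in (X <= _)%E](subn0 n) -/(index_iota 0 n) -sumEFin.
  rewrite [in X in (_ <= X)%E]big_mkcond [in X in (X <= _)%E]big_mkcond/=.
  apply: lee_sum => i _; rewrite in_setT.
  by case: ifPn => [_|_]; [rewrite -lI|exact: measure_ge0].
Unshelve. all: by end_near. Qed.

(** The density is the Radon-Nikodym derivative of the Lebesgue-Stieltjes measure of
    [G \o clamp a b]. Restricting this measure to []a, b]] makes it finite, hence the density
    integrable on the line. *)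
Lemma monotone_abs_cont_density (a b : R) (G : R -> R) : a < b ->
  {within `[a, b], continuous G} ->
  {in `[a, b] &, nondecreasing G} ->
  abs_cont_on_seqs a b G ->
  exists2 h : R -> R, mu.-integrable setT (EFin \o h) &
    forall x, x \in `[a, b] -> G x - G a = (\int[mu]_(t in `[a, x]) h t)%R.
Proof.
move=> ab cG ndG acG.
pose c := clamp a b.
have cab x : c x \in `[a, b].
  by rewrite in_itv/=; exact/clamp_itv/ltW.
have cnd : nondecreasing c := @clamp_nondecreasing _ a b.
have cid x : x \in `[a, b] -> c x = x by rewrite in_itv/=; exact: clamp_id.
pose F := G \o c.
have ndF : nondecreasing F by move=> x y xy; apply: ndG => //; exact: cnd.
have rcF : right_continuous F.
  by move=> x; apply: cvg_at_right_filter; exact: (continuous_comp_clamp (ltW ab) cG).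
pose cF : cumulative R R := HB.pack F (isCumulative.Build R _ R F ndF rcF).
have FE : (cF : R -> R) = F by [].
have domF : lebesgue_stieltjes_measure cF `<< mu.
  apply: abs_cont_dominated => eps eps0; rewrite FE.
  have [delta delta0 acd] := acG _ eps0.
  exists delta => // l lle lno ld.
  pose l' := [seq (c p.1, c p.2) | p <- l].
  have -> : \sum_(p <- l) (F p.2 - F p.1) = \sum_(p <- l') `|G p.2 - G p.1|.
    rewrite big_map !big_seq; apply: eq_bigr => p pl /=.
    by rewrite ger0_norm// subr_ge0; apply: (ndF); exact: lle.
  apply: acd.
  - move=> q /mapP[p pl ->] /=; have := cab p.1; have := cab p.2.
    by rewrite !in_itv/= => /andP[? ?] /andP[? ?]; split => //; apply: cnd; exact: lle.
  - rewrite pairwise_map; apply: sub_pairwise lno => p q /=.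
    by rewrite /nonoverlapping/= => /orP[/cnd->//|/cnd->]; rewrite orbT.
  - apply: le_lt_trans ld; rewrite big_map !big_seq; apply: ler_sum => p pl /=.
    exact/clamp_lipschitz/lle.
have mab : measurable (`]a, b]%classic : set (measurableTypeR R)) by [].
have LSitv x y : x <= y -> lebesgue_stieltjes_measure cF `]x, y]%classic = (F y - F x)%:E.
  move=> xy; rewrite /lebesgue_stieltjes_measure /measure_extension measurable_mu_extE/=; last exact: is_ocitv.
  by rewrite wlength_itv_bnd.
have fab : (lebesgue_stieltjes_measure cF `]a, b]%classic < +oo)%E.
  by rewrite LSitv ?ltry// ltW.
pose nu := mfrestr mab fab.
have domnu : nu `<< mu.
  apply/null_content_dominatesP => A mA muA0; rewrite /nu /mfrestr /mrestr.
  apply/eqP; rewrite eq_le measure_ge0 andbT.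
  move/null_content_dominatesP : domF => /(_ A mA muA0) <-.
  by apply: le_measure; rewrite ?inE//; exact: measurableI.
have [f [f0 ffin intf nuE]] := radon_nikodym_sigma_finite domnu.
exists (fine \o f).
  by apply: eq_integrable intf => // x _ /=; rewrite fineK.
move=> x xab; have /andP[ax xb] : a <= x <= b by move: xab; rewrite in_itv.
have -> : G x - G a = F x - F a by rewrite /F /= !cid// in_itv/= lexx ltW.
have nuax : nu `]a, x]%classic = (F x - F a)%:E.
  rewrite -LSitv// /nu /mfrestr /mrestr; congr (lebesgue_stieltjes_measure cF _).
  by rewrite setIidl//; apply: subset_itvl.
apply: EFin_inj; rewrite -nuax [LHS]nuE// /Rintegral fineK; last first.
  apply: integrable_fin_num => //; apply: (@eq_integrable _ _ _ _ _ _ f) => //.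
    by move=> t _ /=; rewrite fineK.
  exact: integrableS intf.
rewrite -(@integral_itv_obnd_cbnd _ a (BRight x)).
  by apply: eq_integral => t _; rewrite /= fineK.
have : measurable_fun `]a, x]%classic f by apply: measurable_funTS; exact: measurable_int intf.
by apply: eq_measurable_fun => t _; rewrite /= fineK.
Qed.

(** Turns a partition, as used by [variation], into a family of intervals to which absolute
    continuity applies. *)
Lemma itv_partition_zip (f : R -> R) (b x : R) s : path <%R x s ->
  let l := zip (x :: s) s in
  [/\ {in l, forall q, [/\ x <= q.1, q.1 <= q.2 & q.2 <= last x s]},
      pairwise nonoverlapping l,
      \sum_(q <- l) (q.2 - q.1) = last x s - x &
      \sum_(q <- l) `|f q.2 - f q.1| = variation x b f s].
Proof.
elim: s x => [|c s IH] x /=.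
  by move=> _; split => //; rewrite ?big_nil ?subrr// /variation big_nil.
move=> /andP[xc pcs]; have [IH1 IH2 IH3 IH4] := IH c pcs.
have cl : c <= last c s.
  by have := mem_last c s; rewrite inE => /predU1P[->//|]; move/(order_path_min lt_trans)/allP : pcs => H /H /ltW.
split.
- move=> q; rewrite inE => /predU1P[->/=|/IH1[cq q12 ql]]; first by rewrite lexx (ltW xc).
  by split => //; rewrite (le_trans (ltW xc)).
- rewrite IH2 andbT; apply/allP => q /IH1[cq _ _].
  by rewrite /nonoverlapping/= cq.
- by rewrite big_cons IH3/=; lra.
- by rewrite big_cons IH4/= /variation/= big_nat_recl.
Qed.

(** Induction on [l1]: for every partition of the first interval, the pieces are moved to [l2],
    where only increments are summed, and then the supremum over partitions is taken. The second
    list is what makes the induction hypothesis strong enough; the supremum turns the strict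
    inequality into a large one. *)
Lemma total_variation_family (a b eps delta : R) (f : R -> R) :
  (forall l : seq (R * R),
    {in l, forall p, [/\ a <= p.1, p.1 <= p.2 & p.2 <= b]} ->
    pairwise nonoverlapping l ->
    \sum_(p <- l) (p.2 - p.1) < delta ->
    \sum_(p <- l) `|f p.2 - f p.1| < eps) ->
  forall l1 l2 : seq (R * R),
    {in l1 ++ l2, forall p, [/\ a <= p.1, p.1 <= p.2 & p.2 <= b]} ->
    pairwise nonoverlapping (l1 ++ l2) ->
    \sum_(p <- l1 ++ l2) (p.2 - p.1) < delta ->
    (\sum_(p <- l1) total_variation p.1 p.2 f +
     (\sum_(p <- l2) `|f p.2 - f p.1|)%:E <= eps%:E)%E.
Proof.
move=> H; elim => [|p l1 IH] l2 lab lno ld.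
  by rewrite big_nil add0e lee_fin; apply/ltW/H.
have [ap p12 pb] : [/\ a <= p.1, p.1 <= p.2 & p.2 <= b] by apply: lab; rewrite mem_head.
move: lno; rewrite /= => /andP[pl lno].
have ld' : \sum_(q <- l1 ++ l2) (q.2 - q.1) < delta.
  by apply: le_lt_trans ld; rewrite big_cons lerDr subr_ge0.
have lab' : {in l1 ++ l2, forall p, [/\ a <= p.1, p.1 <= p.2 & p.2 <= b]}.
  by move=> q ql; apply: lab; rewrite inE ql orbT.
have IH2 := IH _ lab' lno ld'.
rewrite big_cons -addeA.
set S1 := (\sum_(q <- l1) _)%E in IH2 *.
set S2 := \sum_(q <- l2) _ in IH2 *.
have S10 : (0 <= S1)%E.
  rewrite /S1 big_seq; apply: sume_ge0 => q ql; apply: total_variation_ge0.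
  by have [] := lab' q; rewrite ?mem_cat ?ql.
have S1fin : S1 \is a fin_num.
  rewrite ge0_fin_numE//; apply: le_lt_trans (ltry eps); apply: le_trans IH2.
  by rewrite leeDl// lee_fin sumr_ge0.
rewrite -(fineK S1fin) -EFinD -leeBrDr//.
apply: ge_ereal_sup => _ [_ [s [ps /eqP ls] <-] <-].
have [Z1 Z2 Z3 Z4] := itv_partition_zip f p.2 ps.
rewrite lee_fin -Z4; move: Z1 Z2 Z3 Z4; set l := zip _ _ => Z1 Z2 Z3 Z4.
have := IH (l ++ l2); rewrite -/S1 -(fineK S1fin) -EFinD lee_fin lerBrDr.
rewrite [\sum_(q <- l ++ l2) `|_|]big_cat/= -/S2 addrCA => IHl; apply: IHl.
- move=> q; rewrite !mem_cat orbCA => /orP[/Z1[q1 q2 q3]|]; last by rewrite -mem_cat; exact: lab'.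
  by split => //; [exact: le_trans q1|rewrite (le_trans q3)// ls].
- have subno q r : q \in l -> r \in l1 ++ l2 -> nonoverlapping q r /\ nonoverlapping r q.
    move=> /Z1[q1 q2 q3] rl; have := allP pl _ rl; rewrite /nonoverlapping ls in q3 *.
    move=> /orP[pr|rp].
      by rewrite (le_trans q3 pr) orbT.
    by rewrite (le_trans rp q1) orbT.
  move: lno; rewrite !pairwise_cat => /and3P[l12 l1n l2n]; apply/and3P; split => //.
    apply/allrelP => q r ql; rewrite mem_cat => /orP[rl|rl].
      by have [] := subno r q rl; rewrite // mem_cat ql.
    by move/allrelP : l12; apply.
  apply/and3P; split => //; apply/allrelP => q r ql rl.
  by have [] := subno q r ql; rewrite // mem_cat rl orbT.
- move: ld; rewrite big_cons !big_cat/= Z3 ls.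
  by rewrite [X in X < _ -> _]addrCA.
Qed.

Lemma abs_cont_on_seqs_continuous (a b : R) (f : R -> R) :
  abs_cont_on_seqs a b f -> {within `[a, b], continuous f}.
Proof.
move=> acf; apply/subspace_continuousP => x; rewrite /= in_itv/= => /andP[ax xb].
apply/cvgrPdist_lt => e e0; have [d d0 H] := acf _ e0.
rewrite near_withinE; near=> y => /=; rewrite in_itv/= => /andP[ay yb].
have xyd : `|x - y| < d by near: y; exact: cvgr_dist_lt.
have [xy|yx] := leP x y.
  have := H [:: (x, y)]; rewrite !big_seq1/= distrC; apply => //.
    by move=> q; rewrite inE => /eqP ->.
  by rewrite -[_ - _]ger0_norm ?subr_ge0// distrC.
have := H [:: (y, x)]; rewrite !big_seq1/=; apply => //.
  by move=> q; rewrite inE => /eqP -> /=; split => //; exact: ltW.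
by rewrite -[_ - _]ger0_norm ?subr_ge0// ltW.
Unshelve. all: by end_near. Qed.

(** With d the modulus for eps = 1, each piece of length d / 2 has variation at most 1, and finitely
    many pieces cover [[a, x]]. *)
Lemma abs_cont_on_seqs_bounded_variation (a b : R) (f : R -> R) : a <= b ->
  abs_cont_on_seqs a b f ->
  forall x, a <= x <= b -> total_variation a x f \is a fin_num.
Proof.
move=> ab acf; have [d d0 H] := acf _ ltr01.
have {}H := total_variation_family H.
have TV1 x y : a <= x -> x <= y -> y <= b -> y - x < d -> (total_variation x y f <= 1)%E.
  move=> ax xy yb xyd; have := H [:: (x, y)] [::].
  rewrite !big_seq1 big_nil adde0; apply => //.
  by move=> q; rewrite inE => /eqP ->.
suff TVn n x : a <= x -> x <= b -> x - a <= n%:R * (d / 2) -> (total_variation a x f <= n%:R%:E)%E.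
  move=> x /andP[ax xb]; rewrite ge0_fin_numE ?total_variation_ge0//.
  have := TVn (Num.bound ((x - a) / (d / 2))) _ ax xb.
  rewrite -ler_pdivrMr ?divr_gt0// => TVx.
  by apply: le_lt_trans (TVx _) (ltry _); apply/ltW/archi_boundP; rewrite divr_ge0 ?subr_ge0// divr_ge0// ltW.
elim: n x => [|n IH] x ax xb xan.
  have -> : x = a by apply/eqP; rewrite eq_le ax andbT; move: xan; rewrite mul0r subr_le0.
  by rewrite total_variationxx.
have [xd|dx] := leP (x - a) (d / 2).
  rewrite (le_trans (TV1 _ _ _ ax xb _))// ?lee_fin ?ler1n//.
  by rewrite (le_lt_trans xd)// ltr_pdivrMr// mulr_natr mulr2n ltrDl.
rewrite (@total_variationD _ a x (x - d / 2)); [|lra..].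
have -> : (n.+1%:R)%:E = ((n%:R)%:E + 1 :> \bar R)%E by rewrite -natr1 EFinD.
rewrite leeD//.
  by apply: IH; move: xan; rewrite -natr1; lra.
by apply: TV1; lra.
Qed.

Lemma abs_cont_on_seqs_total_variation (a b : R) (f : R -> R) : a <= b ->
  abs_cont_on_seqs a b f ->
  abs_cont_on_seqs a b (fun x => fine (total_variation a x f)).
Proof.
move=> ab acf e e0; have e20 : 0 < e / 2 by rewrite divr_gt0.
have TVfin := abs_cont_on_seqs_bounded_variation ab acf.
have [d d0 H] := acf _ e20; exists d => // l lab lno ld.
have := total_variation_family H (l1 := l) (l2 := [::]); rewrite cats0 big_nil adde0.
move=> /(_ lab lno ld) TVl.
rewrite -lte_fin; apply: (@le_lt_trans _ _ (e / 2)%:E); last by rewrite lte_fin ltr_pdivrMr// mulr_natr mulr2n ltrDl.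
apply: le_trans TVl; rewrite -sumEFin !big_seq; apply: lee_sum => q /lab[aq q12 qb].
have q1 : a <= q.1 <= b by rewrite aq (le_trans q12).
have q2 : a <= q.2 <= b by rewrite qb (le_trans aq).
have TVE := total_variationD f aq q12.
have TVq : total_variation q.1 q.2 f \is a fin_num.
  by have := TVfin _ q2; rewrite TVE fin_numD => /andP[].
rewrite TVE fineD ?TVfin// addrC addKr ger0_norm ?fineK//.
by apply: fine_ge0; exact: total_variation_ge0.
Qed.

Lemma abs_cont_on_seqsB (a b : R) (f g : R -> R) :
  abs_cont_on_seqs a b f -> abs_cont_on_seqs a b g ->
  abs_cont_on_seqs a b (fun x => f x - g x).
Proof.
move=> acf acg e e0; have e20 : 0 < e / 2 by rewrite divr_gt0.
have [d1 d10 H1] := acf _ e20; have [d2 d20 H2] := acg _ e20.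
exists (Num.min d1 d2); first by rewrite lt_min d10.
move=> l lab lno; rewrite lt_min => /andP[l1 l2].
have {}H1 := H1 l lab lno l1; have {}H2 := H2 l lab lno l2.
rewrite (splitr e); apply: le_lt_trans (ltrD H1 H2).
rewrite -big_split/=; apply: ler_sum => q _.
rewrite (_ : _ - _ - _ = (f q.2 - f q.1) - (g q.2 - g q.1)); first exact: ler_normB.
by ring.
Qed.

(** Jordan decomposition: with V the total variation on [[a, x]], f = V - (V - f) is a difference of
    nondecreasing absolutely continuous functions, each of which has a density. *)
Lemma abs_cont_integral (a b : R) (f : R -> R) : a < b -> abs_cont a b f ->
  exists2 h : R -> R, mu.-integrable setT (EFin \o h) &
    forall x, a <= x <= b -> f x - f a = (\int[mu]_(t in `[a, x]) h t)%R.
Proof.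
move=> ab /abs_cont_seq acf.
have acV := abs_cont_on_seqs_total_variation (ltW ab) acf.
have TVfin := abs_cont_on_seqs_bounded_variation (ltW ab) acf.
pose V x := fine (total_variation a x f); rewrite -/V in acV.
have acW : abs_cont_on_seqs a b (fun x => V x - f x) by exact: abs_cont_on_seqsB.
have Vinc x y : a <= x -> x <= y -> y <= b -> `|f y - f x| <= V y - V x.
  move=> ax xy yb; rewrite /V.
  have TVy : total_variation a y f \is a fin_num by apply: TVfin; rewrite yb (le_trans ax).
  have TVx : total_variation a x f \is a fin_num by apply: TVfin; rewrite ax (le_trans xy).
  rewrite -lee_fin EFinB !fineK// (total_variationD f ax xy) addeAC subee// add0e.
  exact: total_variation_ge.
have ndV : {in `[a, b] &, nondecreasing V}.
  move=> x y; rewrite !in_itv/= => /andP[ax _] /andP[_ yb] xy.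
  by rewrite -subr_ge0 (le_trans _ (Vinc _ _ ax xy yb)).
have ndW : {in `[a, b] &, nondecreasing (fun x => V x - f x)}.
  move=> x y; rewrite !in_itv/= => /andP[ax _] /andP[_ yb] xy.
  have := le_trans (ler_norm _) (Vinc _ _ ax xy yb).
  lra.
have [h1 ih1 h1E] := monotone_abs_cont_density ab (abs_cont_on_seqs_continuous acV) ndV acV.
have [h2 ih2 h2E] := monotone_abs_cont_density ab (abs_cont_on_seqs_continuous acW) ndW acW.
exists (h1 \- h2).
  by have := integrableB measurableT ih1 ih2; apply: eq_integrable.
move=> x axb; rewrite RintegralB//; [|exact: integrableS ih1|exact: integrableS ih2].
by rewrite -h1E ?in_itv// -h2E ?in_itv//; lra.
Qed.

End absolute_continuity.

(** * Differential calculus along filters *)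

Section integral_without_measurability.
Context {d : measure_display} {T : measurableType d} {R : realType}.
Variable mu : {measure set T -> \bar R}.
Import HBNNSimple.
Local Open Scope ereal_scope.
Implicit Types f g : T -> \bar R.

(* The integral of an arbitrary nonnegative function is a supremum over the
   simple functions below it, and these may be cut off on a null set. *)
Lemma ge0_ae_le_integralT f g : (forall x, 0 <= f x) -> (forall x, 0 <= g x) ->
  {ae mu, forall x, f x <= g x} -> \int[mu]_x f x <= \int[mu]_x g x.
Proof.
move=> f0 g0 [N [mN muN0 Nfg]].
rewrite (ge0_integralTE mu f0) (ge0_integralTE mu g0).
apply: ge_ereal_sup => _ /= [h hf <-].
apply: ereal_sup_ubound => /=.
exists (proj_nnsfun h (measurableC mN)).
  move=> x; rewrite -mrestrict patchE; case: ifPn => // /set_mem Nx.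
  have [fg|nfg] := pselect (f x <= g x); first exact: le_trans (hf x) fg.
  by exfalso; apply: Nx; exact: Nfg.
rewrite -!integralT_nnsfun; apply: ge0_ae_eq_integral => //.
- by apply/measurable_EFinP; exact: measurable_funPT.
- by apply/measurable_EFinP; exact: measurable_funPT.
- by move=> x _; rewrite lee_fin.
- by move=> x _; rewrite lee_fin.
exists N; split => // x /= H; apply: contrapT => Nx; apply: H => _.
by rewrite mindicE mem_set// mulr1.
Qed.

Lemma ge0_ae_le_integral (D E : set T) f g :
  (forall x, D x -> 0 <= f x) -> (forall x, E x -> 0 <= g x) ->
  {ae mu, forall x, D x -> E x /\ f x <= g x} ->
  \int[mu]_(x in D) f x <= \int[mu]_(x in E) g x.
Proof.
move=> f0 g0 fg; rewrite integral_mkcond [leRHS]integral_mkcond.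
apply: ge0_ae_le_integralT.
- by move=> x; rewrite patchE; case: ifPn => // /set_mem /f0.
- by move=> x; rewrite patchE; case: ifPn => // /set_mem /g0.
apply: filterS fg => x fg; rewrite patchE; case: ifPn => [/set_mem /fg[Ex fgx]|_].
  by rewrite patchE mem_set.
by rewrite patchE; case: ifPn => // /set_mem /g0.
Qed.

(** The positive parts, and the negative parts, are compared in both directions; neither the domains
    nor the functions need be measurable. *)
Lemma ae_eq_integral_restrict (D E : set T) f g :
  {ae mu, forall x, (f \_ D) x = (g \_ E) x} ->
  \int[mu]_(x in D) f x = \int[mu]_(x in E) g x.
Proof.
move=> fg; rewrite integral_mkcond [RHS]integral_mkcond integralE [RHS]integralE.
congr (_ - _); apply/eqP; rewrite eq_le; apply/andP; split;
  apply: ge0_ae_le_integralT => //; apply: filterS fg => x fg.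
- by rewrite funeposE [leRHS]funeposE fg.
- by rewrite funeposE [leRHS]funeposE fg.
- by rewrite funenegE [leRHS]funenegE fg.
- by rewrite funenegE [leRHS]funenegE fg.
Qed.

End integral_without_measurability.

Section row_vectors.
Context {R : realType} {n : nat}.
Implicit Types x y : 'rV[R]_n.

Lemma norm_coord_le x i : `|x 0 i| <= `|x|.
Proof.
rewrite -[leRHS]/(mx_norm x) mx_normrE.
exact: (le_bigmax _ (fun ij : 'I_1 * 'I_n => `|x ij.1 ij.2|) (0, i)).
Qed.

Lemma norm_le_coord x (e : R) : 0 <= e -> (forall i, `|x 0 i| <= e) -> `|x| <= e.
Proof.
move=> e0 H; rewrite -[leLHS]/(mx_norm x) mx_normrE; apply: bigmax_le => // -[i j] _ /=.
by rewrite ord1.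
Qed.

Lemma cvg_row (T : Type) (F : set_system T) {FF : Filter F} (f : T -> 'rV[R]_n)
    (l : 'rV[R]_n) :
  (forall i, f t 0 i @[t --> F] --> l 0 i) -> f t @[t --> F] --> l.
Proof.
move=> H; apply/cvgrPdist_le => e e0.
have : \forall t \near F, forall i, `|l 0 i - f t 0 i| <= e.
  by apply: filter_forall => i; move/cvgrPdist_le : (H i); exact.
apply: filterS => t Ht; apply: norm_le_coord; first exact: ltW.
by move=> i; rewrite !mxE.
Qed.

Lemma cvg_coord (T : Type) (F : set_system T) {FF : Filter F} (f : T -> 'rV[R]_n)
    (l : 'rV[R]_n) i :
  f t @[t --> F] --> l -> f t 0 i @[t --> F] --> l 0 i.
Proof.
by move=> fl; apply: (@cvg_comp _ _ _ f (fun x : 'rV[R]_n => x 0 i) _ _ _ fl); exact: coord_continuous.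
Qed.

Lemma continuous_at_coord (T : topologicalType) (f : T -> 'rV[R]_n) (y : T) i :
  {for y, continuous f} -> {for y, continuous (fun z => f z 0 i)}.
Proof. by move=> fy; apply: cvg_coord; exact: fy. Qed.

Lemma continuous_at_row (T : topologicalType) (f : T -> 'rV[R]_n) (y : T) :
  (forall i, {for y, continuous (fun z => f z 0 i)}) -> {for y, continuous f}.
Proof. by move=> fy; apply: cvg_row; exact: fy. Qed.

Lemma row_expand x : x = \sum_i x 0 i *: delta_mx 0 i.
Proof. by rewrite -row_sum_delta. Qed.

End row_vectors.

Lemma cvg_near_eq (T : Type) (U : nbhsType) (F : set_system T) {FF : Filter F}
    (f g : T -> U) (l : U) :
  (\forall t \near F, f t = g t) -> f t @[t --> F] --> l -> g t @[t --> F] --> l.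
Proof. by move=> fg; apply: cvg_trans; exact: near_eq_cvg. Qed.

Section slopes.
Context {R : realType}.

Definition slope (V : normedModType R) (f : R -> V) (s t : R) : V :=
  (t - s)^-1 *: (f t - f s).

(** The rules of calculus below hold along any proper filter of this kind. They thus cover at once
    the two-sided filter [s^'] and its trace on [[0, 1]], which defines [deriv01] and is one-sided
    at 0 and 1. *)
Definition punctured_at (s : R) (F : set_system R) :=
  (t @[t --> F] --> s) /\ \forall t \near F, t != s.

Context (s : R) (F : set_system R) {FF : ProperFilter F}.
Hypothesis Fs : punctured_at s F.

Lemma slope_eq (V : normedModType R) (f g : R -> V) (l : V) :
  (\forall t \near F, f t = g t) -> f s = g s ->
  slope f s t @[t --> F] --> l -> slope g s t @[t --> F] --> l.
Proof.
move=> fg fgs; apply: cvg_near_eq.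
by apply: filterS fg => t fgt; rewrite /slope fgs fgt.
Qed.

Lemma slope_continuous (V : normedModType R) (f : R -> V) (l : V) :
  slope f s t @[t --> F] --> l -> f t @[t --> F] --> f s.
Proof.
move=> fl; have [Fcv Fne] := Fs.
have H : (t - s) *: slope f s t + f s @[t --> F] --> (s - s) *: l + f s.
  by apply: cvgD (cvg_cst _); apply: cvgZ => //; apply: cvgB => //; exact: cvg_cst.
rewrite subrr scale0r add0r in H; apply: cvg_near_eq H.
apply: filterS Fne => t ts.
by rewrite /slope scalerA divff ?subr_eq0// scale1r subrK.
Qed.

Lemma slope_comp (V W : normedModType R) (f : R -> V) (tau : V -> W) (l : V) :
  slope f s t @[t --> F] --> l -> differentiable tau (f s) ->
  slope (tau \o f) s t @[t --> F] --> 'D_l tau (f s).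
Proof.
move=> fl dtau; rewrite deriveE//.
have [Fcv Fne] := Fs.
have dc : {for l, continuous ('d tau (f s))} by apply: diff_continuous.
have := diff_locally dtau; set o := (X in _ + X) => tauE.
have tauE' t : tau (f t) - tau (f s) = 'd tau (f s) (f t - f s) + o (f t - f s).
  have := congr1 (fun h => h (f t - f s)) tauE.
  rewrite /= subrK => ->.
  by rewrite /cst/= !fctE; rewrite -addrA addrC addrK.
have S1 : 'd tau (f s) (slope f s t) @[t --> F] --> 'd tau (f s) l.
  exact: (cvg_comp _ _ fl dc).
(* The slopes of f are eventually bounded by [|l| + 1], so a little-o of f t - f s is also one of t
   - s. *)
have S2 : (t - s)^-1 *: o (f t - f s) @[t --> F] --> (0 : W).
  have fcv := slope_continuous fl.
  have fcv0 : f t - f s @[t --> F] --> (0 : V).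
    by rewrite -(subrr (f s)); apply: cvgB => //; exact: cvg_cst.
  have bl : \forall t \near F, `|slope f s t| <= `|l| + 1.
    have fln : `|slope f s t| @[t --> F] --> `|l| by exact: cvg_norm.
    move/cvgrPdist_le : fln => /(_ _ ltr01); apply: filterS => t.
    by rewrite ler_distlC => /andP[_].
  apply/cvgr0Pnorm_le => e e0; have l1 : 0 < `|l| + 1 by rewrite ltr_wpDl.
  have : \forall h \near (0 : V), `|o h| <= e / (`|l| + 1) * `|h|.
    by apply: (littleoP [littleo of o]); rewrite divr_gt0.
  move=> /fcv0 H; near=> t.
  have ts : t - s != 0 by rewrite subr_eq0; near: t.
  have H1 : `|o (f t - f s)| <= e / (`|l| + 1) * `|f t - f s| by near: t.
  rewrite normrZ normfV ler_pdivrMl ?normr_gt0// (le_trans H1)//.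
  have -> : f t - f s = (t - s) *: slope f s t by rewrite /slope scalerA divff// scale1r.
  rewrite normrZ mulrCA ler_pM2l ?normr_gt0// -mulrA ler_piMr ?(ltW e0)//.
  rewrite ler_pdivrMl// mulr1; near: t; exact: bl.
have S3 : 'd tau (f s) (slope f s t) + (t - s)^-1 *: o (f t - f s) @[t --> F] -->
    'd tau (f s) l by rewrite -[X in _ --> X]addr0; exact: cvgD.
apply: cvg_near_eq S3; near=> t; rewrite /= {2}/slope [(tau \o f) t - _]tauE' [RHS]scalerDr.
by rewrite -[in RHS]linearZ.
Unshelve. all: by end_near. Qed.

Lemma slopeD (V : normedModType R) (f g : R -> V) (l k : V) :
  slope f s t @[t --> F] --> l -> slope g s t @[t --> F] --> k ->
  slope (fun t => f t + g t) s t @[t --> F] --> l + k.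
Proof.
move=> fl gk; apply: cvg_near_eq (cvgD fl gk); near=> t.
by rewrite -[LHS]/(slope f s t + slope g s t) /slope -scalerDr opprD addrACA.
Unshelve. all: by end_near. Qed.

Lemma slope_cst (V : normedModType R) (v : V) :
  slope (fun=> v) s t @[t --> F] --> (0 : V).
Proof.
apply: cvg_near_eq (cvg_cst _); near=> t.
by rewrite /slope subrr scaler0.
Unshelve. all: by end_near. Qed.

Lemma slope_sum (I : finType) (V : normedModType R) (f : I -> R -> V) (l : I -> V) :
  (forall i, slope (f i) s t @[t --> F] --> l i) ->
  slope (fun t => \sum_i f i t) s t @[t --> F] --> \sum_i l i.
Proof.
move=> fl.
have : \sum_i slope (f i) s t @[t --> F] --> \sum_i l i by apply: cvg_big => //; exact: add_continuous.
apply: cvg_near_eq; near=> t.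
by rewrite /slope -scaler_sumr sumrB.
Unshelve. all: by end_near. Qed.

Lemma slopeZ (V : normedModType R) (c : R -> R) (f : R -> V) (k : R) (l : V) :
  slope (V := R) c s t @[t --> F] --> k -> slope f s t @[t --> F] --> l ->
  slope (fun t => c t *: f t) s t @[t --> F] --> k *: f s + c s *: l.
Proof.
move=> ck fl; have cc := slope_continuous ck; have fc := slope_continuous fl.
have H : slope (V := R) c s t *: f t + c s *: slope f s t @[t --> F] --> k *: f s + c s *: l.
  by apply: cvgD; [apply: cvgZ|apply: cvgZr].
apply: cvg_near_eq H; near=> t.
rewrite -[LHS]/(_ + _) /slope -scalerA [c s *: _]scalerA mulrC -scalerA -scalerDr.
by rewrite scalerBl scalerBr addrA subrK.
Unshelve. all: by end_near. Qed.

Lemma slope_row n (f : R -> 'rV[R]_n) (l : 'rV[R]_n) :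
  (forall i, slope (V := R) (fun t => f t 0 i) s t @[t --> F] --> l 0 i) ->
  slope f s t @[t --> F] --> l.
Proof.
move=> fl; apply: cvg_row => i; apply: cvg_near_eq (fl i); near=> t.
by rewrite /slope !mxE.
Unshelve. all: by end_near. Qed.

Lemma slope_coord n (f : R -> 'rV[R]_n) (l : 'rV[R]_n) i :
  slope f s t @[t --> F] --> l ->
  slope (V := R) (fun t => f t 0 i) s t @[t --> F] --> l 0 i.
Proof.
move=> /cvg_coord-/(_ i); apply: cvg_near_eq; near=> t.
by rewrite /slope !mxE.
Unshelve. all: by end_near. Qed.

End slopes.

Section slopes01.
Context {R : realType}.
Implicit Types s : R.

Lemma punctured_at_dnbhs s : punctured_at s s^'.
Proof.
by split; [exact: cvg_within|exact: nbhs_dnbhs_neq].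
Qed.

Lemma punctured_at_within01 s : punctured_at s (within `[0, 1] s^').
Proof.
have [Fs Fne] := punctured_at_dnbhs s.
by split; [apply: cvg_trans Fs; apply: cvg_fmap2; exact: cvg_within|exact: cvg_within].
Qed.

Lemma within01_proper s : 0 <= s <= 1 -> ProperFilter (within `[0, 1] s^').
Proof.
move=> /andP[s0 s1]; apply: Build_ProperFilter_ex => P.
rewrite /within/= => -[e /= e0 H].
have e20 : 0 < Num.min (e / 2) (1 / 2) by rewrite lt_min !divr_gt0.
have ee : Num.min (e / 2) (1 / 2) < e.
  by rewrite gt_min ltr_pdivrMr// mulr_natr mulr2n ltrDl e0.
have e1 : Num.min (e / 2) (1 / 2) <= 1 / 2 by rewrite ge_min lexx orbT.
(* A step of length at most 1/2 towards the farther endpoint stays in [[0, 1]]. *)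
have [s12|s12] := leP s (1 / 2).
  exists (s + Num.min (e / 2) (1 / 2)); apply: H => /=.
  - by rewrite opprD addNKr normrN gtr0_norm.
  - by rewrite -subr_eq0 addrAC subrr add0r gt_eqF.
  - by rewrite in_itv/=; lra.
exists (s - Num.min (e / 2) (1 / 2)); apply: H => /=.
- by rewrite opprB addrC subrK gtr0_norm.
- by rewrite -subr_eq0 addrAC subrr add0r oppr_eq0 gt_eqF.
- by rewrite in_itv/=; lra.
Qed.

Lemma deriv01_slope (V : normedModType R) (f : R -> V) s l : 0 <= s <= 1 ->
  slope f s t @[t --> within `[0, 1] s^'] --> l ->
  derivable01 f s /\ deriv01 f s = l.
Proof.
move=> s01 fl; have pF := within01_proper s01.
split; first by apply/cvg_ex; exists l.
by apply: cvg_lim => //; exact: norm_hausdorff.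
Qed.

Lemma derivable01_slope (V : normedModType R) (f : R -> V) s :
  derivable01 f s ->
  slope f s t @[t --> within `[0, 1] s^'] --> deriv01 f s.
Proof. by []. Qed.

Lemma slope_within01 (V : normedModType R) (f : R -> V) s (l : V) :
  slope f s t @[t --> s^'] --> l -> slope f s t @[t --> within `[0, 1] s^'] --> l.
Proof. by apply: cvg_trans; apply: cvg_fmap2; exact: cvg_within. Qed.

Lemma is_derive_slope (f : R -> R) s l :
  is_derive s 1 f l -> slope (V := R) f s t @[t --> s^'] --> l.
Proof.
move=> [df <-].
have H : h^-1 *: ((f \o shift s) (h *: 1) - f s) @[h --> 0^'] --> 'D_1 f s by [].
have Hs : t - s @[t --> s^'] --> 0^'.
  move=> P [e /= e0 HP]; exists e => //= t te ts; apply: HP => /=.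
    by rewrite sub0r normrN distrC.
  by rewrite subr_eq0.
apply: cvg_near_eq (cvg_comp _ _ Hs H); near=> t => /=.
by rewrite /slope /= /shift /= [_ *: 1]mulr1 subrK.
Unshelve. all: by end_near. Qed.

End slopes01.

Section calculus.
Context {R : realType}.

Lemma near_dist_le (V W : normedModType R) (f : V -> W) (x : V) (e : R) :
  {for x, continuous f} -> 0 < e -> \forall y \near x, `|f x - f y| <= e.
Proof. by move=> /cvgrPdist_le; exact. Qed.

Lemma derive_basis n (W : normedModType R) (f : 'rV[R]_n.+1 -> W) (y w : 'rV[R]_n.+1) :
  differentiable f y ->
  'D_w f y = \sum_i w 0 i *: 'D_(delta_mx 0 i) f y.
Proof.
move=> df; rewrite deriveE// {1}(row_expand w) linear_sum.
by apply: eq_bigr => i _; rewrite linearZ -deriveE.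
Qed.

Lemma is_derive_line (V : normedModType R) (f : V -> R) (x u : V) (t l : R) :
  is_derive (x + t *: u) u f l ->
  is_derive t 1 (fun r => f (x + r *: u)) l.
Proof.
move=> [df dl].
have E : (fun h : R => h^-1 *: (((fun r => f (x + r *: u)) \o shift t) (h *: 1) - f (x + t *: u)))
   = (fun h : R => h^-1 *: ((f \o shift (x + t *: u)) (h *: u) - f (x + t *: u))).
  apply/funext => h /=; rewrite /shift/= [_ *: 1]mulr1 scalerDl.
  by rewrite addrCA.
by split; rewrite /derivable /derive E.
Qed.

Lemma MVT_closed (p dp : R -> R) (a b : R) : a < b ->
  (forall s, a <= s <= b -> is_derive s 1 p (dp s)) ->
  exists2 c, a <= c <= b & p b - p a = dp c * (b - a).
Proof.
move=> ab H; have [c cab cE] : exists2 c, c \in `]a, b[ & p b - p a = dp c * (b - a).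
  apply: MVT => //.
    by move=> s /subset_itv_oo_cc; rewrite /= in_itv; exact: H.
  apply: derivable_within_continuous => s; rewrite in_itv/= => /H ?.
  exact: ex_derive.
by exists c => //; move/subset_itv_oo_cc : cab; rewrite /= in_itv.
Qed.

Lemma second_difference_MVT (V : normedModType R) (f fu fuw : V -> R) (x u w : V) (h : R) :
  0 < h ->
  (forall s t, 0 <= s <= h -> 0 <= t <= h ->
     is_derive (x + s *: u + t *: w) u f (fu (x + s *: u + t *: w)) /\
     is_derive (x + s *: u + t *: w) w fu (fuw (x + s *: u + t *: w))) ->
  exists s t, [/\ 0 <= s <= h, 0 <= t <= h &
   f (x + h *: u + h *: w) - f (x + h *: u) - (f (x + h *: w) - f x) =
   fuw (x + s *: u + t *: w) * h ^+ 2].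
Proof.
move=> h0 df.
have hh : 0 <= h <= h by rewrite lexx ltW.
have h00 : 0 <= (0 : R) <= h by rewrite lexx ltW.
pose p (s : R) := f (x + h *: w + s *: u) - f (x + s *: u).
have dp (s : R) : 0 <= s <= h -> is_derive s (1 : R) p
    (fu (x + s *: u + h *: w) - fu (x + s *: u)).
  move=> sh; apply: is_deriveB.
    by apply: is_derive_line; rewrite addrAC; exact: (df _ _ sh hh).1.
  by apply: is_derive_line; have := (df s 0 sh h00).1; rewrite scale0r addr0.
have [s sI sE] := MVT_closed h0 dp.
pose q (t : R) := fu (x + s *: u + t *: w).
have dq (t : R) : 0 <= t <= h -> is_derive t (1 : R) q (fuw (x + s *: u + t *: w)).
  by move=> th; apply: is_derive_line; exact: (df _ _ sI th).2.
have [t tI tE] := MVT_closed h0 dq.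
exists s, t; split => //.
move: sE tE; rewrite /p /q !scale0r !addr0 !subr0 => sE tE.
rewrite expr2 mulrA -tE -sE.
by rewrite [x + h *: u + _]addrAC.
Qed.

(** The second difference over the parallelogram spanned by h u and h w is symmetric in u and w. By
    [second_difference_MVT] it equals h^2 times either mixed derivative at points close to x.
    Symmetry has to be proved because [Ck_on] speaks of iterated directional derivatives only. *)
Lemma derive_schwarz (V : normedModType R) (f fu fw fuw fwu : V -> R) (A : set V)
    (x u w : V) : open A -> A x ->
  (forall y, A y -> is_derive y u f (fu y) /\ is_derive y w fu (fuw y)) ->
  (forall y, A y -> is_derive y w f (fw y) /\ is_derive y u fw (fwu y)) ->
  {for x, continuous fuw} -> {for x, continuous fwu} -> fuw x = fwu x.
Proof.
move=> oA Ax dfu dfw cuw cwu; apply/eqP; rewrite -subr_eq0 -normr_le0.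
apply/ler_addgt0Pr => e e0; rewrite add0r.
have e20 : 0 < e / 2 by rewrite divr_gt0.
have H : \forall y \near x, [/\ A y,
  `|fuw x - fuw y| <= e / 2 & `|fwu x - fwu y| <= e / 2].
  have H1 := near_dist_le cuw e20; have H2 := near_dist_le cwu e20.
  have H3 : \forall y \near x, A y by exact: open_nbhs_nbhs.
  by apply: filterS3 H3 H1 H2.
have /nbhs_ballP[r /= r0 Hr] := H.
(* With this h the parallelogram lies in the ball of radius r around x; the summand 1 keeps the
   denominator positive. *)
pose h := r / (`|u| + `|w| + 1).
have uw0 : 0 < `|u| + `|w| + 1 by rewrite ltr_wpDl// addr_ge0.
have h0 : 0 < h by rewrite divr_gt0.
have ball_h s t : 0 <= s <= h -> 0 <= t <= h -> ball x r (x + s *: u + t *: w).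
  move=> /andP[s0 sh] /andP[t0 th]; rewrite -ball_normE /=.
  rewrite -addrA opprD addNKr normrN (le_lt_trans (ler_normD _ _))// !normrZ !ger0_norm//.
  have : s * `|u| + t * `|w| <= h * (`|u| + `|w|) by rewrite mulrDr lerD// ler_wpM2r.
  move=> /le_lt_trans; apply; rewrite /h mulrAC ltr_pdivrMr// ltr_pM2l//.
  by rewrite ltrDl.
have ball_h' s t : 0 <= s <= h -> 0 <= t <= h -> ball x r (x + s *: w + t *: u).
  by move=> sh th; rewrite addrAC; exact: ball_h.
have [s t sh th|s [t [sh th E1]]] := @second_difference_MVT V f fu fuw x u w h h0.
  by apply: dfu; have [] := Hr _ (ball_h s t sh th).
have [s' t' sh' th'|s' [t' [sh' th' E2]]] := @second_difference_MVT V f fw fwu x w u h h0.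
  by apply: dfw; have [] := Hr _ (ball_h' s' t' sh' th').
have [_ H1 _] := Hr _ (ball_h s t sh th).
have [_ _ H2] := Hr _ (ball_h' s' t' sh' th').
have h20 : h ^+ 2 != 0 by rewrite expf_neq0// gt_eqF.
have ab : fuw (x + s *: u + t *: w) = fwu (x + s' *: w + t' *: u).
  apply: (mulIf h20); rewrite -E1 -E2 [x + h *: w + _]addrAC; ring.
rewrite ab in H1; rewrite (splitr e).
rewrite (le_trans (ler_distD (fwu (x + s' *: w + t' *: u)) _ _))// lerD//.
by rewrite distrC.
Qed.

Lemma is_derive_coord n (V : normedModType R) (f : V -> 'rV[R]_n) (y v : V) i :
  derivable f y v -> is_derive y v (fun y => f y 0 i) (('D_v f y) 0 i).
Proof.
move=> df; split; last by rewrite derive_mx// mxE.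
by have /derivable_mxP := df; exact.
Qed.

Lemma smooth_derive_comm n p (f : 'rV[R]_n -> 'rV[R]_p) (A : set 'rV[R]_n)
    (y u w : 'rV[R]_n) : open A -> smooth_on A f -> A y ->
  'D_w (fun y => 'D_u f y) y = 'D_u (fun y => 'D_w f y) y.
Proof.
move=> oA sf Ay; apply/rowP => i.
have df z v : A z -> derivable f z v by move=> Az; apply: diff_derivable; apply: (sf 1%N).1.
have ddf z v v' : A z -> derivable (fun y => 'D_v f y) z v'.
  by move=> Az; apply: diff_derivable; apply: ((sf 2%N).2 v).1.
have cdf v v' : {for y, continuous (fun y => ('D_v' (fun y => 'D_v f y) y) 0 i)}.
  by apply: continuous_at_coord; exact: ((sf 2%N).2 v).2 v' y Ay.
apply: (derive_schwarz oA Ay _ _ (cdf u w) (cdf w u)) => z Az;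
  by split; apply: is_derive_coord; [exact: df|exact: ddf].
Qed.

(** The mean value theorem is applied on a segment of a ball, which is convex, to one coordinate of
    f at a time; C sums bounds of the partial derivatives, which are locally bounded by
    continuity. *)
Lemma C1_locally_lipschitz n p (f : 'rV[R]_n.+1 -> 'rV[R]_p) (A : set 'rV[R]_n.+1)
    (y0 : 'rV[R]_n.+1) : open A -> Ck_on 1 A f -> A y0 ->
  exists r C : R, [/\ 0 < r, 0 <= C & forall y1 y2, ball y0 r y1 -> ball y0 r y2 ->
    `|f y2 - f y1| <= C * `|y2 - y1|].
Proof.
move=> oA [df cf] Ay0.
have H : \forall y \near y0, A y /\ forall i, `|'D_(delta_mx 0 i) f y| <= `|'D_(delta_mx 0 i) f y0| + 1.
  near=> y; split; first by near: y; exact: open_nbhs_nbhs.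
  near: y; apply: filter_forall => i.
  have := cf (delta_mx 0 i) _ Ay0 => /cvg_norm /cvgrPdist_le /(_ _ ltr01).
  by apply: filterS => y; rewrite ler_distlC => /andP[].
have /nbhs_ballP[r /= r0 Hr] := H.
pose C := \sum_i (`|'D_(delta_mx 0 i) f y0| + 1).
exists r, C; split => //; first by apply: sumr_ge0 => i _; rewrite addr_ge0.
move=> y1 y2 y1r y2r; apply: norm_le_coord => [|j].
  by rewrite mulr_ge0// sumr_ge0// => i _; rewrite addr_ge0.
have seg t : 0 <= t <= 1 -> ball y0 r (y1 + t *: (y2 - y1)).
  move=> /andP[t0 t1]; rewrite -ball_normE /=.
  have -> : y0 - (y1 + t *: (y2 - y1)) = (1 - t) *: (y0 - y1) + t *: (y0 - y2).
    rewrite !scalerBr !scalerBl !scale1r; apply/rowP => k; rewrite !mxE; ring.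
  have n1 : `|y0 - y1| < r by move: y1r; rewrite -ball_normE.
  have n2 : `|y0 - y2| < r by move: y2r; rewrite -ball_normE.
  rewrite (le_lt_trans (ler_normD _ _))// !normrZ !ger0_norm ?subr_ge0//.
  have [->|tn0] := eqVneq t 0; first by rewrite subr0 mul1r mul0r addr0.
  have t0' : 0 < t by rewrite lt_neqAle eq_sym tn0.
  have : t * `|y0 - y2| < t * r by rewrite ltr_pM2l.
  have : (1 - t) * `|y0 - y1| <= (1 - t) * r by rewrite ler_wpM2l ?subr_ge0// ltW.
  lra.
pose q t := f (y1 + t *: (y2 - y1)) 0 j.
have dq (t : R) : 0 <= t <= 1 -> is_derive t (1 : R) q (('D_(y2 - y1) f (y1 + t *: (y2 - y1))) 0 j).
  move=> /seg /Hr [Az _].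
  by apply: (@is_derive_line _ (fun z => f z 0 j)); exact/is_derive_coord/diff_derivable/df.
have [c cI] := MVT_closed ltr01 dq.
rewrite /q scale1r scale0r addr0 subr0 mulr1 [y1 + _]addrC subrK !mxE => ->.
have [Az bz] := Hr _ (seg c cI).
have -> : ('D_(y2 - y1) f (y1 + c *: (y2 - y1))) 0 j =
    \sum_i (y2 - y1) 0 i * ('D_(delta_mx 0 i) f (y1 + c *: (y2 - y1))) 0 j.
  transitivity ((\sum_i ((y2 - y1) 0 i *: 'D_(delta_mx 0 i) f (y1 + c *: (y2 - y1)) : 'rV[R]_p)) 0 j).
    by rewrite derive_basis//; exact: df.
  by rewrite summxE; apply: eq_bigr => i _; rewrite mxE.
rewrite (le_trans (ler_norm_sum _ _ _))// /C mulr_suml ler_sum// => i _.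
rewrite normrM mulrC ler_pM//.
  by rewrite (le_trans _ (bz i))// norm_coord_le.
by rewrite (le_trans _ (norm_coord_le _ i))// !mxE.
Unshelve. all: by end_near. Qed.

End calculus.

(** * Changes of charts *)

Section derive_pairs.
Context {R : realType}.
Implicit Types V W U : normedModType R.

Let quotient_pair_fst V W U (f : V * W -> U) (y u : V) (w : W) :
  (fun h : R => h^-1 *: ((f \o shift (y, w)) (h *: (u, 0)) - f (y, w))) =
  (fun h : R => h^-1 *: (((fun y' => f (y', w)) \o shift y) (h *: u) - f (y, w))).
Proof.
apply/funext => h /=; congr (_ *: (f _ - _)); rewrite /shift/=.
by congr pair; rewrite /= scaler0 add0r.
Qed.

Let quotient_pair_snd V W U (f : V * W -> U) (y : V) (w v : W) :
  (fun h : R => h^-1 *: ((f \o shift (y, w)) (h *: (0, v)) - f (y, w))) =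
  (fun h : R => h^-1 *: (((fun w' => f (y, w')) \o shift w) (h *: v) - f (y, w))).
Proof.
apply/funext => h /=; congr (_ *: (f _ - _)); rewrite /shift/=.
by congr pair; rewrite /= scaler0 add0r.
Qed.

Lemma derive_pair_fst V W U (f : V * W -> U) (y u : V) (w : W) :
  'D_(u, 0) f (y, w) = 'D_u (fun y' => f (y', w)) y.
Proof. by rewrite /derive quotient_pair_fst. Qed.

Lemma derive_pair_snd V W U (f : V * W -> U) (y : V) (w v : W) :
  'D_(0, v) f (y, w) = 'D_v (fun w' => f (y, w')) w.
Proof. by rewrite /derive quotient_pair_snd. Qed.

Lemma derivable_pair_fst V W U (f : V * W -> U) (y u : V) (w : W) :
  derivable f (y, w) (u, 0) -> derivable (fun y' => f (y', w)) y u.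
Proof. by rewrite /derivable quotient_pair_fst. Qed.

Lemma derivable_pair_snd V W U (f : V * W -> U) (y : V) (w v : W) :
  derivable f (y, w) (0, v) -> derivable (fun w' => f (y, w')) w v.
Proof. by rewrite /derivable quotient_pair_snd. Qed.

Lemma derive_pair V W U (f : V * W -> U) (y u : V) (w v : W) :
  differentiable f (y, w) ->
  'D_(u, v) f (y, w) = 'D_u (fun y' => f (y', w)) y + 'D_v (fun w' => f (y, w')) w.
Proof.
move=> df; rewrite -derive_pair_fst -derive_pair_snd !deriveE// -linearD.
by congr ('d f _ _); congr pair; rewrite /= ?addr0 ?add0r.
Qed.

Lemma deriveDdir V W (f : V -> W) (y u v : V) : differentiable f y ->
  'D_(u + v) f y = 'D_u f y + 'D_v f y.
Proof. by move=> df; rewrite !deriveE// linearD. Qed.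

Lemma deriveZdir V W (f : V -> W) (y u : V) (c : R) : differentiable f y ->
  'D_(c *: u) f y = c *: 'D_u f y.
Proof. by move=> df; rewrite !deriveE// linearZ. Qed.

Lemma slope_pair V W (s : R) (F : set_system R) {FF : Filter F} (f : R -> V)
    (g : R -> W) (l : V) (k : W) :
  slope f s t @[t --> F] --> l -> slope g s t @[t --> F] --> k ->
  slope (fun t => (f t, g t)) s t @[t --> F] --> (l, k).
Proof.
by move=> fl gk; have : (slope f s t, slope g s t) @[t --> F] --> (l, k) by exact: cvg_pair.
Qed.

Lemma derive_compE V W U (f : V -> W) (g : W -> U) (y w : V) :
  differentiable f y -> differentiable g (f y) ->
  'D_w (g \o f) y = 'D_('D_w f y) g (f y).
Proof.
move=> df dg; have dgf := differentiable_comp df dg.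
transitivity ('d (g \o f) y w); first exact: deriveE.
transitivity ('d g (f y) ('d f y w)); first by rewrite (diff_comp df dg).
by rewrite -(deriveE _ df) -(deriveE _ dg).
Qed.

(** Both the base point y t and the direction xi t move. Expanding xi t in the basis separates them:
    each term is a coordinate of xi t times a fixed partial derivative of tau at y t, so the product
    and chain rules apply. *)
Lemma slope_pushforward n p (tau : 'rV[R]_n.+1 -> 'rV[R]_p) (A : set 'rV[R]_n.+1)
    (y xi : R -> 'rV[R]_n.+1) (w xi' : 'rV[R]_n.+1) (s : R) (F : set_system R) :
  ProperFilter F -> punctured_at s F -> open A -> smooth_on A tau -> A (y s) ->
  slope y s t @[t --> F] --> w -> slope xi s t @[t --> F] --> xi' ->
  slope (fun t => 'D_(xi t) tau (y t)) s t @[t --> F] -->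
    'D_xi' tau (y s) + 'D_w (fun x => 'D_(xi s) tau x) (y s).
Proof.
move=> FF Fs oA stau Ays yw xiw.
have dtau x : A x -> differentiable tau x by move=> Ax; apply: (stau 1%N).1.
have ddtau v x : A x -> differentiable (fun x => 'D_v tau x) x.
  by move=> Ax; apply: ((stau 2%N).2 v).1.
have -> : 'D_w (fun x => 'D_(xi s) tau x) (y s) =
    \sum_i xi s 0 i *: 'D_w (fun x => 'D_(delta_mx 0 i) tau x) (y s).
  transitivity ('D_w (fun x => \sum_i xi s 0 i *: 'D_(delta_mx 0 i) tau x) (y s)).
    apply: near_eq_derive; have : \forall x \near y s, A x by exact: open_nbhs_nbhs.
    by apply: filterS => x Ax; rewrite derive_basis//; exact: dtau.
  have dZ i : is_derive (y s) w (fun x => xi s 0 i *: 'D_(delta_mx 0 i) tau x)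
      (xi s 0 i *: 'D_w (fun x => 'D_(delta_mx 0 i) tau x) (y s)).
    by apply: is_deriveZ; apply: derivableP; apply/diff_derivable/ddtau.
  by have [_ <-] := is_derive_sum dZ; rewrite fct_sumE.
rewrite derive_basis; last exact: dtau.
rewrite -big_split/=.
apply: (@slope_eq _ _ _ _ _ (fun t => \sum_i xi t 0 i *: 'D_(delta_mx 0 i) tau (y t))).
- have yc : y t @[t --> F] --> y s by exact: slope_continuous yw.
  have : \forall x \near y s, A x by exact: open_nbhs_nbhs.
  move=> H0; have {}H0 : \forall t \near F, A (y t) by exact: yc H0.
  by apply: filterS H0 => t At; rewrite -derive_basis//; exact: dtau.
- by rewrite -derive_basis//; exact: dtau.
apply: slope_sum => i.
apply: slopeZ => //; first exact: slope_coord.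
by apply: (@slope_comp _ _ _ _ _ _ _ _ (fun x => 'D_(delta_mx 0 i) tau x)) => //; exact: ddtau.
Qed.

End derive_pairs.

Section charts.
#[local] Opaque derive.
Context {R : realType} {m : nat} {M : manifold R m.+1}.
Notation V := 'rV[R]_m.+1.
Notation coord := (@Defs.coord R m.+1 M).
Implicit Types (a b c : chart M) (x : M) (y w : V).

Definition transition a b : V -> V := phi b \o phi_inv a.

Definition overlap a b : set V := phi a @` (dom a `&` dom b).

Lemma img_dom a y : img a y -> dom a (phi_inv a y) /\ phi a (phi_inv a y) = y.
Proof. by move=> [x ax <-]; rewrite phiK. Qed.

Lemma overlapP a b y : overlap a b y <-> img a y /\ dom b (phi_inv a y).
Proof.
split=> [[x [ax bx] <-]|[[x ax <-]]]; first by rewrite phiK//; split => //; exists x.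
by rewrite phiK// => bx; exists x.
Qed.

Lemma overlap_open a b : open (overlap a b).
Proof.
rewrite openE => y /overlapP[ay bxy].
have H1 : \forall y' \near y, img a y' by apply: open_nbhs_nbhs; split => //; exact: img_open.
have H2 : \forall y' \near y, dom b (phi_inv a y').
  apply: (phi_inv_continuous ay); apply: open_nbhs_nbhs; split => //; exact: dom_open.
by rewrite /interior; apply: filterS2 H1 H2 => y' h1 h2; apply/overlapP.
Qed.

Lemma overlap_phi a b x : dom a x -> dom b x -> overlap a b (phi a x).
Proof. by move=> ax bx; exists x. Qed.

Lemma transition_phi a b x : dom a x -> transition a b (phi a x) = phi b x.
Proof. by move=> ax; rewrite /transition/= phiK. Qed.

Lemma differentiable_transition a b y : overlap a b y ->
  differentiable (transition a b) y.
Proof. by move=> aby; apply: (@transition_smooth _ _ M a b 1%N).1. Qed.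

Lemma derive_transition_comp a b c y w : overlap a b y -> dom c (phi_inv a y) ->
  'D_('D_w (transition a b) y) (transition b c) (transition a b y) =
  'D_w (transition a c) y.
Proof.
move=> aby cy; have [ay by_] := (overlapP _ _ _).1 aby.
have dab := differentiable_transition aby.
have bcy : overlap b c (transition a b y) by exact: overlap_phi.
have dbc := differentiable_transition bcy.
rewrite -(derive_compE _ dab dbc); apply: near_eq_derive.
have : \forall y' \near y, overlap a b y' by apply: open_nbhs_nbhs; split => //; exact: overlap_open.
apply: filterS => y' /overlapP[ay' by'].
by rewrite /transition/= phiK.
Qed.

Lemma derive_transition_id a y w : img a y -> 'D_w (transition a a) y = w.
Proof.
move=> ay; transitivity ('D_w id y); last by rewrite derive_id.
apply: near_eq_derive.
have : \forall y' \near y, img a y' by apply: open_nbhs_nbhs; split => //; exact: img_open.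
by apply: filterS => y' /img_dom[_ E]; rewrite /transition/= E.
Qed.

Lemma coordE a x (v : tangent x) :
  coord a v = 'D_(v : V) (transition (chart_at x) a) (phi (chart_at x) x).
Proof. by []. Qed.

Lemma of_coordE a y w : of_coord a y w = 'D_w (transition a (chart_at (phi_inv a y))) y :> V.
Proof. by []. Qed.

Lemma coord_of_coord a b y w : overlap a b y ->
  coord b (of_coord a y w) = 'D_w (transition a b) y.
Proof.
move=> aby; have [ay by_] := (overlapP _ _ _).1 aby.
rewrite coordE of_coordE; set c := chart_at _.
have cy : dom c (phi_inv a y) := chart_at_dom _.
have acy : overlap a c y by apply/overlapP.
by rewrite -(derive_transition_comp w acy by_).
Qed.

Lemma coord_of_coordK a y w : img a y -> coord a (of_coord a y w) = w.
Proof.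
move=> ay; rewrite coord_of_coord ?derive_transition_id//.
by apply/overlapP; split => //; have [] := img_dom ay.
Qed.

Lemma of_coord_coord a b x (v : tangent x) : dom a x -> dom b x ->
  'D_(coord a v) (transition a b) (phi a x) = coord b v.
Proof.
move=> ax bx; rewrite !coordE; set c := chart_at x.
have cx : dom c x := chart_at_dom _.
have cax : overlap c a (phi c x) by exact: overlap_phi.
rewrite -(derive_transition_comp (v : V) cax (c := b)); last by rewrite phiK.
by rewrite transition_phi.
Qed.

Lemma coord_chart_at x (v : tangent x) : coord (chart_at x) v = v :> V.
Proof.
by rewrite coordE derive_transition_id//; exists x => //; exact: chart_at_dom.
Qed.

Lemma of_coordK a x (v : tangent x) : dom a x ->
  of_coord a (phi a x) (coord a v) = v :> V.
Proof.
move=> ax; rewrite of_coordE phiK// of_coord_coord//; last exact: chart_at_dom.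
exact: coord_chart_at.
Qed.

Lemma of_coord_transition a b y w : overlap a b y ->
  of_coord b (transition a b y) ('D_w (transition a b) y) = of_coord a y w :> V.
Proof.
move=> aby; have [ay by_] := (overlapP _ _ _).1 aby.
rewrite !of_coordE; have -> : phi_inv b (transition a b y) = phi_inv a y by rewrite /transition/= phiK.
by rewrite derive_transition_comp//; exact: chart_at_dom.
Qed.

Variable L : forall x : M, tangent x -> R.

(** [tangent x] is convertible to [V] for every x. This non-dependent copy of [L] allows the base
    point to be rewritten without transporting the vector. *)
Let Ltot (x : M) (v : V) : R := @L x v.

Lemma in_chart_transition a b y w : overlap a b y ->
  in_chart L a y w = in_chart L b (transition a b y) ('D_w (transition a b) y).
Proof.
move=> aby; have [ay by_] := (overlapP _ _ _).1 aby.
rewrite /in_chart -/(Ltot _ _) -[RHS]/(Ltot _ _) of_coord_transition//.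
by rewrite /transition/= phiK.
Qed.

Lemma near_dom_curve (z : R -> M) a (s : R) : {within `[0, 1], continuous z} ->
  0 <= s <= 1 -> dom a (z s) -> \forall t \near within `[0, 1] (nbhs s), dom a (z t).
Proof.
move=> /subspace_continuousP cz s01 azs.
have /cz : `[0, 1]%classic s by rewrite /= in_itv.
by apply; apply: open_nbhs_nbhs; split => //; exact: dom_open.
Qed.

Lemma near_within_dnbhs (s : R) (P : set R) :
  (\forall t \near within `[0, 1] (nbhs s), P t) ->
  \forall t \near within `[0, 1] s^', P t.
Proof.
move=> H; suff : \forall t \near s, t != s -> `[0, 1]%classic t -> P t by [].
have {}H : \forall t \near s, `[0, 1]%classic t -> P t by [].
by apply: filterS H => t Ht _.
Qed.

Lemma slope_phi_transition (z : R -> M) a b (s : R) (w : V) :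
  {within `[0, 1], continuous z} -> 0 <= s <= 1 -> dom a (z s) -> dom b (z s) ->
  slope (phi a \o z) s t @[t --> within `[0, 1] s^'] --> w ->
  slope (phi b \o z) s t @[t --> within `[0, 1] s^'] -->
    'D_w (transition a b) (phi a (z s)).
Proof.
move=> cz s01 azs bzs zw; have pF := within01_proper s01.
have dab : differentiable (transition a b) (phi a (z s)).
  by apply: differentiable_transition; exact: overlap_phi.
have H : slope (transition a b \o (phi a \o z)) s t @[t --> within `[0, 1] s^'] -->
  'D_w (transition a b) (phi a (z s)).
  exact: (slope_comp (punctured_at_within01 s) zw dab).
apply: slope_eq H; last by rewrite /= transition_phi.
have := near_within_dnbhs (near_dom_curve cz s01 azs).
by apply: filterS => t azt; rewrite /= transition_phi.
Qed.

Definition chart_lagrangian a (yw : V * V) : R := in_chart L a yw.1 yw.2.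

Hypothesis L_C1 : C1_TM L.

Lemma differentiable_chart_lagrangian a y w : img a y ->
  differentiable (chart_lagrangian a) (y, w).
Proof. by move=> ay; apply: (L_C1 a).1. Qed.

Lemma derive_chart_lagrangian a y w u v : img a y ->
  'D_(u, v) (chart_lagrangian a) (y, w) = d_x_chart L a y w u + d_v_chart L a y w v.
Proof. by move=> ay; rewrite derive_pair//; exact: differentiable_chart_lagrangian. Qed.

Lemma slope_line (y u : V) (F : set_system R) : ProperFilter F -> punctured_at 0 F ->
  slope (fun t : R => y + t *: u) 0 t @[t --> F] --> u.
Proof.
move=> FF [_ Fne]; apply: cvg_near_eq (cvg_cst u).
apply: filterS Fne => t t0.
by rewrite /slope subr0 scale0r addr0 [y + _]addrC addrK scalerA mulVf// scale1r.
Qed.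

(* Differentiating the change of coordinates
   (y, w) |-> (tau y, D_w tau y) of TM. *)
Lemma derive_chart_lagrangian_transition a b y w u v : overlap a b y ->
  'D_(u, v) (chart_lagrangian a) (y, w) =
  'D_('D_u (transition a b) y,
      'D_v (transition a b) y + 'D_u (fun x : V => 'D_w (transition a b) x) y)
    (chart_lagrangian b) (transition a b y, 'D_w (transition a b) y).
Proof.
move=> aby; have [ay by_] := (overlapP _ _ _).1 aby.
have pF : ProperFilter (0 : R)^' by exact: Proper_dnbhs_numFieldType.
have pu := punctured_at_dnbhs (0 : R).
have Ly : slope (fun t : R => y + t *: u) 0 t @[t --> 0^'] --> u by exact: slope_line.
have Lw : slope (fun t : R => w + t *: v) 0 t @[t --> 0^'] --> v by exact: slope_line.
have s1 : slope (chart_lagrangian a \o (fun t : R => (y + t *: u, w + t *: v))) 0 t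
    @[t --> 0^'] --> 'D_(u, v) (chart_lagrangian a) (y, w).
  have := slope_comp pu (tau := chart_lagrangian a) (slope_pair Ly Lw).
  by move=> /(_ pF); rewrite !scale0r !addr0; apply; exact: differentiable_chart_lagrangian.
have s2 : slope (fun t : R => transition a b (y + t *: u)) 0 t @[t --> 0^'] -->
    'D_u (transition a b) y.
  have := slope_comp pu (tau := transition a b) Ly => /(_ pF); rewrite !scale0r !addr0; apply.
  exact: differentiable_transition.
have s3 := slope_pushforward pF pu (@overlap_open a b) (@transition_smooth _ _ _ a b) _ Ly Lw.
rewrite !scale0r !addr0 in s3; have {}s3 := s3 aby.
have bty : img b (transition a b y).
  by rewrite /transition; exists (phi_inv a y).
have s4 : slope (chart_lagrangian b \o (fun t : R => (transition a b (y + t *: u),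
      'D_(w + t *: v) (transition a b) (y + t *: u)))) 0 t @[t --> 0^'] -->
    'D_('D_u (transition a b) y,
        'D_v (transition a b) y + 'D_u (fun x : V => 'D_w (transition a b) x) y)
    (chart_lagrangian b) (transition a b (y + 0 *: u), 'D_(w + 0 *: v) (transition a b) (y + 0 *: u)).
  apply: slope_comp => //; first exact: slope_pair.
  by rewrite !scale0r !addr0; exact: differentiable_chart_lagrangian.
rewrite !scale0r !addr0 in s4.
apply: (cvg_unique _ s1); first exact: norm_hausdorff.
apply: slope_eq s4; last first.
  by rewrite /= !scale0r !addr0 /chart_lagrangian/= -in_chart_transition.
have yc : y + t *: u @[t --> (0 : R)^'] --> y.
  by have := slope_continuous pu Ly => /(_ pF); rewrite scale0r addr0.
have aby' : \forall x \near y, overlap a b x.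
  by apply: open_nbhs_nbhs; split => //; exact: overlap_open.
have {}aby' : \forall t \near (0 : R)^', overlap a b (y + t *: u) by exact: yc aby'.
apply: filterS aby' => t abt.
by rewrite /chart_lagrangian/= -in_chart_transition.
Qed.

(** Neither term of the density is invariant by itself. Differentiating the transformed velocity in
    the direction u produces a second derivative of the transition map, and differentiating the
    transformed field along the curve produces the one with u and w exchanged; they agree by
    Schwarz. *)
Lemma dx_dv_transition a b y w u v : overlap a b y ->
  d_x_chart L b (transition a b y) ('D_w (transition a b) y) ('D_u (transition a b) y) +
  d_v_chart L b (transition a b y) ('D_w (transition a b) y)
    ('D_v (transition a b) y + 'D_w (fun x : V => 'D_u (transition a b) x) y) =
  d_x_chart L a y w u + d_v_chart L a y w v.
Proof.
move=> aby; have [ay by_] := (overlapP _ _ _).1 aby.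
have bty : img b (transition a b y) by exists (phi_inv a y).
have H : 'D_w (fun x : V => 'D_u (transition a b) x) y =
    'D_u (fun x : V => 'D_w (transition a b) x) y.
  exact: (smooth_derive_comm u w (@overlap_open a b) (@transition_smooth _ _ _ a b) aby).
rewrite H; apply: etrans (esym (derive_chart_lagrangian _ _ _ bty)) _.
apply: etrans (esym (derive_chart_lagrangian_transition _ _ _ aby)) _.
exact: derive_chart_lagrangian.
Qed.

Lemma dA_density_transition (z : R -> M) (xi : forall s, tangent (z s)) a b (s : R) :
  {within `[0, 1], continuous z} -> 0 <= s <= 1 -> dom a (z s) -> dom b (z s) ->
  derivable01 (phi a \o z) s -> derivable01 (field_coord xi a) s ->
  [/\ derivable01 (phi b \o z) s, derivable01 (field_coord xi b) s &
      dA_density L xi b s = dA_density L xi a s].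
Proof.
move=> cz s01 azs bzs dz dxi; have pF := within01_proper s01.
have pu := punctured_at_within01 s.
pose y := phi a (z s); pose w : V := deriv01 (phi a \o z) s.
pose u : V := field_coord xi a s; pose v : V := deriv01 (field_coord xi a) s.
have sz : slope (phi a \o z) s t @[t --> within `[0, 1] s^'] --> w by exact: derivable01_slope.
have sxi : slope (field_coord xi a) s t @[t --> within `[0, 1] s^'] --> v by exact: derivable01_slope.
have aby : overlap a b y by exact: overlap_phi.
have sz' := slope_phi_transition cz s01 azs bzs sz.
have xib : \forall t \near within `[0, 1] (nbhs s),
    field_coord xi b t = 'D_(field_coord xi a t) (transition a b) (phi a (z t)).
  have := near_dom_curve cz s01 bzs; have := near_dom_curve cz s01 azs.
  by apply: filterS2 => t azt bzt; rewrite /field_coord of_coord_coord.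
have xibs : field_coord xi b s = 'D_u (transition a b) y.
  by rewrite /field_coord -(of_coord_coord (xi s) azs bzs).
have sxi' : slope (field_coord xi b) s t @[t --> within `[0, 1] s^'] -->
    'D_v (transition a b) y + 'D_w (fun x : V => 'D_u (transition a b) x) y.
  have H := slope_pushforward (y := phi a \o z) pF pu (@overlap_open a b) (@transition_smooth _ _ _ a b) aby sz sxi.
  apply: slope_eq H => //.
  have := near_within_dnbhs xib; by apply: filterS => t ->.
have [dz1 dz2] := deriv01_slope s01 sz'; have [dx1 dx2] := deriv01_slope s01 sxi'.
split; [exact: dz1|exact: dx1|].
apply: etrans (dx_dv_transition w u v aby).
by rewrite /dA_density dz2 dx2 xibs -(transition_phi b azs).
Qed.

End charts.

(** * Derivatives of absolutely continuous curves *)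

Lemma continuous_at_pair (T U W : topologicalType) (f : T -> U) (g : T -> W) (x : T) :
  {for x, continuous f} -> {for x, continuous g} ->
  {for x, continuous (fun t => (f t, g t))}.
Proof. by move=> cf cg; exact: cvg_pair. Qed.

Section abs_cont_rows.
Context {R : realType}.
Notation mu := (@lebesgue_measure R).

Lemma abs_cont_coord n (s1 s2 : R) (Y : R -> 'rV[R]_n) i :
  abs_cont s1 s2 Y -> abs_cont (V := R) s1 s2 (fun t => Y t 0 i).
Proof.
move=> acY e e0; have [d d0 H] := acY e e0; exists d => // k u v uv uvij uvd.
apply: le_lt_trans (H k u v uv uvij uvd); apply: ler_sum => j _.
by apply: le_trans (norm_coord_le _ i); rewrite !mxE.
Qed.

Lemma abs_cont_comp_clamp (V : normedModType R) (s1 s2 a b : R) (Y : R -> V) :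
  s1 <= s2 -> abs_cont s1 s2 Y -> abs_cont a b (Y \o clamp s1 s2).
Proof.
move=> s12 acY e e0; have [d d0 H] := acY e e0; exists d => // k u v uv uvij uvd.
apply: (H k (fun i => clamp s1 s2 (u i)) (fun i => clamp s1 s2 (v i))).
- move=> i; have [_ uvi _] := uv i.
  have /andP[? ?] := clamp_itv (u i) s12; have /andP[? ?] := clamp_itv (v i) s12.
  by split => //; exact: clamp_nondecreasing.
- by move=> i j /uvij[H1|H1]; [left|right]; exact: clamp_nondecreasing.
- apply: le_lt_trans uvd; apply: ler_sum => i _.
  by have [_ uvi _] := uv i; exact: clamp_lipschitz.
Qed.

(** The bound on increments is required at distances below r only: in a family of total length less
    than r every interval is shorter than r. *)
Lemma abs_cont_dominated_by (V W : normedModType R) (a b C r : R) (Y : R -> V) (f : R -> W) :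
  0 < r -> 0 <= C ->
  (forall s t, a <= s -> s <= t -> t <= b -> t - s < r ->
     `|f t - f s| <= C * (`|Y t - Y s| + (t - s))) ->
  abs_cont a b Y -> abs_cont a b f.
Proof.
move=> r0 C0 fY acY e e0.
(* One half is spent on the increments of Y and the other on the lengths; [C + 1] is positive even
   if C = 0. *)
have eC : 0 < e / (C + 1) / 2 by rewrite !divr_gt0// ltr_wpDl.
have [d d0 H] := acY _ eC.
exists (Num.min d (Num.min r (e / (C + 1) / 2))); first by rewrite !lt_min d0 r0 eC.
move=> k u v uv uvij; rewrite !lt_min => /and3P[ud ur ue].
have uvr i : v i - u i < r.
  apply: le_lt_trans ur; rewrite (bigD1 i)//= lerDl sumr_ge0// => j _.
  by rewrite subr_ge0; have [] := uv j.
have H1 := H k u v uv uvij ud.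
apply: (@le_lt_trans _ _ (C * (\sum_(i < k) `|Y (v i) - Y (u i)| + \sum_(i < k) (v i - u i)))).
  rewrite -big_split/= mulr_sumr; apply: ler_sum => i _.
  by have [? ? ?] := uv i; apply: fY.
have S0 : 0 <= \sum_(i < k) `|Y (v i) - Y (u i)| + \sum_(i < k) (v i - u i).
  by rewrite addr_ge0// sumr_ge0// => i _; rewrite subr_ge0; have [] := uv i.
have C1 : 0 < C + 1 by rewrite ltr_wpDl.
apply: (@le_lt_trans _ _ ((C + 1) * (\sum_(i < k) `|Y (v i) - Y (u i)| + \sum_(i < k) (v i - u i)))).
  by rewrite ler_wpM2r// lerDl.
have -> : e = (C + 1) * (e / (C + 1)) by rewrite mulrC divfK// gt_eqF.
by rewrite ltr_pM2l// [e / (C + 1)]splitr ltrD.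
Qed.

(** Compactness in its near-covering form, along the filter [\oo] of scales: as [P N] weakens with
    N, a scale that works near each point may be chosen uniformly. *)
Lemma compact_uniform_scale (K : set R) (P : nat -> R -> Prop) :
  compact K ->
  (forall r, K r -> exists N, \forall r' \near r, K r' -> P N r') ->
  (forall N N' r, (N <= N')%N -> P N r -> P N' r) ->
  exists N, forall r, K r -> P N r.
Proof.
move=> /compact_near_coveringP cK HP mP.
have [N _ HN] : \forall N \near \oo, K `<=` (fun r => K r -> P N r).
  apply: (cK nat \oo (fun N r => K r -> P N r)) => r Kr; have [N HN] := HP r Kr.
  exists ([set r' | K r' -> P N r'], [set N' | (N <= N')%N]) => /=.
    by split => //; exists N.
  by move=> [r' N'] /= [H1 H2] Kr'; apply: mP H2 _; exact: H1.
by exists N => r Kr; apply: HN => //=.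
Qed.

Lemma measurable_ifT (N : set R) (A B : R -> R) : measurable (N : set (measurableTypeR R)) ->
  measurable_fun setT A -> measurable_fun setT B ->
  measurable_fun setT (fun r => if r \in N then A r else B r).
Proof.
move=> mN mA mB; apply: measurable_fun_ifT => //.
by apply: (measurable_fun_bool true); rewrite setTI preimage_mem_true.
Qed.

End abs_cont_rows.

Section lebesgue_ae.
Context {R : realType}.
Notation mu := (@lebesgue_measure R).

Lemma ae_imp (P Q : R -> Prop) : (forall x, P x -> Q x) ->
  {ae mu, forall x, P x} -> {ae mu, forall x, Q x}.
Proof. by move=> PQ; apply: filterS => //; exact: (ae_filter_ringOfSetsType mu). Qed.

Lemma ae_and (P Q : R -> Prop) : {ae mu, forall x, P x} -> {ae mu, forall x, Q x} ->
  {ae mu, forall x, P x /\ Q x}.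
Proof. by apply: filterI; exact: (ae_filter_ringOfSetsType mu). Qed.

Lemma ae_itv_exists (s1 s2 : R) (P : R -> Prop) : s1 < s2 ->
  {ae mu, forall x, P x} -> exists x, s1 < x < s2 /\ P x.
Proof.
move=> s12 [N [mN muN NP]]; apply: contrapT => H.
have sub : `]s1, s2[ `<=` N.
  move=> x; rewrite /= in_itv/= => xs; apply: NP => /= Px; apply: H; by exists x.
have : (mu `]s1, s2[%classic <= mu N)%E.
  by apply: le_measure => //; rewrite inE//; exact: measurable_itv.
rewrite muN lebesgue_measure_itv/= lte_fin s12 -EFinB lee_fin subr_le0.
by rewrite leNgt s12.
Qed.

Lemma integrable_itv (h : R -> R) (i : interval R) :
  mu.-integrable setT (EFin \o h) -> mu.-integrable [set` i] (EFin \o h).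
Proof. by move=> ih; apply: (integrableS measurableT _ _ ih). Qed.

Lemma ae_notin_seq (s : seq R) : {ae mu, forall x, x \notin s}.
Proof.
elim: s => [|c s IH]; first by apply: aeW => x.
have H : {ae mu, forall x, x != c}.
  exists [set c]; split; first exact: measurable_set1.
    exact: lebesgue_measure_set1.
  by move=> x /= /negP; rewrite negbK => /eqP.
apply: ae_imp (ae_and H IH) => x [xc xs].
by rewrite inE negb_or xc xs.
Qed.

Lemma integrable_itv_cst1 (s t : R) : mu.-integrable `[s, t] (EFin \o (fun=> 1 : R)).
Proof.
apply/integrableP; split; first by apply/measurable_EFinP; exact: measurable_cst.
under eq_integral do rewrite /= normr1.
rewrite integral_cst/=; last exact: measurable_itv.
rewrite mul1e lebesgue_measure_itv/=; case: ifP => _ //.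
by rewrite -EFinB ltry.
Qed.

Lemma ae_slope_integral (s1 : R) (h : R -> R) : mu.-integrable setT (EFin \o h) ->
  {ae mu, forall x, s1 < x ->
    slope (V := R) (fun x => \int[mu]_(t in `[s1, x]) h t)%R x t @[t --> x^'] --> h x}.
Proof.
move=> ih.
have lh : locally_integrable setT h by apply: open_integrable_locally => //; exact: openT.
have ihy y : mu.-integrable [set` Interval (BLeft s1) (BRight y)] (EFin \o h).
  by apply: (integrableS measurableT _ _ ih).
apply: ae_imp (FTC1 ihy lh) => x H s1x; have [dF F'] := H s1x.
rewrite derive1E in F'.
by apply: is_derive_slope; apply: DeriveDef; [exact: dF|exact: F'].
Qed.

End lebesgue_ae.

Section speed.
Context {R : realType} {n : nat}.
Notation mu := (@lebesgue_measure R).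
Notation V := 'rV[R]_n.+1.

(* w is an everywhere defined Borel version of the derivative of Y, which
   vanishes on the null set N. *)
Record speed (s1 s2 : R) (Y w : R -> V) (N : set R) : Prop := Speed {
  speed_null : measurable (N : set (measurableTypeR R)) /\ mu N = 0%E;
  speed_slope : forall r, s1 < r < s2 -> ~ N r -> slope Y r t @[t --> r^'] --> w r;
  speed_off : forall r, ~ (s1 < r < s2 /\ ~ N r) -> w r = 0;
  speed_int : forall i, mu.-integrable setT (EFin \o (fun r => w r 0 i));
  speed_primitive : forall i x, s1 <= x <= s2 ->
    Y x 0 i - Y s1 0 i = (\int[mu]_(t in `[s1, x]) w t 0 i)%R }.

Lemma abs_cont_speed (s1 s2 : R) (Y : R -> V) : s1 < s2 -> abs_cont s1 s2 Y ->
  exists w N, speed s1 s2 Y w N.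
Proof.
move=> s12 acY.
have /choice[h hP] : forall i, exists h : R -> R, mu.-integrable setT (EFin \o h) /\
    forall x, s1 <= x <= s2 -> Y x 0 i - Y s1 0 i = (\int[mu]_(t in `[s1, x]) h t)%R.
  by move=> i; have [h h1 h2] := abs_cont_integral s12 (abs_cont_coord i acY); exists h.
have aeD i : {ae mu, forall x, s1 < x < s2 ->
    slope (V := R) (fun t => Y t 0 i) x t @[t --> x^'] --> h i x}.
  have [ih hE] := hP i; apply: ae_imp (ae_slope_integral s1 ih) => x H /andP[s1x xs2].
  have sl : slope (V := R) (fun x => Y s1 0 i + \int[mu]_(t in `[s1, x]) h i t)%R x t @[t --> x^'] --> 0 + h i x.
    by apply: slopeD; [exact: slope_cst|exact: H].
  rewrite add0r in sl; apply: slope_eq (sl).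
    near=> t; rewrite -hE; first by rewrite addrC subrK.
    apply/andP; split; apply: ltW; near: t; apply: nbhs_dnbhs; [exact: lt_nbhsr|exact: lt_nbhsl].
  clear H sl; rewrite -hE; first by rewrite addrC subrK.
  by rewrite !ltW.
have : {ae mu, forall x, forall i, s1 < x < s2 -> slope (V := R) (fun t => Y t 0 i) x t @[t --> x^'] --> h i x}.
  exact: filter_forall.
move=> [N0 [mN0 muN0 HN]].
(* With the endpoints in N, the densities h and their restriction w to D differ inside [[s1, s2]] on
   N only, so they have the same integrals. *)
pose N := N0 `|` [set s1] `|` [set s2].
have mN : measurable (N : set (measurableTypeR R)).
  by apply: measurableU; [apply: measurableU|]; [exact: mN0|exact: measurable_set1|exact: measurable_set1].
have N0' : mu N = 0%E.
  apply/eqP; rewrite eq_le measure_ge0 andbT.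
  apply: (@le_trans _ _ (mu (N0 `|` [set s1]) + mu [set s2])%E).
    apply: measureU2; [apply: measurableU|]; [exact: mN0|exact: measurable_set1|exact: measurable_set1].
  rewrite [X in (_ + X)%E]lebesgue_measure_set1 adde0.
  apply: (@le_trans _ _ (mu N0 + mu [set s1])%E).
    by apply: measureU2; [exact: mN0|exact: measurable_set1].
  by rewrite [X in (_ + X)%E]lebesgue_measure_set1 adde0 muN0.
pose D : set R := `]s1, s2[ `\` N.
have mD : measurable (D : set (measurableTypeR R)) by apply: measurableD => //; exact: mN.
pose w r : V := \row_i (h i \_ D) r.
exists w, N; split => //.
- move=> r rs Nr.
  have Dr : D r by split => //=; rewrite in_itv.
  apply: slope_row => i; rewrite mxE patchE mem_set//.
  by apply: contrapT => H; apply: Nr; left; left; apply: HN => /(_ i rs).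
- move=> r H; apply/rowP => i; rewrite mxE patchE memNset ?mxE// => -[rs Nr].
- move=> i; have [ih _] := hP i.
  have : mu.-integrable D (EFin \o h i) by apply: (integrableS measurableT _ _ ih).
  rewrite integrable_mkcond//; apply: eq_integrable => // r _ /=.
  by rewrite mxE !patchE; case: ifPn.
- move=> i x /[dup] xs /andP[_ xs2].
  rewrite (hP i).2//; congr fine; apply: ae_eq_integral_restrict.
  exists N; split => // r /= H; apply: contrapT => Nr; apply: H.
  rewrite !patchE; case: ifPn => // /set_mem /=; rewrite in_itv/= => /andP[sr rx].
  rewrite mxE patchE mem_set//; split => //=; rewrite in_itv/= !lt_neqAle sr (le_trans rx)// !andbT.
  by apply/andP; split; apply/eqP => E; apply: Nr; [left; right|right]; rewrite E.
Unshelve. all: by end_near. Qed.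

(** The function is an everywhere limit of measurable ones: off [N'] of Phi (Y, q k), where q k is
    the difference quotient of step 1/(k+1), and on [N'], where w vanishes, of the constant sequence
    Phi (Y, 0). Defining w everywhere, by 0 on bad points, is what gives convergence at every r. *)
Lemma speed_measurable (s1 s2 : R) (Y w : R -> V) (N : set R) (Phi : V * V -> R) :
  speed s1 s2 Y w N -> continuous Y ->
  (forall r v, {for (Y r, v), continuous Phi}) ->
  measurable_fun setT (fun r => Phi (Y r, w r)).
Proof.
move=> sw cY cPhi; have [[mN muN] sl off _ _] := sw.
pose N' : set R := N `|` ~` `]s1, s2[.
have mN' : measurable (N' : set (measurableTypeR R)).
  by apply: measurableU; [exact: mN|apply: measurableC; exact: measurable_itv].
have wN r : N' r -> w r = 0.
  by move=> [Nr|nr]; apply: off => -[rs nNr] //; apply: nr.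
pose q k (r : R) : V := k.+1%:R *: (Y (r + k.+1%:R^-1) - Y r).
pose F k r := if r \in N' then Phi (Y r, 0) else Phi (Y r, q k r).
apply: (@measurable_fun_cvg _ _ _ _ F).
  move=> k; apply: measurable_ifT => //; apply: continuous_measurable_fun => r.
    apply: (@continuous_comp _ _ _ (fun r => (Y r, 0 : V)) Phi); last exact: cPhi.
    by apply: continuous_at_pair; [exact: cY|exact: cvg_cst].
  apply: (@continuous_comp _ _ _ (fun r => (Y r, q k r)) Phi); last exact: cPhi.
  apply: continuous_at_pair; first exact: cY.
  have cYk : {for r, continuous (fun t : R => Y (t + k.+1%:R^-1))}.
    apply: (@continuous_comp _ _ _ (fun t : R => t + k.+1%:R^-1) Y); last exact: cY.
    by apply: cvgD; [exact: cvg_id|exact: cvg_cst].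
  by apply: cvgZr; apply: cvgB; [exact: cYk|exact: cY].
move=> r _; have [N'r|N'r] := boolP (r \in N').
  rewrite wN; last exact: set_mem.
  by rewrite /F N'r; exact: cvg_cst.
rewrite /F (negbTE N'r).
have rs : s1 < r < s2.
  by apply: contraNT N'r => H; apply: mem_set; right; rewrite /= in_itv/=; apply/negP.
have nNr : ~ N r by move=> Nr; move/negP : N'r; apply; apply: mem_set; left.
have qw : q k r @[k --> \oo] --> w r.
  have H := sl r rs nNr.
  have tk : r + k.+1%:R^-1 @[k --> \oo] --> r^'.
    move=> P [e /= e0 HP].
    suff : \forall k \near \oo, P (r + k.+1%:R^-1) by [].
    near=> k; apply: HP => /=.
      rewrite opprD addNKr normrN ger0_norm ?invr_ge0//.
      by near: k; exact: near_infty_natSinv_lt (PosNum e0).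
    by rewrite -subr_eq0 addrAC subrr add0r invr_eq0.
  apply: cvg_near_eq (cvg_comp _ _ tk H); near=> k.
  by rewrite /slope /q addrAC subrr add0r invrK.
apply: (@cvg_comp _ _ _ (fun k => (Y r, q k r)) Phi _ (nbhs (Y r, w r))); last exact: cPhi.
have c1 : Y r @[k --> \oo] --> Y r by exact: cvg_cst.
exact: (cvg_pair c1 qw).
Unshelve. all: by end_near. Qed.

End speed.

(** * Trapezoidal test functions *)

Section test_functions.
Context {R : realType}.

(* The piecewise linear function equal to 1 on [a + h, b] and to 0 outside
   ]a, b + h[. *)
Definition trapezoid (a b h t : R) : R :=
  clamp 0 1 ((t - a) / h) - clamp 0 1 ((t - b) / h).

Definition trapezoid_slope (a b h t : R) : R :=
  h^-1 * ((a < t < a + h)%R%:R - (b < t < b + h)%R%:R).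

Lemma clamp_left (a b x : R) : a <= b -> x <= a -> clamp a b x = a.
Proof. by move=> ab xa; rewrite /clamp; apply/max_idPl; rewrite ge_min xa. Qed.

Lemma clamp_right (a b x : R) : a <= b -> b <= x -> clamp a b x = b.
Proof. by move=> ab xb; rewrite /clamp (min_idPr xb); apply/max_idPr. Qed.

Lemma trapezoid_lipschitz (a b h s t : R) : 0 < h ->
  `|trapezoid a b h s - trapezoid a b h t| <= (2 / h) * `|s - t|.
Proof.
move=> h0; rewrite /trapezoid.
have H c : `|clamp 0 1 ((s - c) / h) - clamp 0 1 ((t - c) / h)| <= h^-1 * `|s - t|.
  rewrite (le_trans (clamp_dist _ _ _ _))// -mulrBl opprB addrA subrK.
  by rewrite normrM mulrC normfV (ger0_norm (ltW h0)).
rewrite (_ : _ - _ = (clamp 0 1 ((s - a) / h) - clamp 0 1 ((t - a) / h)) -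
  (clamp 0 1 ((s - b) / h) - clamp 0 1 ((t - b) / h))); last by ring.
rewrite (le_trans (ler_normB _ _))//.
rewrite (_ : 2 / h * `|s - t| = h^-1 * `|s - t| + h^-1 * `|s - t|); last by ring.
by apply: lerD; exact: H.
Qed.

Lemma trapezoid_eq0 (a b h t : R) : 0 < h -> a <= b -> t <= a \/ b + h <= t ->
  trapezoid a b h t = 0.
Proof.
move=> h0 ab [ta|bt]; rewrite /trapezoid.
  rewrite !clamp_left ?ler01 ?subrr// pmulr_lle0 ?invr_gt0// subr_le0//.
  exact: le_trans ta ab.
rewrite !clamp_right ?ler01 ?subrr// ler_pdivlMr// mul1r lerBrDr//.
  by rewrite addrC.
by rewrite addrC (le_trans _ bt)// lerD2r.
Qed.

Lemma trapezoid_ge0_le1 (a b h t : R) : 0 < h -> a <= b -> 0 <= trapezoid a b h t <= 1.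
Proof.
move=> h0 ab; rewrite /trapezoid subr_ge0; apply/andP; split.
  by apply: clamp_nondecreasing; rewrite ler_pM2r ?invr_gt0// lerB.
have /andP[_ c1] := clamp_itv ((t - a) / h) (@ler01 R).
have /andP[c0 _] := clamp_itv ((t - b) / h) (@ler01 R).
by rewrite lerBlDr (le_trans c1)// lerDl.
Qed.

Lemma clamp01_mid (a h t : R) : 0 < h -> a < t < a + h ->
  clamp 0 1 ((t - a) / h) = h^-1 * (t - a).
Proof.
move=> h0 /andP[ta th]; rewrite clamp_id 1?mulrC// mulr_ge0 ?invr_ge0 ?subr_ge0 ?(ltW ta) ?(ltW h0)//=.
by rewrite mulrC ler_pdivrMr// mul1r lerBlDr addrC ltW.
Qed.

Lemma slope_clamp01 (a h t : R) : 0 < h -> t != a -> t != a + h ->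
  slope (V := R) (fun r => clamp 0 1 ((r - a) / h)) t r @[r --> t^'] -->
    h^-1 * (a < t < a + h)%R%:R.
Proof.
move=> h0 ta tah.
have pu := punctured_at_dnbhs t.
have [lta|gta|ea] := ltgtP t a; last by rewrite ea eqxx in ta.
  rewrite mulr0; apply: (@slope_eq _ _ _ _ _ (fun=> 0)); last exact: slope_cst.
    near=> r; rewrite clamp_left ?ler01// pmulr_lle0 ?invr_gt0// subr_le0 ltW//.
    by near: r; apply: nbhs_dnbhs; exact: lt_nbhsl.
  by rewrite clamp_left ?ler01// pmulr_lle0 ?invr_gt0// subr_le0 ltW.
have [lth|gth|eh] := ltgtP t (a + h); last by rewrite eh eqxx in tah.
  rewrite mulr1; apply: (@slope_eq _ _ _ _ _ (fun r => h^-1 *: (r - a))); last first.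
    have [_ Fne] := pu.
    apply: cvg_near_eq (cvg_cst _); apply: filterS Fne => r rt.
    rewrite /slope -scalerBr scalerA opprB addrA subrK mulrC -scalerA.
    by rewrite [_ *: (r - t)]mulVf ?subr_eq0// [_ *: 1]mulr1.
  - by rewrite clamp01_mid// gta.
  - near=> r; rewrite clamp01_mid//; apply/andP; split.
      by near: r; apply: nbhs_dnbhs; exact: lt_nbhsr.
    by near: r; apply: nbhs_dnbhs; exact: lt_nbhsl.
rewrite mulr0; apply: (@slope_eq _ _ _ _ _ (fun=> (1 : R))); last exact: slope_cst.
  near=> r; rewrite clamp_right ?ler01// ler_pdivlMr// mul1r lerBrDr addrC ltW//.
  by near: r; apply: nbhs_dnbhs; exact: lt_nbhsr.
by rewrite clamp_right ?ler01// ler_pdivlMr// mul1r lerBrDr addrC ltW.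
Unshelve. all: by end_near. Qed.

Lemma slope_trapezoid (a b h t : R) : 0 < h ->
  t \notin [:: a; a + h; b; b + h] ->
  slope (V := R) (trapezoid a b h) t r @[r --> t^'] --> trapezoid_slope a b h t.
Proof.
rewrite !inE !negb_or => h0 /and4P[ta tah tb tbh].
rewrite /trapezoid_slope mulrBr.
have H1 := slope_clamp01 h0 ta tah; have H2 := slope_clamp01 h0 tb tbh.
apply: cvg_near_eq (cvgB H1 H2); near=> r.
rewrite -[LHS]/(slope (V := R) (fun r => clamp 0 1 ((r - a) / h)) t r -
  slope (V := R) (fun r => clamp 0 1 ((r - b) / h)) t r).
by rewrite /slope -scalerBr /trapezoid; congr (_ *: _); ring.
Unshelve. all: by end_near. Qed.

End test_functions.

(** * Test fields *)

Section weak_euler_lagrange.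
Context {R : realType} {m : nat} {M : manifold R m.+1}.
Notation mu := (@lebesgue_measure R).
Notation V := 'rV[R]_m.+1.
Notation coord := (@Defs.coord R m.+1 M).
#[local] Opaque derive.

Lemma product_variation_le (B C k Z N u v : R) : 0 <= B * C -> 0 <= k * Z ->
  B * C + k * Z <= N -> 0 <= u -> 0 <= v -> B * (C * u) + k * v * Z <= N * (u + v).
Proof.
move=> h1 h2 h3 u0 v0.
have e1 : B * C * u <= N * u by apply: ler_wpM2r; lra.
have e2 : k * Z * v <= N * v by apply: ler_wpM2r; lra.
lra.
Qed.

(** A single integer serves as a Lipschitz constant and, inverted, as the distance at which it is
    valid; [compact_uniform_scale] can then handle both at once. *)
Lemma exists_scale (c delta : R) : 0 < delta ->
  exists N : nat, c <= N.+1%:R /\ N.+1%:R^-1 < delta.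
Proof.
move=> d0; exists (Num.bound (`|c| + delta^-1)).
have H : `|c| + delta^-1 < (Num.bound (`|c| + delta^-1)).+1%:R.
  apply: (@lt_le_trans _ _ (Num.bound (`|c| + delta^-1))%:R); last by rewrite ler_nat.
  by apply: archi_boundP; rewrite addr_ge0// invr_ge0 ltW.
split.
  by rewrite (le_trans (ler_norm c))// ltW// (le_lt_trans _ H)// lerDl invr_ge0 ltW.
rewrite -[ltRHS]invrK ltf_pV2 ?posrE ?invr_gt0 ?ltr0Sn//.
by rewrite (le_lt_trans _ H)// lerDr.
Qed.

Lemma coord_of_coord_phi (a b : chart M) x (w : V) : dom a x -> dom b x ->
  @Defs.coord R m.+1 M b x (of_coord a (phi a x) w) = 'D_w (transition a b) (phi a x).
Proof.
move=> ax bx; rewrite -(coord_of_coord w (overlap_phi ax bx)).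
have H x' (v : V) : x = x' -> @Defs.coord R m.+1 M b x v = @Defs.coord R m.+1 M b x' v by move=> ->.
by apply: H; rewrite phiK.
Qed.

(* The field along z supported in ]s1, s2[ which, in the chart a, is f times a
   constant vector. *)
Definition test_field (z : R -> M) (a : chart M) (s1 s2 : R) (f : R -> R) (e : V)
    (s : R) : tangent (z s) :=
  if s1 < s < s2 then (of_coord a (phi a (z s)) (f s *: e) : V) else 0.

Context (z : R -> M) (a : chart M) (s1 s2 : R) (f : R -> R) (e : V) (kappa a0 b0 : R).
Hypothesis cz : {within `[0, 1], continuous z}.
Hypothesis s12 : s1 < s2.
Hypothesis azs : segment_in z a s1 s2.
Hypothesis f_lip : forall s t, `|f s - f t| <= kappa * `|s - t|.
Hypothesis a0s : s1 < a0.
Hypothesis b0s : b0 < s2.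
Hypothesis f0 : forall t, t <= a0 \/ b0 <= t -> f t = 0.

Let xi := test_field z a s1 s2 f e.
Let Y (r : R) : V := phi a (z (clamp s1 s2 r)).

Lemma dom_clamp r : dom a (z (clamp s1 s2 r)).
Proof. by have [? ? ? H] := azs; apply: H; exact/clamp_itv/ltW. Qed.

Lemma continuous_curve_clamp : continuous Y.
Proof.
have [s10 _ s21 H] := azs.
have cY' : {within `[s1, s2], continuous z}.
  by apply: continuous_subspaceW cz => t /=; rewrite !in_itv/= => /andP[? ?]; apply/andP; split; lra.
have := continuous_comp_clamp (ltW s12) cY' => czc r.
by apply: (@continuous_comp _ _ _ (z \o clamp s1 s2) (phi a)); [exact: czc|exact/phi_continuous/dom_clamp].
Qed.

Lemma field_coord_test b s : dom b (z s) -> field_coord xi b s =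
  if s1 < s < s2 then f s *: 'D_e (transition a b) (Y s) else 0.
Proof.
move=> bzs; rewrite /field_coord /xi /test_field; case: ifPn => s12s.
  have azs' : dom a (z s).
    by have [_ _ _ H] := azs; apply: H; move: s12s => /andP[? ?]; rewrite !ltW.
  rewrite coord_of_coord_phi// /Y clamp_id; last by move: s12s => /andP[? ?]; rewrite !ltW.
  by rewrite deriveZdir//; apply: differentiable_transition; exact: overlap_phi.
rewrite coordE -[X in 'D_X _ _]/(0 : V).
exact: derive0.
Qed.

Lemma field_coord_test_id s : dom a (z s) -> field_coord xi a s =
  if s1 < s < s2 then f s *: e else 0.
Proof.
move=> azs'; rewrite field_coord_test//; case: ifPn => // s12s.
rewrite derive_transition_id// /Y; exists (z (clamp s1 s2 s)) => //; exact: dom_clamp.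
Qed.

Lemma field_coord_test_eq0 b s : dom b (z s) -> s <= a0 \/ b0 <= s ->
  field_coord xi b s = 0.
Proof. by move=> bzs H; rewrite field_coord_test// f0// scale0r; case: ifP. Qed.

(** Admissible fields are tested in every chart b, while Y lives in the chart a. Where r is at most
    s1 or at least s2, the field vanishes around r because f does, with a margin given by a0 and b0.
    Inside, both charts contain z r, and the field is f times a C^1 function of Y. *)
Lemma dominated_near b s t r : segment_in z b s t -> s <= r <= t ->
  exists N : nat, \forall r1 \near r, `[s, t]%classic r1 ->
    forall r', s <= r' <= t -> `|r' - r1| < N.+1%:R^-1 ->
    `|field_coord xi b r' - field_coord xi b r1| <= N.+1%:R * (`|Y r' - Y r1| + `|r' - r1|).
Proof.
move=> [s0 st t1 bz] rst.
have nearE (delta : R) (N : nat) (Q : R -> R -> Prop) : 0 < delta -> N.+1%:R^-1 < delta / 2 ->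
    (forall r1 r', s <= r1 <= t -> s <= r' <= t -> `|r1 - r| < delta -> `|r' - r| < delta -> Q r1 r') ->
    \forall r1 \near r, `[s, t]%classic r1 -> forall r', s <= r' <= t -> `|r' - r1| < N.+1%:R^-1 ->
    Q r1 r'.
  move=> d0 Nd HQ; exists (delta / 2) => /=; first by rewrite divr_gt0.
  move=> r1 /= rr1; rewrite in_itv/= => r1st r' r'st r'r1; apply: HQ => //.
    by rewrite distrC (lt_trans rr1)// ltr_pdivrMr// mulr_natr mulr2n ltrDl.
  rewrite [delta]splitr (le_lt_trans (ler_distD r1 _ _))// ltrD//; first exact: lt_trans r'r1 Nd.
  by rewrite distrC.
have zero_case (delta : R) : 0 < delta ->
    (forall r1, `|r1 - r| < delta -> r1 <= a0 \/ b0 <= r1) ->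
  exists N : nat, \forall r1 \near r, `[s, t]%classic r1 ->
    forall r', s <= r' <= t -> `|r' - r1| < N.+1%:R^-1 ->
    `|field_coord xi b r' - field_coord xi b r1| <= N.+1%:R * (`|Y r' - Y r1| + `|r' - r1|).
  move=> d0 H; have [N [_ Nd]] := @exists_scale 0 (delta / 2) (divr_gt0 d0 (@ltr0Sn _ 1)).
  exists N; apply: (nearE _ _ _ d0 Nd) => r1 r' r1st r'st /H r1d /H r'd.
  rewrite !field_coord_test_eq0//; [|exact: bz|exact: bz].
  by rewrite subrr normr0 mulr_ge0// addr_ge0.
have [rs1|s1r] := leP r s1.
  apply: (zero_case (a0 - s1)); first by rewrite subr_gt0.
  by move=> r1; rewrite ltr_norml => /andP[_ H]; left; lra.
have [s2r|rs2] := leP s2 r.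
  apply: (zero_case (s2 - b0)); first by rewrite subr_gt0.
  by move=> r1; rewrite ltr_norml => /andP[H _]; right; lra.
have rcl : clamp s1 s2 r = r by rewrite clamp_id// !ltW.
have oab : overlap a b (Y r).
  by rewrite /Y rcl; apply: overlap_phi; [have := dom_clamp r; rewrite rcl|exact: bz].
have [rr [C [rr0 C0 lipC]]] := C1_locally_lipschitz (@overlap_open _ _ _ a b)
  ((@transition_smooth _ _ M a b 2%N).2 e) oab.
have [d1 d10 Hd1] : exists2 d : R, 0 < d & forall r', `|r' - r| < d -> ball (Y r) rr (Y r').
  have cYr : {for r, continuous Y} by exact: continuous_curve_clamp.
  have [d /= d0 Hd] := cYr _ (nbhsx_ballx (Y r) _ rr0).
  by exists d => // r' r'd; apply: Hd; rewrite /= distrC.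
(* [d1] keeps Y in the ball where the derivative of the transition map is Lipschitz, 1 serves to
   bound f, and the other two keep the parameter inside []s1, s2[]. *)
pose delta := Num.min (Num.min d1 1) (Num.min (r - s1) (s2 - r)).
have d0 : 0 < delta by rewrite !lt_min d10 ltr01 !subr_gt0 s1r.
have dP r' : `|r' - r| < delta -> [/\ s1 < r' < s2, ball (Y r) rr (Y r') & `|r' - r| < 1].
  rewrite !lt_min => /andP[/andP[h1 h2] /andP[h3 h4]]; split => //; last exact: Hd1.
  by move: h3 h4; rewrite !ltr_norml => /andP[? ?] /andP[? ?]; apply/andP; split; lra.
pose Z := `|'D_e (transition a b) (Y r)| + C * rr.
pose Bf := `|f r| + `|kappa|.
have ZP y : ball (Y r) rr y -> `|'D_e (transition a b) y| <= Z.
  move=> yr; rewrite -[X in `|X|](subrK ('D_e (transition a b) (Y r))) addrC.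
  rewrite (le_trans (ler_normD _ _))// lerD// (le_trans (lipC _ _ (ballxx _ rr0) yr))//.
  by rewrite ler_wpM2l// distrC ltW//; move: yr; rewrite -ball_normE.
have kap0 (r1 r2 : R) : kappa * `|r1 - r2| <= `|kappa| * `|r1 - r2| by rewrite ler_wpM2r// ler_norm.
have BfP r' : `|r' - r| < 1 -> `|f r'| <= Bf.
  move=> r'r; rewrite -[X in `|X|](subrK (f r)) addrC (le_trans (ler_normD _ _))// lerD//.
  rewrite (le_trans (f_lip _ _))// (le_trans (kap0 _ _))//.
  by rewrite ler_piMr// ltW.
have Z0 : 0 <= Z by rewrite addr_ge0// mulr_ge0// ltW.
have Bf0 : 0 <= Bf by rewrite addr_ge0.
(* In the product rule, [Bf * C] multiplies the increment of Y and [|kappa| * Z] that of the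
   parameter. *)
have [N [NC Nd]] := @exists_scale (Bf * C + `|kappa| * Z) (delta / 2) (divr_gt0 d0 (@ltr0Sn _ 1)).
exists N; apply: (nearE _ _ _ d0 Nd) => r1 r' r1st r'st /dP[r1s br1 r1r] /dP[r's br' r'r].
rewrite !field_coord_test; [|exact: bz|exact: bz].
rewrite r1s r's.
set D' := 'D_e _ (Y r'); set D1 := 'D_e _ (Y r1).
have -> : f r' *: D' - f r1 *: D1 = f r' *: (D' - D1) + (f r' - f r1) *: D1.
  by rewrite scalerBr scalerBl addrA subrK.
rewrite (le_trans (ler_normD _ _))// !normrZ.
apply: (@le_trans _ _ (Bf * (C * `|Y r' - Y r1|) + (`|kappa| * `|r' - r1|) * Z)).
  apply: lerD; apply: ler_pM => //; [exact: BfP|exact: lipC| |exact: ZP].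
  by rewrite (le_trans (f_lip _ _)).
have NC0 : 0 <= Bf * C by rewrite mulr_ge0.
have NK0 : 0 <= `|kappa| * Z by rewrite mulr_ge0.
by apply: product_variation_le NC _ _ => //; exact: normr_ge0.
Qed.

Lemma field_coord_test_dominated b s t : segment_in z b s t ->
  exists N : nat, forall r r', s <= r <= t -> s <= r' <= t -> `|r' - r| < N.+1%:R^-1 ->
    `|field_coord xi b r' - field_coord xi b r| <= N.+1%:R * (`|Y r' - Y r| + `|r' - r|).
Proof.
move=> sg; have [s0 st t1 bz] := sg.
pose P (N : nat) r := forall r', s <= r' <= t -> `|r' - r| < N.+1%:R^-1 ->
    `|field_coord xi b r' - field_coord xi b r| <= N.+1%:R * (`|Y r' - Y r| + `|r' - r|).
suff [N HN] : exists N, forall r, `[s, t]%classic r -> P N r.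
  by exists N => r r' rst; apply: HN; rewrite /= in_itv.
apply: compact_uniform_scale; first exact: segment_compact.
  move=> r; rewrite /= in_itv/= => rst.
  exact: dominated_near.
move=> N N' r NN' PN r' r'st r'r.
have NN'R : N.+1%:R <= N'.+1%:R :> R by rewrite ler_nat.
apply: le_trans (PN r' r'st _) _.
  by apply: lt_le_trans r'r _; rewrite lef_pV2 ?posrE ?ltr0Sn.
by rewrite ler_wpM2r// addr_ge0.
Qed.

Lemma abs_cont_field_coord_test b s t : abs_cont s1 s2 (phi a \o z) ->
  segment_in z b s t -> abs_cont s t (field_coord xi b).
Proof.
move=> acz sg; have [N HN] := field_coord_test_dominated sg.
apply: (@abs_cont_dominated_by _ _ _ _ _ N.+1%:R N.+1%:R^-1 Y).
- by rewrite invr_gt0 ltr0Sn.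
- by rewrite ler0n.
- move=> r r' sr rr' r't r'r; have := HN r r'.
  rewrite sr r't (le_trans rr' r't) (le_trans sr rr') ger0_norm ?subr_ge0//.
  by apply.
exact: (abs_cont_comp_clamp _ _ (ltW s12) acz).
Qed.

Lemma slope_Y_off r : ~ (s1 <= r <= s2) -> slope Y r t @[t --> r^'] --> (0 : V).
Proof.
move=> H; apply: (@slope_eq _ _ _ _ _ (fun=> Y r)); last exact: slope_cst; last by [].
have [rs1|s1r] := ltP r s1.
  near=> t; rewrite /Y !clamp_left ?(ltW s12) ?(ltW rs1)// ltW//.
  by near: t; apply: nbhs_dnbhs; exact: lt_nbhsl.
have rs2 : s2 < r by rewrite ltNge; apply/negP => rs2; apply: H; rewrite s1r.
near=> t; rewrite /Y !clamp_right ?(ltW s12) ?(ltW rs2)// ltW//.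
by near: t; apply: nbhs_dnbhs; exact: lt_nbhsr.
Unshelve. all: by end_near. Qed.

(* [deriv01] is a junk constant where the derivative does not exist. *)
Lemma deriv01_field_coord_test_le b s t (w : R -> V) : segment_in z b s t ->
  exists C0 : R, 0 <= C0 /\ forall r, s < r < t -> slope Y r t @[t --> r^'] --> w r ->
    `|deriv01 (field_coord xi b) r| ^+ 2 <= C0 * (`|w r| ^+ 2 + 1).
Proof.
move=> sg; have [N HN] := field_coord_test_dominated sg; have [sg0 sgst sgt1 _] := sg.
pose K := `|(point : V)| + N.+1%:R.
have K0 : 0 <= K by rewrite addr_ge0.
exists (2 * K ^+ 2); split; first by rewrite mulr_ge0// sqr_ge0.
move=> r /andP[sr rt] wr.
have r01 : 0 <= r <= 1 by apply/andP; split; lra.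
suff H : `|deriv01 (field_coord xi b) r| <= K * (`|w r| + 1).
  apply: (@le_trans _ _ ((K * (`|w r| + 1)) ^+ 2)).
    by rewrite ler_sqr ?nnegrE// mulr_ge0// addr_ge0.
  have H2 : (`|w r| + 1) ^+ 2 <= 2 * (`|w r| ^+ 2 + 1) by have := sqr_ge0 (`|w r| - 1); nra.
  rewrite exprMn [leRHS](_ : _ = K ^+ 2 * (2 * (`|w r| ^+ 2 + 1))); last by ring.
  by apply: ler_wpM2l H2; exact: sqr_ge0.
have pF := within01_proper r01.
have [df|ndf] := pselect (derivable01 (field_coord xi b) r); last first.
  have -> : deriv01 (field_coord xi b) r = point.
    by rewrite /deriv01; apply: dvgP; exact: ndf.
  apply: (@le_trans _ _ K); first by rewrite lerDl ler0n.
  by rewrite ler_peMr// lerDr.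
have H1 := derivable01_slope df; have H2 := slope_within01 wr.
have H1n : `|slope (field_coord xi b) r t| @[t --> within `[0, 1] r^'] -->
  `|deriv01 (field_coord xi b) r| by exact: cvg_norm.
have H2n : N.+1%:R * (`|slope Y r t| + 1) @[t --> within `[0, 1] r^'] -->
    N.+1%:R * (`|w r| + 1).
  by apply: cvgMr; apply: cvgD; [exact: cvg_norm|exact: cvg_cst].
apply: (@le_trans _ _ (N.+1%:R * (`|w r| + 1))); last first.
  by rewrite ler_wpM2r ?addr_ge0// /K lerDr.
apply: ler_cvg_to H1n H2n _.
have [_ Fne] := punctured_at_within01 r.
have near1 : \forall t' \near r, s <= t' <= t /\ `|t' - r| < N.+1%:R^-1.
  near=> t'; split.
    by apply/andP; split; apply: ltW; near: t'; [exact: lt_nbhsr|exact: lt_nbhsl].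
  by rewrite distrC; near: t'; apply: (nbhsx_ballx r); rewrite invr_gt0 ltr0Sn.
have near2 : \forall t' \near within `[0, 1] r^', s <= t' <= t /\ `|t' - r| < N.+1%:R^-1.
  by apply: cvg_within; exact: nbhs_dnbhs.
near=> t'.
have [t'st t'r] : s <= t' <= t /\ `|t' - r| < N.+1%:R^-1 by near: t'.
have t'ne : t' != r by near: t'.
have t'r0 : 0 < `|t' - r| by rewrite normr_gt0 subr_eq0.
rewrite /slope !normrZ normfV ler_pdivrMl//.
rewrite mulrCA mulrDr mulr1 mulrA divff ?gt_eqF// mul1r.
by apply: HN => //; rewrite !ltW.
Unshelve. all: by end_near. Qed.

End weak_euler_lagrange.

(** * The lemma of du Bois-Reymond *)

Section du_bois_reymond.
Context {R : realType}.
Notation mu := (@lebesgue_measure R).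

Lemma Rintegral_itvoo (h : R -> R) (s x y : R) : mu.-integrable setT (EFin \o h) ->
  s <= x -> x < y -> (\int[mu]_(t in `]x, y[) h t)%R =
  (\int[mu]_(t in `[s, y]) h t)%R - (\int[mu]_(t in `[s, x]) h t)%R.
Proof.
move=> ih sx xy; have hi i := integrable_itv i ih.
rewrite Rintegral_itv_bndo_bndc//.
by rewrite Rintegral_itvB// bnd_simp ltW.
Qed.

Lemma trapezoid_continuous (a b h : R) : 0 < h -> continuous (trapezoid a b h).
Proof.
move=> h0 x; have H c : {for x, continuous (fun t : R => clamp 0 1 ((t - c) / h))}.
  apply: (@continuous_comp _ _ _ (fun t : R => (t - c) / h) (clamp 0 1)); last exact: clamp_continuous.
  by apply: cvgMl; apply: cvgB; [exact: cvg_id|exact: cvg_cst].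
exact: cvgB (H a) (H b).
Qed.

Lemma trapezoid_lim (a b t : R) : a <= b ->
  trapezoid a b k.+1%:R^-1 t @[k --> \oo] --> ((a < t <= b)%R%:R : R).
Proof.
move=> ab; apply: cvg_near_eq (cvg_cst _).
have h0 (k : nat) : 0 < k.+1%:R^-1 :> R by rewrite invr_gt0 ltr0Sn.
have [ta|at_] := leP t a.
  by near=> k; rewrite trapezoid_eq0//; left.
have [tb|bt] := leP t b.
  near=> k; rewrite /trapezoid clamp_right ?ler01//; last first.
    rewrite ler_pdivlMr// mul1r ltW//.
    by near: k; apply: (near_infty_natSinv_lt (PosNum _)); rewrite subr_gt0.
  by rewrite clamp_left ?ler01 ?subr0// pmulr_lle0// subr_le0.
near=> k; rewrite trapezoid_eq0//; right; rewrite -lerBrDl ltW//.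
by near: k; apply: (near_infty_natSinv_lt (PosNum _)); rewrite subr_gt0.
Unshelve. all: by end_near. Qed.

Lemma integrable_trapezoid (X : R -> R) (a b h : R) : 0 < h -> a <= b ->
  mu.-integrable setT (EFin \o X) ->
  mu.-integrable setT (EFin \o (fun t => X t * trapezoid a b h t)).
Proof.
move=> h0 ab iX; apply: (le_integrable measurableT _ _ iX).
  apply/measurable_EFinP; apply: measurable_funM.
    by apply/measurable_EFinP; exact: measurable_int iX.
  by apply: continuous_measurable_fun; exact: trapezoid_continuous.
move=> t _ /=; rewrite lee_fin normrM ler_piMr//.
by have /andP[? ?] := trapezoid_ge0_le1 t h0 ab; rewrite ger0_norm.
Qed.

Lemma trapezoid_slopeE (P : R -> R) (a b h t : R) : P t * trapezoid_slope a b h t =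
  h^-1 * ((P \_ `]a, a + h[) t - (P \_ `]b, b + h[) t).
Proof.
rewrite /trapezoid_slope !patchE !mem_setE !in_itv/=.
by rewrite -[point]/(0 : R); case: ifP => _; case: ifP => _; rewrite /=; ring.
Qed.

Lemma integrable_restrict (P : R -> R) (i : interval R) : mu.-integrable setT (EFin \o P) ->
  mu.-integrable setT (EFin \o (P \_ [set` i])).
Proof. by move=> iP; rewrite -restrict_EFin -integrable_mkcond//; exact: integrable_itv. Qed.

Lemma integrable_trapezoid_slope (P : R -> R) (a b h : R) :
  mu.-integrable setT (EFin \o P) ->
  mu.-integrable setT (EFin \o (fun t => P t * trapezoid_slope a b h t)).
Proof.
move=> iP.
rewrite (_ : EFin \o _ = EFin \o (fun t => h^-1 * ((P \_ `]a, a + h[) t - (P \_ `]b, b + h[) t))); last first.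
  by apply/funext => t /=; rewrite trapezoid_slopeE.
have i1 := integrable_restrict `]a, a + h[ iP; have i2 := integrable_restrict `]b, b + h[ iP.
have i3 : mu.-integrable setT (EFin \o (fun t => (P \_ `]a, a + h[) t - (P \_ `]b, b + h[) t)).
  exact: (integrableB measurableT i1 i2).
exact: (integrableZl measurableT h^-1 i3).
Qed.

(** The two ramps turn the integral into difference quotients of the primitive of P at a and at b,
    ready for Lebesgue differentiation as h tends to 0. *)
Lemma Rintegral_trapezoid_slope (P : R -> R) (s a b h : R) : 0 < h -> s <= a -> a <= b ->
  mu.-integrable setT (EFin \o P) ->
  (\int[mu]_t (P t * trapezoid_slope a b h t))%R =
  slope (V := R) (fun x => \int[mu]_(t in `[s, x]) P t)%R a (a + h) -
  slope (V := R) (fun x => \int[mu]_(t in `[s, x]) P t)%R b (b + h).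
Proof.
move=> h0 sa ab iP.
under eq_Rintegral do rewrite trapezoid_slopeE.
have i1 := integrable_restrict `]a, a + h[ iP; have i2 := integrable_restrict `]b, b + h[ iP.
rewrite RintegralZl//; last exact: (integrableB measurableT i1 i2).
rewrite RintegralB// -!Rintegral_mkcond.
rewrite (@Rintegral_itvoo P s)//; last by rewrite ltrDl.
rewrite (@Rintegral_itvoo P s)//; [|exact: le_trans ab|by rewrite ltrDl].
by rewrite /slope ![_ + h - _]addrAC !subrr !add0r -scalerBr.
Qed.

(** If a < b are points where the primitive of P has derivative P, letting h tend to 0 in the
    hypothesis gives \int_a^b X + P(a) - P(b) = 0. Such points have full measure, so P - \int X
    takes there the value it has at one of them, g. *)
Lemma du_bois_reymond (s1 s2 : R) (X P : R -> R) : s1 < s2 ->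
  mu.-integrable setT (EFin \o X) -> mu.-integrable setT (EFin \o P) ->
  (forall a b h, 0 < h -> s1 < a -> a <= b -> b + h < s2 ->
    (\int[mu]_t (X t * trapezoid a b h t + P t * trapezoid_slope a b h t))%R = 0) ->
  exists c, {ae mu, forall r, s1 < r < s2 -> P r = c + (\int[mu]_(t in `[s1, r]) X t)%R}.
Proof.
move=> s12 iX iP H.
pose A r := slope (V := R) (fun x => \int[mu]_(t in `[s1, x]) P t)%R r t @[t --> r^'] --> P r.
pose G r := (\int[mu]_(t in `[s1, r]) X t)%R.
have aeA := ae_slope_integral s1 iP.
have key a b : s1 < a -> a < b -> b < s2 -> A a -> A b -> P b - G b = P a - G a.
  move=> s1a ab bs2 Aa Ab; have leab := ltW ab.
  pose hn (k : nat) : R := (k.+1%:R)^-1.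
  have hn0 k : 0 < hn k by rewrite invr_gt0 ltr0Sn.
  have hA r : A r -> slope (V := R) (fun x => \int[mu]_(t in `[s1, x]) P t)%R r (r + hn k) @[k --> \oo] --> P r.
    move=> Ar; suff tk : r + hn k @[k --> \oo] --> r^' by exact: (cvg_comp _ _ tk Ar).
    move=> U [e /= e0 HU].
    suff : \forall k \near \oo, U (r + hn k) by [].
    near=> k; apply: HU => /=.
      rewrite opprD addNKr normrN ger0_norm ?ltW//.
      by near: k; exact: near_infty_natSinv_lt (PosNum e0).
    by rewrite -subr_eq0 addrAC subrr add0r gt_eqF.
  have limX : (\int[mu]_t (X t * trapezoid a b (hn k) t))%R @[k --> \oo] --> G b - G a.
    have XE : X \_ `]a, b] = fun t => X t * (a < t <= b)%R%:R.
      apply/funext => t; rewrite patchE mem_setE in_itv/=.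
      by case: ifP => _; rewrite ?mulr1 ?mulr0.
    have -> : G b - G a = (\int[mu]_t (X t * (a < t <= b)%R%:R))%R.
      rewrite /G Rintegral_itvB ?bnd_simp//; [|exact: integrable_itv|exact: ltW].
      by rewrite Rintegral_mkcond XE.
    apply: fine_cvg; rewrite fineK; last first.
      have := integrable_restrict `]a, b] iX; rewrite XE => /(integrable_fin_num measurableT).
      exact.
    apply: (@dominated_cvg _ _ _ mu setT measurableT _ _ (fun t => (`|X t|)%:E)) => //.
    - by move=> k; apply: measurable_int; exact: integrable_trapezoid iX.
    - move=> t _; apply: cvg_EFin; first by near=> k.
      by apply: cvgMr; exact: trapezoid_lim.
    - by apply: integrable_abse iX.
    - move=> k t _ /=; rewrite lee_fin normrM ler_piMr//.
      by have /andP[? ?] := trapezoid_ge0_le1 t (hn0 k) leab; rewrite ger0_norm.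
  have lim0 := @cvgD _ _ _ _ eventually_filter _ _ _ _ limX (@cvgB _ _ _ _ eventually_filter _ _ _ _ (hA a Aa) (hA b Ab)).
  have near0 : \forall k \near \oo, (\int[mu]_t (X t * trapezoid a b (hn k) t))%R +
     (slope (V := R) (fun x => \int[mu]_(t in `[s1, x]) P t)%R a (a + hn k) -
  slope (V := R) (fun x => \int[mu]_(t in `[s1, x]) P t)%R b (b + hn k)) = 0.
    near=> k; rewrite -Rintegral_trapezoid_slope ?(ltW s1a)//.
    rewrite -RintegralD//; [|exact: integrable_trapezoid|exact: integrable_trapezoid_slope].
    apply: H => //; rewrite -ltrBrDl.
    near: k; apply: (near_infty_natSinv_lt (PosNum _)).
    by rewrite subr_gt0.
  have lim1 : G b - G a + (P a - P b) = 0.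
    apply: (cvg_unique _ lim0); first exact: norm_hausdorff.
    apply: cvg_near_eq (cvg_cst _).
    by apply: filterS near0 => k /= ->.
  lra.
have [g [/andP[s1g gs2] Ag]] : exists g, s1 < g < s2 /\ A g.
  have [g [gs Ag]] := ae_itv_exists s12 aeA.
  by exists g; split => //; apply: Ag; case/andP: gs.
exists (P g - G g).
apply: ae_imp aeA => r /= Ar /andP[s1r rs2].
have {}Ar : A r := Ar s1r.
have [rg|gr|<-] := ltgtP r g; last by rewrite subrK.
  by rewrite (key r g)// subrK.
by rewrite -(key g r)// subrK.
Unshelve. all: by end_near. Qed.

End du_bois_reymond.

(** * The Euler-Lagrange equation almost everywhere *)

Section euler_lagrange_ae.
Context {R : realType} {m : nat} {M : manifold R m.+1}.
Notation mu := (@lebesgue_measure R).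
Notation V := 'rV[R]_m.+1.
Notation coord := (@Defs.coord R m.+1 M).
#[local] Opaque derive.

Lemma restrict_in (T : Type) (U : pointedType) (D : set T) (f : T -> U) x : D x -> (f \_ D) x = f x.
Proof. by move=> Dx; rewrite patchE mem_set. Qed.

Lemma restrict_out (T : Type) (U : pointedType) (D : set T) (f : T -> U) x : ~ D x -> (f \_ D) x = point.
Proof. by move=> Dx; rewrite patchE memNset. Qed.

Lemma restrict_lincomb_out (D : set R) (k1 k2 : R -> R) r u v : ~ D r ->
  (k1 \_ D) r * u + (k2 \_ D) r * v = 0.
Proof. by move=> Dr; rewrite !restrict_out// -[point]/(0 : R) !mul0r addr0. Qed.

Lemma du_bois_reymond_restrict (s1 s2 : R) (X P : R -> R) : s1 < s2 ->
  mu.-integrable setT (EFin \o (X \_ `[s1, s2])) ->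
  mu.-integrable setT (EFin \o (P \_ `[s1, s2])) ->
  (forall a b h, 0 < h -> s1 < a -> a <= b -> b + h < s2 ->
    (\int[mu]_t ((X \_ `[s1, s2]) t * trapezoid a b h t +
                 (P \_ `[s1, s2]) t * trapezoid_slope a b h t))%R = 0) ->
  exists c, {ae mu, forall r, s1 < r < s2 -> P r = c + (\int[mu]_(t in `[s1, r]) X t)%R}.
Proof.
move=> s12 iX iP H; have [c Hc] := du_bois_reymond s12 iX iP H.
exists c; apply: ae_imp Hc => r {}H rs; have := H rs.
have rs' : `[s1, s2]%classic r by rewrite /= in_itv/=; case/andP: rs => *; rewrite !ltW.
rewrite (restrict_in _ rs') => ->; congr (_ + _); congr fine; apply: eq_integral => t.
rewrite inE/= in_itv/= => /andP[h1 h2].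
rewrite restrict_in//= in_itv/= h1 (le_trans h2)//.
by case/andP: rs => _ /ltW.
Qed.

Lemma d_x_chartE (L : forall x : M, tangent x -> R) (a : chart M) y w u : C1_TM L -> img a y ->
  d_x_chart L a y w u = 'd (chart_lagrangian L a) (y, w) (u, 0).
Proof.
move=> L1 ay; rewrite -deriveE; last exact: differentiable_chart_lagrangian.
by rewrite derive_pair_fst.
Qed.

Lemma d_v_chartE (L : forall x : M, tangent x -> R) (a : chart M) y w u : C1_TM L -> img a y ->
  d_v_chart L a y w u = 'd (chart_lagrangian L a) (y, w) (0, u).
Proof.
move=> L1 ay; rewrite -deriveE; last exact: differentiable_chart_lagrangian.
by rewrite derive_pair_snd.
Qed.

Lemma d_x_chartZ (L : forall x : M, tangent x -> R) (a : chart M) y w c u : C1_TM L -> img a y ->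
  d_x_chart L a y w (c *: u) = c * d_x_chart L a y w u.
Proof.
move=> L1 ay; rewrite !d_x_chartE// -[RHS]linearZ/=; congr ('d _ _ (_, _)).
by rewrite scaler0.
Qed.

Lemma d_v_chartZ (L : forall x : M, tangent x -> R) (a : chart M) y w c u : C1_TM L -> img a y ->
  d_v_chart L a y w (c *: u) = c * d_v_chart L a y w u.
Proof.
move=> L1 ay; rewrite !d_v_chartE// -[RHS]linearZ/=; congr ('d _ _ (_, _)).
by rewrite scaler0.
Qed.

Lemma d_v_chartD (L : forall x : M, tangent x -> R) (a : chart M) y w u v : C1_TM L -> img a y ->
  d_v_chart L a y w (u + v) = d_v_chart L a y w u + d_v_chart L a y w v.
Proof.
move=> L1 ay; rewrite !d_v_chartE// -[RHS]linearD/=; congr ('d _ _ (_, _)).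
by rewrite addr0.
Qed.

Context (z : R -> M) (a : chart M) (s1 s2 : R) (w : R -> V) (N : set R).
Hypothesis cz : {within `[0, 1], continuous z}.
Hypothesis acz : forall b s t, segment_in z b s t -> abs_cont s t (phi b \o z).
Hypothesis s12 : s1 < s2.
Hypothesis azs : segment_in z a s1 s2.
Let Y (r : R) : V := phi a (z (clamp s1 s2 r)).
Hypothesis sw : speed s1 s2 Y w N.
Hypothesis iw : mu.-integrable setT (EFin \o (fun r => `|w r| ^+ 2)).

Lemma speed_ae_off : {ae mu, forall r, ~ N r}.
Proof.
have [[mN N0] _ _ _ _] := sw; exists N; split => // r /= H.
by apply: contrapT => Nr; apply: H.
Qed.

Lemma near_clampE r : s1 < r < s2 -> \forall t \near r, clamp s1 s2 t = t.
Proof.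
move=> /andP[s1r rs2]; near=> t; rewrite clamp_id//; apply/andP; split; apply: ltW.
  by near: t; exact: lt_nbhsr.
by near: t; exact: lt_nbhsl.
Unshelve. all: by end_near. Qed.

Lemma mem_segment r : s1 < r < s2 -> 0 <= r <= 1 /\ dom a (z r).
Proof.
have [s10 _ s21 H] := azs; move=> /andP[s1r rs2]; split.
  by apply/andP; split; lra.
by apply: H; rewrite !ltW.
Qed.

Lemma deriv01_speed r : s1 < r < s2 -> ~ N r ->
  derivable01 (phi a \o z) r /\ deriv01 (phi a \o z) r = w r.
Proof.
move=> rs nN; have [r01 _] := mem_segment rs.
apply: deriv01_slope => //; apply: slope_within01.
have sl := speed_slope sw rs nN.
apply: slope_eq sl; last by rewrite /Y clamp_id//; case/andP: rs => *; rewrite !ltW.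
have H := near_clampE rs.
have H' : \forall t \near r^', clamp s1 s2 t = t by exact: nbhs_dnbhs.
by apply: filterS H' => t; rewrite /Y /= => ->.
Qed.

Lemma ae_slope_speed : {ae mu, forall r, slope Y r t @[t --> r^'] --> w r}.
Proof.
apply: ae_imp (ae_and speed_ae_off (ae_notin_seq [:: s1; s2])) => r [nN].
rewrite !inE negb_or => /andP[rs1 rs2].
have [rs|nrs] := boolP (s1 < r < s2).
  by have := speed_slope sw rs nN.
rewrite (speed_off sw); last by move=> [rs]; rewrite rs in nrs.
apply: slope_Y_off => // /andP[h1 h2]; move/negP: nrs; apply.
by rewrite !lt_neqAle h1 h2 eq_sym rs1 rs2.
Qed.

Lemma test_field_tangent (f : R -> R) (e : V) (kappa a0 b0 : R) :
  (forall s t, `|f s - f t| <= kappa * `|s - t|) ->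
  s1 < a0 -> b0 < s2 -> (forall t, t <= a0 \/ b0 <= t -> f t = 0) ->
  Omega12_tangent (test_field z a s1 s2 f e).
Proof.
move=> f_lip a0s b0s f0; have [s10 _ s21 _] := azs; split.
- by rewrite /test_field ltNge s10.
- by rewrite /test_field andbC ltNge s21.
move=> b s t sg; split.
  exact: (abs_cont_field_coord_test e cz s12 azs f_lip a0s b0s f0 (acz azs) sg).
have [C0 [C00 HC]] := deriv01_field_coord_test_le e cz s12 azs f_lip a0s b0s f0 w sg.
apply: (@le_lt_trans _ _ (\int[mu]_(r in `[s, t]) (C0 * (`|w r| ^+ 2 + 1))%:E)%E).
  apply: ge0_ae_le_integral.
  - by move=> r _; rewrite lee_fin sqr_ge0.
  - by move=> r _; rewrite lee_fin mulr_ge0// addr_ge0// sqr_ge0.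
  apply: ae_imp (ae_and ae_slope_speed (ae_notin_seq [:: s; t])) => r [sl].
  rewrite !inE negb_or => /andP[rs rt]; rewrite /= in_itv/= => /andP[h1 h2]; split.
    by rewrite h1.
  by rewrite lee_fin; apply: HC => //; rewrite !lt_neqAle h1 h2 eq_sym rs rt.
have i1 : mu.-integrable `[s, t] (EFin \o (fun r => `|w r| ^+ 2)).
  exact: integrable_itv.
have i2 := integrable_itv_cst1 s t.
have i3 : mu.-integrable `[s, t] (EFin \o (fun r => C0 * (`|w r| ^+ 2 + 1))).
  have H := integrableD (measurable_itv `[s, t] : measurable (_ : set (measurableTypeR R))) i1 i2.
  exact: (integrableZl (measurable_itv `[s, t] : measurable (_ : set (measurableTypeR R))) C0 H).
exact: integrable_lty i3.
Qed.

Context (L : forall x : M, tangent x -> R).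
Hypothesis L_C1 : C1_TM L.

(** [dA] reads the density at r in the chart selected at z r. By invariance it may be computed in
    the chart a, where the field is f times the constant e. *)
Lemma dA_density_test_in b (f f' : R -> R) (e : V) r : s1 < r < s2 -> ~ N r ->
  dom b (z r) -> slope (V := R) f r t @[t --> r^'] --> f' r ->
  [/\ derivable01 (phi b \o z) r, derivable01 (field_coord (test_field z a s1 s2 f e) b) r &
    dA_density L (test_field z a s1 s2 f e) b r =
      d_x_chart L a (Y r) (w r) e * f r + d_v_chart L a (Y r) (w r) e * f' r].
Proof.
move=> rs nN bzr sf; have [r01 azr] := mem_segment rs.
have [dz1 dz2] := deriv01_speed rs nN.
set xi := test_field z a s1 s2 f e.
have pu := punctured_at_dnbhs r.
have xir : field_coord xi a r = f r *: e by rewrite /xi field_coord_test_id// rs.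
have sxi : slope (field_coord xi a) r t @[t --> within `[0, 1] r^'] --> f' r *: e.
  apply: slope_within01.
  have pF : ProperFilter r^' by exact: Proper_dnbhs_numFieldType.
  have H : slope (fun t => f t *: e) r t @[t --> r^'] --> f' r *: e + f r *: 0.
    by apply: slopeZ => //; exact: slope_cst.
  rewrite scaler0 addr0 in H.
  apply: slope_eq H => //.
  have H' : \forall t \near r, s1 < t < s2.
    move: rs => /andP[s1r rs2]; near=> t; apply/andP; split.
      by near: t; exact: lt_nbhsr.
    by near: t; exact: lt_nbhsl.
  have {}H' : \forall t \near r^', s1 < t < s2 by exact: nbhs_dnbhs.
  apply: filterS H' => t ts; have [_ azt] := mem_segment ts.
  by rewrite /xi field_coord_test_id// ts.
have [dx1 dx2] := deriv01_slope r01 sxi.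
have [h1 h2 h3] := dA_density_transition L_C1 cz r01 azr bzr dz1 dx1.
split; [exact: h1|exact: h2|apply: etrans h3 _].
have aY : img a (Y r) by exists (z (clamp s1 s2 r)) => //; exact: dom_clamp.
have YE : phi a (z r) = Y r by rewrite /Y clamp_id//; case/andP: rs => *; rewrite !ltW.
rewrite /dA_density YE dz2 dx2 xir.
by rewrite d_x_chartZ// d_v_chartZ// mulrC [f' r * _]mulrC.
Unshelve. all: by end_near. Qed.

Lemma dA_density_test_out b (f : R -> R) (e : V) a0 b0 r :
  (forall t, t <= a0 \/ b0 <= t -> f t = 0) -> 0 <= r <= 1 -> dom b (z r) ->
  r < a0 \/ b0 < r -> dA_density L (test_field z a s1 s2 f e) b r = 0.
Proof.
move=> f0 r01 bzr H; set xi := test_field z a s1 s2 f e.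
have xi0 t : dom b (z t) -> t < a0 \/ b0 < t -> field_coord xi b t = 0.
  move=> bzt Ht; apply: (field_coord_test_eq0 e azs f0 bzt).
  by case: Ht => ?; [left|right]; exact: ltW.
have Ht : \forall t \near r, t < a0 \/ b0 < t.
  case: H => H; near=> t; [left|right]; near: t; [exact: lt_nbhsl|exact: lt_nbhsr].
have sxi : slope (field_coord xi b) r t @[t --> within `[0, 1] r^'] --> (0 : V).
  have pF := within01_proper r01.
  apply: (@slope_eq _ _ _ _ _ (fun=> 0)); last exact: slope_cst.
    have H1 := near_within_dnbhs (near_dom_curve cz r01 bzr).
    have H2 : \forall t \near within `[0, 1] r^', t < a0 \/ b0 < t.
      by apply: cvg_within; exact: nbhs_dnbhs.
    by apply: filterS2 H1 H2 => t h1 h2; rewrite xi0.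
  by rewrite xi0.
have [dx1 dx2] := deriv01_slope r01 sxi.
by rewrite /dA_density dx2 xi0// /d_x_chart /d_v_chart !derive0 addr0.
Unshelve. all: by end_near. Qed.

(* The domain of integration in [dA] is not known to be measurable: the two
   integrals are compared up to a null set only. *)
Lemma dA_test_field (f f' : R -> R) (e : V) (kappa a0 b0 : R) (pts : seq R) :
  s1 < a0 -> b0 < s2 -> (forall t, t <= a0 \/ b0 <= t -> f t = 0) ->
  (forall r, r \notin pts -> slope (V := R) f r t @[t --> r^'] --> f' r) ->
  dA L (test_field z a s1 s2 f e) =
  (\int[mu]_r ((((fun r => d_x_chart L a (Y r) (w r) e) \_ `[s1, s2]) r * f r +
    ((fun r => d_v_chart L a (Y r) (w r) e) \_ `[s1, s2]) r * f' r)%:E))%E.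
Proof.
move=> a0s b0s f0 sf; apply: ae_eq_integral_restrict.
apply: ae_imp (ae_and speed_ae_off (ae_notin_seq [:: s1, s2 & pts])) => r [nN].
rewrite !inE !negb_or => /and3P[rs1 rs2 rp].
rewrite [RHS](restrict_in _ (I : [set: R] r)).
have [rs|nrs] := boolP (s1 < r < s2).
  have [r01 azr] := mem_segment rs.
  have [h1 h2 h3] := dA_density_test_in e rs nN (chart_at_dom (z r)) (sf _ rp).
  rewrite restrict_in; last by split.
  have rs' : `[s1, s2]%classic r by rewrite /= in_itv/=; case/andP: rs => *; rewrite !ltW.
  congr EFin; apply: (etrans h3); congr (_ * _ + _ * _); exact: (esym (restrict_in _ rs')).
have rs : r < s1 \/ s2 < r.
  have [?|s1r] := ltP r s1; [by left|right].
  by move: nrs; rewrite lt_neqAle eq_sym rs1 s1r/= -leNgt le_eqVlt eq_sym (negbTE rs2).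
have rs' : ~ `[s1, s2]%classic r.
  by rewrite /= in_itv/= => /andP[? ?]; case: rs; lra.
rewrite [RHS](_ : _ = 0%:E); last by congr EFin; exact: restrict_lincomb_out.
set D := (X in patch _ X).
have [Dr|nDr] := pselect (D r); last exact: (restrict_out _ nDr).
rewrite (restrict_in _ Dr); have [r01 _ _] := Dr.
congr EFin; apply: (dA_density_test_out e f0 r01); first exact: chart_at_dom.
by case: rs => ?; [left|right]; lra.
Qed.

Lemma euler_lagrange_ae (e : V) :
  critical_point L z ->
  mu.-integrable setT (EFin \o ((fun r => d_x_chart L a (Y r) (w r) e) \_ `[s1, s2])) ->
  mu.-integrable setT (EFin \o ((fun r => d_v_chart L a (Y r) (w r) e) \_ `[s1, s2])) ->
  exists c, {ae mu, forall r, s1 < r < s2 -> d_v_chart L a (Y r) (w r) e =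
    c + (\int[mu]_(t in `[s1, r]) d_x_chart L a (Y t) (w t) e)%R}.
Proof.
move=> crit iX iP.
apply: (du_bois_reymond_restrict s12 iX iP) => a0 b0 h h0 s1a ab bs.
have f0 t : t <= a0 \/ b0 + h <= t -> trapezoid a0 b0 h t = 0 by exact: trapezoid_eq0.
have crit0 := crit _ (test_field_tangent e (fun s t => trapezoid_lipschitz a0 b0 s t h0) s1a bs f0).
rewrite (@dA_test_field _ (trapezoid_slope a0 b0 h) e (2 / h) _ _ [:: a0; a0 + h; b0; b0 + h] s1a bs f0) in crit0.
  by rewrite /Rintegral crit0.
by move=> r rp; exact: slope_trapezoid h0 rp.
Qed.

End euler_lagrange_ae.

(** * Fibre derivatives *)

Section scalar_functions.
Context {R : realType} {V : lmodType R} (f : V -> R).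
Hypothesis lf : scalar f.

Lemma scalar_fun0 : f 0 = 0.
Proof. by have := lf (-1) 0 0; rewrite scaler0 addr0 mulN1r addNr. Qed.

Lemma scalar_funD u v : f (u + v) = f u + f v.
Proof. by rewrite -[u in LHS]scale1r lf mul1r. Qed.

Lemma scalar_funZ c u : f (c *: u) = c * f u.
Proof. by rewrite -[c *: u]addr0 lf scalar_fun0 addr0. Qed.

Lemma scalar_funB u v : f (u - v) = f u - f v.
Proof. by rewrite scalar_funD -scaleN1r scalar_funZ mulN1r. Qed.

Lemma scalar_fun_sum n (u : 'I_n -> V) : f (\sum_i u i) = \sum_i f (u i).
Proof.
elim: n u => [|n IH] u; first by rewrite !big_ord0 scalar_fun0.
by rewrite !big_ord_recr/= scalar_funD IH.
Qed.

End scalar_functions.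

Lemma is_derive_scalar {R : realType} {V : normedModType R} (f : V -> R) (w u : V) :
  scalar f -> is_derive w u f (f u).
Proof.
move=> lf; have H : h^-1 *: ((f \o shift w) (h *: u) - f w) @[h --> (0 : R)^'] --> f u.
  apply: cvg_near_eq (cvg_cst _); near=> h.
  have -> : (f \o shift w) (h *: u) = f (h *: u) + f w by rewrite -scalar_funD.
  rewrite addrK scalar_funZ// [_ *: _]mulrA mulVf ?mul1r//.
  by near: h; exact: nbhs_dnbhs_neq.
apply: DeriveDef; first by apply/cvg_ex; exists (f u).
exact: (cvg_lim _ H).
Unshelve. all: by end_near. Qed.

Section fibers.
Context {R : realType} {m : nat} {M : manifold R m.+1}.
Notation V := 'rV[R]_m.+1.
Notation coord := (@Defs.coord R m.+1 M).
Context (a : chart M) (y : V).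
Hypothesis ay : img a y.

Lemma overlap_chart_at : overlap a (chart_at (phi_inv a y)) y.
Proof. by apply/overlapP; split => //; exact: chart_at_dom. Qed.

Lemma of_coordD (u v : V) : of_coord a y (u + v) = of_coord a y u + of_coord a y v :> V.
Proof. by rewrite !of_coordE deriveDdir//; apply/differentiable_transition/overlap_chart_at. Qed.

Lemma of_coordZ c (u : V) : of_coord a y (c *: u) = c *: (of_coord a y u : V) :> V.
Proof. by rewrite !of_coordE deriveZdir//; apply/differentiable_transition/overlap_chart_at. Qed.

Lemma of_coordB (u v : V) : of_coord a y (u - v) = of_coord a y u - of_coord a y v :> V.
Proof. by rewrite of_coordD -scaleN1r of_coordZ scaleN1r. Qed.

Lemma of_coord_neq0 (u : V) : u != 0 -> (of_coord a y u : V) != 0.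
Proof.
apply: contra => /eqP u0; rewrite -(coord_of_coordK u ay).
have -> : of_coord a y u = 0 by exact: u0.
by rewrite coordE -[X in 'D_X _ _]/(0 : V) derive0.
Qed.

Lemma of_coord_K (v : tangent (phi_inv a y)) : of_coord a y (coord a v) = v :> V.
Proof.
have [ax ey] := img_dom ay.
have := of_coordK v ax; rewrite [in X in X -> _]ey.
exact.
Qed.

Lemma d_v_of_coord (L : forall x : M, tangent x -> R) (w u : V) :
  d_v_chart L a y w u = d_v L (of_coord a y w) (of_coord a y u).
Proof.
have E : (fun h : R => h^-1 *: ((in_chart L a y \o shift w) (h *: u) - in_chart L a y w)) =
  (fun h : R => h^-1 *: ((@L (phi_inv a y) \o shift (of_coord a y w)) (h *: of_coord a y u) -
     @L (phi_inv a y) (of_coord a y w))).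
  apply/funext => h; congr (_ *: (@L (phi_inv a y) _ - _)); rewrite /shift.
  by apply: (etrans (of_coordD _ _)); congr (_ + _); exact: of_coordZ.
by rewrite /d_v_chart /d_v /derive E.
Qed.

Lemma scalar_of_coord (l : tangent (phi_inv a y) -> R) : scalar l ->
  scalar (fun u : V => l (of_coord a y u)).
Proof.
move=> ll c u v.
have -> : of_coord a y (c *: u + v) = c *: of_coord a y u + of_coord a y v.
  exact: (etrans (of_coordD _ _) (f_equal (fun x => x + _) (of_coordZ _ _))).
exact: ll.
Qed.

Context (L : forall x : M, tangent x -> R) (K : forall x : M, tangent x)
  (Q : forall x : M, tangent x -> R) (d : M -> R).
Hypothesis L_C1 : C1_TM L.
Hypothesis Q_lin : forall x, scalar (@Q x).

Let q (u : V) := in_chart Q a y u.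
Let kappa := Q (K (phi_inv a y)).
Let k : V := coord a (K (phi_inv a y)).

Lemma in_chart_form_scalar : scalar q.
Proof. move=> c u v; exact: (scalar_of_coord (@Q_lin (phi_inv a y)) c u v). Qed.

Lemma in_chart_formK : q k = kappa.
Proof. by rewrite /q /in_chart /k of_coord_K. Qed.

Lemma derivable_in_chart (w u : V) : derivable (in_chart L a y) w u.
Proof.
have dL := differentiable_chart_lagrangian L_C1 w ay.
have : derivable (chart_lagrangian L a) (y, w) (0, u) by exact: diff_derivable.
exact: derivable_pair_snd.
Qed.

Lemma d_v_chart_L_c (w u : V) : d_v_chart (L_c L K Q) a y w u =
  d_v_chart L a y w u - 2 * q w * q u / kappa.
Proof.
have lq := in_chart_form_scalar.
have dq : is_derive w u q (q u) by exact: is_derive_scalar.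
have dL : is_derive w u (in_chart L a y) (d_v_chart L a y w u).
  by apply: DeriveDef => //; exact: derivable_in_chart.
have H : is_derive w u (fun w => in_chart L a y w - q w * q w * kappa^-1)
    (d_v_chart L a y w u - 2 * q w * q u / kappa).
  have H1 := is_deriveD dL (is_deriveN (is_deriveM (is_deriveM dq dq) (is_derive_cst kappa^-1 w u))).
  rewrite (_ : (fun _ => _) = in_chart L a y - q * q * cst kappa^-1); last by apply/funext.
  apply: is_derive_eq H1 _.
  rewrite scaler0 add0r /cst /= -!scalerDl; rewrite /GRing.scale/=; ring.
rewrite /d_v_chart.
have -> : in_chart (L_c L K Q) a y = (fun w => in_chart L a y w - q w * q w * kappa^-1).
  by apply/funext => v; rewrite /in_chart /L_c expr2.
by have [_ ->] := H.
Qed.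

Hypothesis noether : forall x (v : tangent x), d_v L v (K x) = Q v + d x.

Lemma d_v_chart_noether (w : V) : d_v_chart L a y w k = q w + d (phi_inv a y).
Proof.
rewrite d_v_of_coord -noether; congr (d_v _ _ _).
exact: of_coord_K.
Qed.

Lemma d_v_chart_L_c_momentum (w u : V) : d_v_chart (L_c L K Q) a y w u =
  d_v_chart L a y w u - 2 * (d_v_chart L a y w k - d (phi_inv a y)) * q u / kappa.
Proof. by rewrite d_v_chart_L_c d_v_chart_noether addrK. Qed.

End fibers.

Lemma near_bounded {R : realType} (T : topologicalType) (f : T -> R) (y0 : T) :
  {for y0, continuous f} -> \forall y \near y0, `|f y| <= `|f y0| + 1.
Proof.
move=> cf; have H : \forall y \near y0, `|f y0 - f y| < 1.
  have /cvgrPdist_lt := cf; apply; exact: ltr01.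
apply: filterS H => y H; rewrite -[f y](subrK (f y0)) addrC (le_trans (ler_normD _ _))//.
by rewrite lerD// distrC ltW.
Qed.

Section C1_functions.
Context {R : realType} {V : normedModType R}.
Implicit Types (A : set V) (f g : V -> R).

Lemma Ck1_continuous A f x : Ck_on 1 A f -> A x -> {for x, continuous f}.
Proof. by move=> [df _] Ax; apply: differentiable_continuous; exact: df. Qed.

Lemma derive_continuous_at A f v x : Ck_on 1 A f -> A x -> {for x, continuous (fun y => 'D_v f y)}.
Proof. by move=> [_ cf] Ax; exact: cf. Qed.

Lemma Ck1M A f g : open A -> Ck_on 1 A f -> Ck_on 1 A g -> Ck_on 1 A (f * g).
Proof.
move=> oA Cf Cg; have [[df _] [dg _]] := (Cf, Cg); split.
  by move=> x Ax; apply: differentiableM; [exact: df|exact: dg].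
move=> v x Ax.
have DE y : A y -> 'D_v (f * g) y = f y *: 'D_v g y + g y *: 'D_v f y.
  by move=> Ay; apply: deriveM; apply: diff_derivable; [exact: df|exact: dg].
have nA : \forall y \near x, A y by apply: open_nbhs_nbhs; split.
have H : {for x, continuous (fun y => f y *: 'D_v g y + g y *: 'D_v f y)}.
  apply: cvgD; apply: cvgM.
  - exact: Ck1_continuous Cf Ax.
  - exact: derive_continuous_at Cg Ax.
  - exact: Ck1_continuous Cg Ax.
  - exact: derive_continuous_at Cf Ax.
have E := DE x Ax; rewrite /prop_for /continuous_at E.
by apply: cvg_near_eq H; apply: filterS nA => y Ay; rewrite DE.
Qed.

Lemma Ck1D A f g : open A -> Ck_on 1 A f -> Ck_on 1 A g -> Ck_on 1 A (f + g).
Proof.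
move=> oA Cf Cg; have [[df _] [dg _]] := (Cf, Cg); split.
  by move=> x Ax; apply: differentiableD; [exact: df|exact: dg].
move=> v x Ax.
have DE y : A y -> 'D_v (f + g) y = 'D_v f y + 'D_v g y.
  by move=> Ay; apply: deriveD; apply: diff_derivable; [exact: df|exact: dg].
have nA : \forall y \near x, A y by apply: open_nbhs_nbhs; split.
have H : {for x, continuous (fun y => 'D_v f y + 'D_v g y)}.
  by apply: cvgD; [exact: derive_continuous_at Cf Ax|exact: derive_continuous_at Cg Ax].
have E := DE x Ax; rewrite /prop_for /continuous_at E.
by apply: cvg_near_eq H; apply: filterS nA => y Ay; rewrite DE.
Qed.

Lemma Ck1_sum n A (f : 'I_n -> V -> R) : open A -> (forall i, Ck_on 1 A (f i)) ->
  Ck_on 1 A (\sum_i f i).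
Proof.
move=> oA; elim: n f => [|n IH] f Cf; last first.
  by rewrite big_ord_recr; apply: Ck1D => //; apply: IH => i; exact: Cf.
rewrite big_ord0; split=> [x _|v x _]; first exact: differentiable_cst.
by rewrite (_ : (fun y => _) = (fun=> 0)); [exact: cvg_cst|apply/funext => y; exact: derive_cst].
Qed.

End C1_functions.

Section row_families.
Context {R : realType} {n : nat}.
Notation V := 'rV[R]_n.

Lemma scalar_expand (f : V -> R) (w : V) : scalar f -> f w = \sum_j w 0 j * f (delta_mx 0 j).
Proof.
move=> lf; rewrite [w in LHS]row_expand scalar_fun_sum//.
by apply: eq_bigr => j _; rewrite scalar_funZ.
Qed.

Lemma near_bounded_family (T : topologicalType) (f : 'I_n -> T -> R) (y0 : T) :
  (forall j, {for y0, continuous (f j)}) ->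
  exists B, 0 <= B /\ \forall y \near y0, forall w : V, `|\sum_j w 0 j * f j y| <= B * `|w|.
Proof.
move=> cf; exists (\sum_j (`|f j y0| + 1)); split.
  by apply: sumr_ge0 => j _; rewrite addr_ge0.
have H : \forall y \near y0, forall j, `|f j y| <= `|f j y0| + 1.
  by apply: filter_forall => j; exact: near_bounded.
apply: filterS H => y H w; rewrite mulr_suml (le_trans (ler_norm_sum _ _ _))//.
apply: ler_sum => j _; rewrite normrM mulrC ler_pM//.
exact: norm_coord_le.
Qed.

End row_families.

Lemma Ck1_coord {R : realType} {V : normedModType R} n (A : set V) (f : V -> 'rV[R]_n) i :
  open A -> Ck_on 1 A f -> Ck_on 1 A (fun y => f y 0 i : R).
Proof.
move=> oA [df cf]; split=> [x Ax|v x Ax].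
  by apply: (@differentiable_comp _ _ _ _ f (fun v : 'rV[R]_n => v 0 i : R)); [exact: df|exact: differentiable_coord].
have DE y : A y -> 'D_v (fun y => f y 0 i : R) y = ('D_v f y) 0 i.
  by move=> Ay; have [_ ->] := is_derive_coord i (diff_derivable (v := v) (df y Ay)).
have nA : \forall y \near x, A y by apply: open_nbhs_nbhs; split.
have H : {for x, continuous (fun y => ('D_v f y) 0 i : R)}.
  by apply: continuous_at_coord; exact: cf.
have E := DE x Ax; rewrite /prop_for /continuous_at E.
by apply: cvg_near_eq H; apply: filterS nA => y Ay; rewrite DE.
Qed.

Lemma cvg_sum_ord {R : realType} n (T : Type) (F : set_system T) {FF : Filter F}
    (f : 'I_n -> T -> R) (l : 'I_n -> R) :
  (forall i, f i x @[x --> F] --> l i) -> \sum_i f i x @[x --> F] --> \sum_i l i.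
Proof. by move=> fl; apply: cvg_big => //; exact: add_continuous. Qed.

(** * Quadratic forms *)

Section quadratic_forms.
Context {R : realType} {n : nat}.
Notation V := 'rV[R]_n.+1.

Definition quadratic (A : 'I_n.+1 -> 'I_n.+1 -> R) (w : V) : R :=
  \sum_i \sum_j w 0 i * w 0 j * A i j.

Lemma quadratic_continuous A : continuous (quadratic A).
Proof.
move=> w.
have c k : {for w, continuous (fun w : V => w 0 k : R)} by exact: coord_continuous.
have H i j : {for w, continuous (fun w : V => w 0 i * w 0 j * A i j : R)}.
  exact: (cvgM (cvgM (c i) (c j)) (cvg_cst (A i j))). 
have H1 i : {for w, continuous (fun w : V => \sum_j w 0 i * w 0 j * A i j : R)}.
  exact: (@cvg_sum_ord _ _ _ _ _ _ (fun j => w 0 i * w 0 j * A i j) (H i)).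
exact: (@cvg_sum_ord _ _ _ _ _ _ (fun i => \sum_j w 0 i * w 0 j * A i j) H1).
Qed.

Lemma quadraticZ A c w : quadratic A (c *: w) = c ^+ 2 * quadratic A w.
Proof.
rewrite /quadratic mulr_sumr; apply: eq_bigr => i _; rewrite mulr_sumr; apply: eq_bigr => j _.
by rewrite !mxE; ring.
Qed.

Lemma quadratic_dist A B (e : R) w : (forall i j, `|A i j - B i j| <= e) ->
  `|quadratic A w - quadratic B w| <= (n.+1 ^ 2)%:R * e * `|w| ^+ 2.
Proof.
move=> AB.
have -> : quadratic A w - quadratic B w = \sum_i \sum_j w 0 i * w 0 j * (A i j - B i j).
  rewrite /quadratic -sumrB; apply: eq_bigr => i _; rewrite -sumrB; apply: eq_bigr => j _.
  by rewrite mulrBr.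
rewrite (le_trans (ler_norm_sum _ _ _))//.
have -> : (n.+1 ^ 2)%:R * e * `|w| ^+ 2 = \sum_(i < n.+1) \sum_(j < n.+1) (`|w| ^+ 2 * e).
  by rewrite !sumr_const !card_ord -mulrnA -[RHS]mulr_natl -mulnn; ring.
apply: ler_sum => i _; rewrite (le_trans (ler_norm_sum _ _ _))//.
apply: ler_sum => j _; rewrite !normrM expr2.
by apply: ler_pM => //; apply: ler_pM => //; exact: norm_coord_le.
Qed.

(** The constants are the extrema on the unit sphere, which is compact; homogeneity does the
    rest. *)
Lemma quadratic_bounds A : (forall w, w != 0 -> 0 < quadratic A w) ->
  exists c C, 0 < c /\ forall w, c * `|w| ^+ 2 <= quadratic A w <= C * `|w| ^+ 2.
Proof.
move=> A0; pose S : set V := [set w | `|w| = 1].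
have cS : compact S.
  apply: bounded_closed_compact.
    by exists 1; split => // M M1 w /= ->; exact: ltW.
  have -> : S = (fun w : V => `|w|) @^-1` [set 1] by [].
  by apply: closed_comp => [w _|]; [exact: norm_continuous|exact: closed_eq].
have wS (w : V) : w != 0 -> S (`|w|^-1 *: w).
  by move=> w0; rewrite /S/= normrZ normfV normr_id mulVf// normr_eq0.
have S0 : S !=set0.
  exists (`|const_mx 1 : V|^-1 *: const_mx 1); apply: wS.
  by apply/eqP => /rowP/(_ ord0); rewrite !mxE; apply/eqP; rewrite oner_eq0.
have cA : {within S, continuous (quadratic A)}.
  by apply: continuous_subspaceT; exact: quadratic_continuous.
have [v1 v1S Hmin] := compact_EVT_min S0 cS cA.
have [v2 v2S Hmax] := compact_EVT_max S0 cS cA.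
exists (quadratic A v1), (quadratic A v2); split.
  apply: A0; move: v1S; rewrite inE /S/= => v11; apply/eqP => v0.
  by move: v11; rewrite v0 normr0 => /eqP; rewrite eq_sym oner_eq0.
move=> w; have [->|w0] := eqVneq w 0.
  have -> : quadratic A 0 = 0 by have := quadraticZ A 0 0; rewrite scale0r expr0n/= mul0r.
  by rewrite normr0 expr0n/= !mulr0 lexx.
have wE : quadratic A w = quadratic A (`|w|^-1 *: w) * `|w| ^+ 2.
  by rewrite quadraticZ exprVn mulrAC mulVf ?mul1r// expf_neq0// normr_eq0.
have Sw : `|w|^-1 *: w \in S by rewrite inE; exact: wS.
by rewrite wE; apply/andP; split; rewrite ler_wpM2r ?sqr_ge0//; [exact: Hmin|exact: Hmax].
Qed.

End quadratic_forms.

(** * Local bounds *)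

Lemma near_forall1 n (T : topologicalType) (y0 : T) (P : T -> 'I_n -> Prop) :
  (forall i, \forall y \near y0, P y i) -> \forall y \near y0, forall i, P y i.
Proof. by move=> H; apply: filter_forall => i; exact: H. Qed.

Lemma near_forall2 n (T : topologicalType) (y0 : T) (P : T -> 'I_n -> 'I_n -> Prop) :
  (forall i j, \forall y \near y0, P y i j) -> \forall y \near y0, forall i j, P y i j.
Proof. by move=> H; apply: filter_forall => i; apply: filter_forall => j; exact: H. Qed.

Lemma perturbed_bounds {R : realType} (c C n A B : R) : c * n <= B <= C * n -> 0 <= n ->
  `|A - B| <= c / 2 * n -> c / 2 * n <= A <= (`|C| + c / 2) * n.
Proof.
move=> /andP[h1 h2] n0; rewrite ler_norml => /andP[h3 h4].
have h5 : C * n <= `|C| * n by rewrite ler_wpM2r// ler_norm.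
by apply/andP; split; lra.
Qed.

Lemma quotient_derive_eq {R : realType} (l q D1 D2 F : R) : F != 0 ->
  l - ((q * q) *: (- F ^- 2 *: D1) + F^-1 *: (q *: D2 + q *: D2)) =
  l - (2 * q * D2 / F - q ^+ 2 / F ^+ 2 * D1).
Proof. by move=> F0; rewrite /GRing.scale/=; field. Qed.

(** Here p is the derivative of L in v along a basis vector e_i, q1 = Q(w), q2 = Q(e_i), k = Q(K),
    and w is the norm of the velocity. The first bound is the one on [L_c], tested on e_i / t. *)
Lemma d_v_bound_arith {R : realType} (t B1 B p q1 q2 k w : R) : 0 < t -> 0 <= B -> 0 <= B1 -> 0 <= w ->
  `|t^-1 * p - 2 * q1 * (t^-1 * q2) / k| <= B1 * (t * w + 1) ->
  `|k^-1| <= B -> `|q1| <= B * w -> `|q2| <= B ->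
  `|p| <= (t * B1 * (t + 1) + 2 * B * B * B) * (w + 1).
Proof.
move=> t0 B0 B10 w0 H hk hq1 hq2.
have -> : p = t * (t^-1 * p - 2 * q1 * (t^-1 * q2) / k) + 2 * (q1 * q2 * k^-1).
  by rewrite mulrBr mulVKf ?gt_eqF// -[in X in _ - X + _](mulrA (2 * q1)) [t * (_ * (_ / k))]mulrCA -(mulrA t^-1) mulVKf ?gt_eqF//; ring.
rewrite (le_trans (ler_normD _ _))// normrM (gtr0_norm t0) normrM [`|2|]ger0_norm// !normrM.
have h1 : t * `|t^-1 * p - 2 * q1 * (t^-1 * q2) / k| <= t * (B1 * (t * w + 1)) by rewrite ler_wpM2l// ltW.
have h2 : `|q1| * `|q2| * `|k^-1| <= B * w * B * B.
  by apply: ler_pM => //; apply: ler_pM.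
have h3 : 0 <= t * B1 * (t + w) by rewrite !mulr_ge0// ?addr_ge0// ltW.
have h4 : 0 <= B * B * B by rewrite !mulr_ge0.
lra.
Qed.

(** As in [d_v_bound_arith], with p the derivative of L in x, and D1, D2 the derivatives of y |->
    Q(K) and of y |-> Q(w) along e_i. *)
Lemma d_x_bound_arith {R : realType} (t B1 C0 B p q1 D1 D2 k w : R) : 0 < t -> 0 <= B -> 0 <= B1 -> 0 <= w -> 0 <= C0 ->
  `|t^-1 * p - (2 * q1 * (t^-1 *: D2) / k - q1 ^+ 2 / k ^+ 2 * (t^-1 *: D1))| <= B1 * (C0 * w ^+ 2 + 1) ->
  `|k^-1| <= B -> `|q1| <= B * w -> `|D1| <= B -> `|D2| <= B * w ->
  `|p| <= (t * B1 * (C0 + 1) + (2 * B * B * B + B ^+ 2 * B ^+ 2 * B)) * (w ^+ 2 + 1).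
Proof.
move=> t0 B0 B10 w0 C00 H hk hq1 hD1 hD2.
set r := _ - _ in H.
have -> : p = t * r + (2 * (q1 * D2 * k^-1) - q1 ^+ 2 * k^-1 ^+ 2 * D1).
  have E (X : R) : t * (t^-1 * X) = X by rewrite mulVKf// gt_eqF.
  rewrite /r mulrBr E -addrA -[LHS]addr0; congr (_ + _).
  have -> : 2 * q1 * (t^-1 *: D2) / k - q1 ^+ 2 / k ^+ 2 * (t^-1 *: D1) =
    t^-1 * (2 * (q1 * D2 * k^-1) - q1 ^+ 2 * k^-1 ^+ 2 * D1).
    by rewrite exprVn /GRing.scale/=; ring.
  by rewrite E addNr.
have h1 : t * `|r| <= t * (B1 * (C0 * w ^+ 2 + 1)) by rewrite ler_wpM2l// ltW.
have h2 : `|q1| * `|D2| * `|k^-1| <= B * w * (B * w) * B.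
  by apply: ler_pM => //; apply: ler_pM.
have h5 : `|q1| ^+ 2 * `|k^-1| ^+ 2 * `|D1| <= (B * w) ^+ 2 * B ^+ 2 * B.
  have h50 : 0 <= `|q1| ^+ 2 * `|k^-1| ^+ 2 by rewrite mulr_ge0 ?sqr_ge0.
  apply: ler_pM => //.
  by apply: ler_pM; rewrite ?sqr_ge0// ler_sqr ?nnegrE// mulr_ge0.
rewrite (le_trans (ler_normD _ _))// normrM (gtr0_norm t0).
have h6 : `|2 * (q1 * D2 * k^-1) - q1 ^+ 2 * k^-1 ^+ 2 * D1| <=
    2 * (`|q1| * `|D2| * `|k^-1|) + `|q1| ^+ 2 * `|k^-1| ^+ 2 * `|D1|.
  by rewrite !expr2 (le_trans (ler_normB _ _))// !normrM [`|2|]ger0_norm.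
have h3 : 0 <= t * B1 * (C0 + w ^+ 2) by rewrite !mulr_ge0// ?addr_ge0 ?sqr_ge0// ltW.
have h4 : 0 <= B * B * B by rewrite !mulr_ge0.
have h7 : 0 <= B ^+ 2 * B ^+ 2 * B by rewrite !mulr_ge0.
move: h1 h2 h5 h6 h3 h4 h7; move: `|r| (`|q1| * _ * _) (`|q1| ^+ 2 * _ * _) `|_ - _| => r' x1 x2 x3.
move=> h1 h2 h5 h6 h3 h4 h7; lra.
Qed.

Lemma row_subE {R : realType} n (A B : 'rV[R]_n) i : (A - B) 0 i = A 0 i - B 0 i.
Proof. by rewrite !mxE. Qed.

(** Here u is the norm of w2 - w1 and p that of the difference of momenta, whose values on w2 - w1
    and on K are S1 and S2; x1 and x2 are the values of the first momentum on these vectors, dl = d,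
    q = Q(w2 - w1), k = Q(K). The first momentum and d cancel, leaving lam u^2 <= S1 - 2 S2 q / k;
    dividing by u gives the claim. *)
Lemma legendre_arith {R : realType} (lam u p B k0 n x1 x2 S1 S2 dl q k : R) : 0 < lam -> 0 < u -> 0 <= B ->
  0 <= p -> 0 <= k0 ->
  lam * u ^+ 2 <= x1 + S1 - 2 * (x2 + S2 - dl) * q / k - (x1 - 2 * (x2 - dl) * q / k) ->
  `|S1| <= n * (u * p) -> `|S2| <= k0 * p -> `|k^-1| <= B -> `|q| <= B * u ->
  u <= (n + 2 * k0 * B * B) / lam * p.
Proof.
move=> lam0 u0 B0 p0 k00 + h1 h2 h3 h4.
have -> : x1 + S1 - 2 * (x2 + S2 - dl) * q / k - (x1 - 2 * (x2 - dl) * q / k) = S1 - 2 * (S2 * q * k^-1).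
  by ring.
move=> H; rewrite mulrAC ler_pdivlMr// -(ler_pM2r u0).
have -> : u * lam * u = lam * u ^+ 2 by ring.
apply: (le_trans H).
have h5 : `|S2 * q * k^-1| <= k0 * p * (B * u) * B.
  by rewrite !normrM; apply: ler_pM => //; apply: ler_pM.
have := ler_norm S1; have := ler_norm (- (S2 * q * k^-1)); rewrite normrN.
move: h5; move: `|S2 * q * k^-1| (S2 * q * k^-1) => t1 t2 h5 h6 h7.
lra.
Qed.

Section local_bounds.
Context {R : realType} {m : nat} {M : manifold R m.+1}.
Notation V := 'rV[R]_m.+1.
Notation coord := (@Defs.coord R m.+1 M).
Notation e_ := (delta_mx 0).
#[local] Opaque derive.

Context (g : forall x : M, tangent x -> tangent x -> R).
Hypothesis hg : riemannian_metric g.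

Definition metric_form (a : chart M) (y : V) (i j : 'I_m.+1) : R :=
  g (of_coord a y (e_ i)) (of_coord a y (e_ j)).

Definition metric_sq (a : chart M) (y w : V) : R := g (of_coord a y w) (of_coord a y w).

Lemma metric_sqE a y w : img a y -> metric_sq a y w = quadratic (metric_form a y) w.
Proof.
move=> ay; have [g_lin g_sym _ _] := hg.
have lf u : scalar (fun w : V => g (of_coord a y u) (of_coord a y w)).
  by move=> c u1 u2; exact: (scalar_of_coord ay (@g_lin _ (of_coord a y u)) c u1 u2).
rewrite /metric_sq (scalar_expand w (lf w)) /quadratic exchange_big/=.
apply: eq_bigr => j _; rewrite g_sym (scalar_expand w (lf (e_ j))) mulr_sumr.
by apply: eq_bigr => i _; rewrite mulrA [w 0 i * _]mulrC g_sym.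
Qed.

Lemma metric_sq_gt0 a y w : img a y -> w != 0 -> 0 < metric_sq a y w.
Proof. by move=> ay w0; have [_ _ + _] := hg; apply; exact: of_coord_neq0. Qed.

Lemma gnorm_of_coord a y w : img a y -> Defs.gnorm g (of_coord a y w) ^+ 2 = metric_sq a y w.
Proof.
move=> ay; rewrite /Defs.gnorm sqr_sqrtr//; have [->|w0] := eqVneq w 0; last first.
  exact: ltW (metric_sq_gt0 ay w0).
by rewrite -[leRHS]/(metric_sq a y 0) metric_sqE// /quadratic big1// => i _; rewrite big1// => j _; rewrite !mxE !mul0r.
Qed.

Lemma near_img (a : chart M) (y0 : V) : img a y0 -> \forall y \near y0, img a y.
Proof. by move=> ay0; apply: open_nbhs_nbhs; split => //; exact: img_open. Qed.

(** [quadratic_bounds] compares g with the norm at y0 only; continuity of the coefficients of g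
    extends this to a neighbourhood at the cost of c / 2. *)
Lemma metric_local_bounds a y0 : img a y0 -> exists c C, [/\ 0 < c, 0 < C &
  \forall y \near y0, forall w, c * `|w| ^+ 2 <= metric_sq a y w <= C * `|w| ^+ 2].
Proof.
move=> ay0; have [_ _ _ g_smooth] := hg.
have [c [C [c0 H]]] : exists c C, 0 < c /\ forall w : V, c * `|w| ^+ 2 <= quadratic (metric_form a y0) w <= C * `|w| ^+ 2.
  by apply: quadratic_bounds => w w0; rewrite -metric_sqE//; exact: metric_sq_gt0.
(* Moving each of the (m+1)^2 coefficients by at most e moves the form by at most c / 2 times the
   squared norm. *)
pose e : R := c / 2 / (m.+1 ^ 2)%:R.
have n0 : 0 < (m.+1 ^ 2)%:R :> R by rewrite ltr0n expn_gt0.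
have e0 : 0 < e by rewrite !divr_gt0.
have near_e : \forall y \near y0, forall i j, `|metric_form a y i j - metric_form a y0 i j| <= e.
  apply: near_forall2 => i j.
  have cg : {for y0, continuous (fun y => metric_form a y i j)}.
    exact: (g_smooth a (e_ i) (e_ j) 0%N).
  have H1 : \forall y \near y0, `|metric_form a y0 i j - metric_form a y i j| < e.
    have /cvgrPdist_lt := cg; apply; exact: e0.
  by apply: filterS H1 => y; rewrite distrC => /ltW.
exists (c / 2), (`|C| + c / 2); split.
- by rewrite divr_gt0.
- by rewrite ltr_wpDl// divr_gt0.
have near_a := near_img ay0.
apply: filterS2 near_e near_a => y He ay w.
have := quadratic_dist w He; rewrite -/e.
have -> : (m.+1 ^ 2)%:R * e = c / 2 by rewrite mulrC /e divfK// gt_eqF.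
by rewrite metric_sqE//; apply: perturbed_bounds (H w) (sqr_ge0 _).
Qed.

Context (L : forall x : M, tangent x -> R) (K : forall x : M, tangent x)
  (Q : forall x : M, tangent x -> R) (d : M -> R).
Hypothesis L_C1 : C1_TM L.
Hypothesis K_C1 : C1_vector_field K.
Hypothesis Q_C1 : C1_one_form Q.
Hypothesis noether : forall x (v : tangent x), d_v L v (K x) = Q v + d x.
Hypothesis QK_lt0 : forall x, Q (K x) < 0.

Lemma Q_lin x : scalar (@Q x).
Proof. by have [+ _] := Q_C1; apply. Qed.

Definition form_K (a : chart M) (y : V) : R := Q (K (phi_inv a y)).

Definition coord_K (a : chart M) (y : V) : V := coord a (K (phi_inv a y)).

Lemma form_KE a y : img a y ->
  form_K a y = \sum_j coord_K a y 0 j * in_chart Q a y (e_ j).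
Proof.
move=> ay; have lq := in_chart_form_scalar ay Q_lin.
by rewrite /form_K -in_chart_formK// -[LHS]/(in_chart Q a y (coord_K a y)) (scalar_expand _ lq).
Qed.

Lemma in_chart_formE a y w : img a y ->
  in_chart Q a y w = \sum_j w 0 j * in_chart Q a y (e_ j).
Proof. by move=> ay; exact: (scalar_expand w (in_chart_form_scalar ay Q_lin)). Qed.

(** [form_K] as a sum of products of coordinate functions, each of them C^1 by hypothesis, so that
    its own C^1 regularity follows from the algebra of C^1 functions. *)
Definition form_K_sum (a : chart M) : V -> R :=
  \sum_j (fun y => coord_K a y 0 j) * (fun y => in_chart Q a y (e_ j)).

Lemma form_K_sumE a y : img a y -> form_K_sum a y = form_K a y.
Proof. by move=> ay; rewrite form_KE// /form_K_sum fct_sumE. Qed.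

Lemma form_K_sum_C1 a : Ck_on 1 (img a) (form_K_sum a).
Proof.
have [_ CQ] := Q_C1.
apply: Ck1_sum => [|j]; first exact: img_open.
apply: Ck1M; [exact: img_open| |exact: CQ].
by apply: Ck1_coord; [exact: img_open|exact: K_C1].
Qed.

Lemma near_form_K_inv_bounded a y0 : img a y0 ->
  exists B, \forall y \near y0, `|(form_K a y)^-1| <= B.
Proof.
move=> ay0; exists (`|(form_K_sum a y0)^-1| + 1).
have cF : {for y0, continuous (fun y => (form_K_sum a y)^-1)}.
  have cS := Ck1_continuous (form_K_sum_C1 a) ay0.
  by apply: (cvgV _ cS); rewrite form_K_sumE// lt_eqF// QK_lt0.
have near_a := near_img ay0.
apply: filterS2 (near_bounded cF) near_a => y + ay.
by rewrite form_K_sumE.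
Qed.

Lemma derive_in_chart_form a y w u : img a y ->
  'D_u (fun y' => in_chart Q a y' w) y = \sum_j w 0 j * 'D_u (fun y' => in_chart Q a y' (e_ j)) y.
Proof.
move=> ay; have [_ CQ] := Q_C1.
have dq j : derivable (fun y' => in_chart Q a y' (e_ j)) y u.
  by apply: diff_derivable; exact: (CQ a (e_ j)).1.
have dh j : derivable (w 0 j \*: (fun y' => in_chart Q a y' (e_ j))) y u by exact: derivableZ.
transitivity ('D_u (\sum_j (w 0 j \*: (fun y' => in_chart Q a y' (e_ j)))) y).
  apply: near_eq_derive; have near_a := near_img ay.
  apply: filterS near_a => y' ay'.
  by rewrite in_chart_formE// fct_sumE.
rewrite derive_sum//; apply: eq_bigr => j _.
by rewrite deriveZ.
Qed.

Lemma d_x_chart_L_c a y w u : img a y -> d_x_chart (L_c L K Q) a y w u =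
  d_x_chart L a y w u -
  (2 * in_chart Q a y w * 'D_u (fun y' => in_chart Q a y' w) y / form_K a y -
   in_chart Q a y w ^+ 2 / form_K a y ^+ 2 * 'D_u (form_K_sum a) y).
Proof.
move=> ay; have [_ CQ] := Q_C1.
pose q y' := in_chart Q a y' w; pose F := form_K_sum a.
have dq : is_derive y u q ('D_u q y).
  by apply: DeriveDef => //; apply: diff_derivable; exact: (CQ a w).1.
have dF : is_derive y u F ('D_u F y).
  by apply: DeriveDef => //; apply: diff_derivable; exact: (form_K_sum_C1 a).1.
have F0 : F y != 0 by rewrite /F form_K_sumE// lt_eqF// QK_lt0.
have dV : is_derive y u (fun y' => (F y')^-1) (- (F y) ^- 2 *: 'D_u F y).
  by apply: DeriveDef; [apply: derivableV F0 _|apply: deriveV F0 _]; exact: ex_derive.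
have dL : is_derive y u (fun y' => in_chart L a y' w) (d_x_chart L a y w u).
  apply: DeriveDef => //; apply: (derivable_pair_fst (f := chart_lagrangian L a)).
  by apply: diff_derivable; exact: differentiable_chart_lagrangian.
have H1 := is_deriveD dL (is_deriveN (is_deriveM (is_deriveM dq dq) dV)).
have -> : d_x_chart (L_c L K Q) a y w u =
    'D_u ((fun y' => in_chart L a y' w) - q * q * (fun y' => (F y')^-1)) y.
  apply: near_eq_derive; have near_a := near_img ay.
  apply: filterS near_a => y' ay'.
  by rewrite /in_chart /L_c expr2 -[X in _ * _ / X]/(form_K a y') -form_K_sumE.
have [_ ->] := H1.
rewrite -[form_K a y]form_K_sumE//.
by apply: (quotient_derive_eq _ _ _ _ F0).
Qed.

Context (C lambda : M -> R) (Ca : M -> R) (a : chart M) (y0 : V).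
Hypothesis C_cont : continuous C.
Hypothesis lambda_cont : continuous lambda.
Hypothesis lambda_gt0 : forall x, 0 < lambda x.
Hypothesis Ca_bounded : forall x, dom a x -> exists B, \forall x' \near x, Ca x' <= B.
Hypothesis d_x_L_c_bound : forall x (v : tangent x), dom a x ->
  (dual_norm g (fun w : tangent x =>
     d_x_chart (L_c L K Q) a (phi a x) (coord a v) (coord a w))
   <= (Ca x * (Defs.gnorm g v ^+ 2 + 1))%:E)%E.
Hypothesis d_v_L_c_bound : forall x (v : tangent x),
  (dual_norm g (d_v (L_c L K Q) v) <= (C x * (Defs.gnorm g v + 1))%:E)%E.
Hypothesis d_v_L_c_monotone : forall x (v1 v2 : tangent x),
  lambda x * Defs.gnorm g (v2 - v1) ^+ 2 <=
  d_v (L_c L K Q) v2 (v2 - v1) - d_v (L_c L K Q) v1 (v2 - v1).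
Hypothesis ay0 : img a y0.

Lemma near_L_c_monotone : exists2 lam, 0 < lam & \forall y \near y0, forall w1 w2 : V,
  lam * `|w2 - w1| ^+ 2 <= d_v_chart (L_c L K Q) a y w2 (w2 - w1) -
    d_v_chart (L_c L K Q) a y w1 (w2 - w1).
Proof.
have [c [C0 [c0 C00 Hm]]] := metric_local_bounds ay0.
have l0 := lambda_gt0 (phi_inv a y0).
(* Near y0 the continuous function lambda stays above half its value, and c compares g with the norm
   of the chart. *)
exists (lambda (phi_inv a y0) / 2 * c); first by rewrite mulr_gt0// divr_gt0.
have near_a := near_img ay0.
have near_l : \forall y \near y0, lambda (phi_inv a y0) / 2 < lambda (phi_inv a y).
  have cl : {for y0, continuous (lambda \o phi_inv a)}.
    apply: continuous_comp; [exact: phi_inv_continuous|exact: lambda_cont].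
  have /cvgr_gt := cl; apply; rewrite ltr_pdivrMr//.
  by rewrite mulr_natr mulr2n ltrDl.
have H : \forall y \near y0, [/\ img a y, lambda (phi_inv a y0) / 2 < lambda (phi_inv a y) &
    forall w, c * `|w| ^+ 2 <= metric_sq a y w <= C0 * `|w| ^+ 2].
  by apply: filterS3 near_a near_l Hm => y *; split.
apply: filterS H => y [ay ly my] w1 w2.
rewrite !d_v_of_coord// -[leLHS]mulrA.
apply: (@le_trans _ _ (lambda (phi_inv a y) * metric_sq a y (w2 - w1))).
  have /andP[h1 _] := my (w2 - w1).
  apply: ler_pM (ltW ly) h1; first exact: ltW (divr_gt0 l0 (ltr0Sn _ 1)).
  by rewrite mulr_ge0 ?sqr_ge0// ltW.
have := d_v_L_c_monotone (of_coord a y w1) (of_coord a y w2).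
have -> : of_coord a y w2 - of_coord a y w1 = of_coord a y (w2 - w1) by exact: (esym (of_coordB ay _ _)).
by rewrite gnorm_of_coord.
Qed.

Lemma dual_norm_bound x (l : tangent x -> R) (B : R) (v : tangent x) :
  (dual_norm g l <= B%:E)%E -> Defs.gnorm g v <= 1 -> `|l v| <= B.
Proof.
move=> lB v1; rewrite -lee_fin; apply: le_trans lB.
by apply: ereal_sup_ubound; exists v.
Qed.

Lemma gnorm_of_coord_le y w t : img a y -> 0 <= t -> metric_sq a y w <= t ^+ 2 ->
  Defs.gnorm g (of_coord a y w) <= t.
Proof.
move=> ay t0 H; rewrite -(@ler_pXn2r _ 2)// ?nnegrE ?sqrtr_ge0//.
by rewrite gnorm_of_coord.
Qed.

Lemma norm_delta_row i : `|e_ i : V| <= 1.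
Proof.
by apply: norm_le_coord => // j; rewrite mxE eqxx/=; case: eqP; rewrite ?normr1 ?normr0.
Qed.

(** [dual_norm] tests on the unit ball of g only, so basis vectors are shrunk by the square root t
    of the upper constant of the metric. *)
Lemma gnorm_basis_le y t i : img a y -> 0 < t ->
  (forall w : V, metric_sq a y w <= t ^+ 2 * `|w| ^+ 2) ->
  Defs.gnorm g (of_coord a y (t^-1 *: e_ i)) <= 1.
Proof.
move=> ay t0 H; apply: gnorm_of_coord_le => //; apply: le_trans (H _) _.
rewrite normrZ exprMn mulrA -exprMn normfV (gtr0_norm t0) divff ?gt_eqF// expr1n mul1r.
by rewrite !expr_le1// norm_delta_row.
Qed.

Lemma near_form_bounds : exists B, 0 <= B /\ \forall y \near y0, [/\ `|(form_K a y)^-1| <= B,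
  (forall w, `|in_chart Q a y w| <= B * `|w|) &
  forall i, `|'D_(e_ i) (form_K_sum a) y| <= B /\
    forall w : V, `|'D_(e_ i) (fun y' => in_chart Q a y' w) y| <= B * `|w|].
Proof.
have [_ CQ] := Q_C1.
have [B1 H1] := near_form_K_inv_bounded ay0.
have [B2 [B20 H2]] : exists B, 0 <= B /\ \forall y \near y0, forall w : V,
    `|\sum_j w 0 j * in_chart Q a y (e_ j)| <= B * `|w|.
  apply: (near_bounded_family (f := fun j y => in_chart Q a y (e_ j))) => j.
  exact: (Ck1_continuous (CQ a (e_ j)) ay0).
have /choice[B3 H3] : forall i, exists B, 0 <= B /\ \forall y \near y0, forall w : V,
    `|\sum_j w 0 j * 'D_(e_ i) (fun y' => in_chart Q a y' (e_ j)) y| <= B * `|w|.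
  move=> i; apply: (near_bounded_family (f := fun j y => 'D_(e_ i) (fun y' => in_chart Q a y' (e_ j)) y)) => j.
  exact: (derive_continuous_at (CQ a (e_ j)) ay0).
have H4 i : \forall y \near y0, `|'D_(e_ i) (form_K_sum a) y| <= `|'D_(e_ i) (form_K_sum a) y0| + 1.
  by apply: near_bounded; exact: (derive_continuous_at (form_K_sum_C1 a) ay0).
pose B := `|B1| + B2 + \sum_i (B3 i + (`|'D_(e_ i) (form_K_sum a) y0| + 1)).
have S0 i : 0 <= B3 i + (`|'D_(e_ i) (form_K_sum a) y0| + 1).
  by rewrite addr_ge0// ?(H3 i).1// addr_ge0.
have Si i : B3 i + (`|'D_(e_ i) (form_K_sum a) y0| + 1) <= B.
  rewrite /B (bigD1 i)//= [leRHS]addrCA lerDl addr_ge0//; first by rewrite addr_ge0.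
  by apply: sumr_ge0 => j _; exact: S0.
have SS0 : 0 <= \sum_i (B3 i + (`|'D_(e_ i) (form_K_sum a) y0| + 1)).
  by apply: sumr_ge0 => j _; exact: S0.
exists B; split; first by rewrite !addr_ge0.
have near_a := near_img ay0.
have H5 : \forall y \near y0, forall i, (forall w : V,
    `|\sum_j w 0 j * 'D_(e_ i) (fun y' => in_chart Q a y' (e_ j)) y| <= B3 i * `|w|) /\
    `|'D_(e_ i) (form_K_sum a) y| <= `|'D_(e_ i) (form_K_sum a) y0| + 1.
  by apply: near_forall1 => i; apply: filterI; [exact: (H3 i).2|exact: H4].
have H6 : \forall y \near y0, [/\ img a y, `|(form_K a y)^-1| <= B1 & forall w : V,
    `|\sum_j w 0 j * in_chart Q a y (e_ j)| <= B2 * `|w|].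
  by apply: filterS3 near_a H1 H2 => y *; split.
apply: filterS2 H5 H6 => y h5 [ay h1 h2]; split.
- by rewrite (le_trans h1)// (le_trans (ler_norm _))// /B -addrA lerDl addr_ge0.
- move=> w; rewrite in_chart_formE// (le_trans (h2 w))// ler_wpM2r//.
  by rewrite /B addrAC lerDr addr_ge0.
move=> i; have [h3 h4] := h5 i; split.
  by rewrite (le_trans h4)// (le_trans _ (Si i))// lerDr (H3 i).1.
move=> w; rewrite derive_in_chart_form// (le_trans (h3 w))// ler_wpM2r//.
by rewrite (le_trans _ (Si i))// lerDl addr_ge0.
Qed.

(** L differs from [L_c] by Q^2 / Q(K), whose derivative in v along a basis vector grows linearly in
    w, with locally bounded coefficients. *)
Lemma near_d_v_bound : exists B, 0 <= B /\ \forall y \near y0, forall w i,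
  `|d_v_chart L a y w (e_ i)| <= B * (`|w| + 1).
Proof.
have [c [C0 [c0 C00 Hm]]] := metric_local_bounds ay0.
have [B [B0 HB]] := near_form_bounds.
pose t := Num.sqrt C0; have t0 : 0 < t by rewrite sqrtr_gt0.
have tC : t ^+ 2 = C0 by rewrite sqr_sqrtr// ltW.
have near_a := near_img ay0.
have near_C : \forall y \near y0, `|C (phi_inv a y)| <= `|C (phi_inv a y0)| + 1.
  apply: (near_bounded (f := C \o phi_inv a)).
  by apply: continuous_comp; [exact: phi_inv_continuous|exact: C_cont].
set B1 := `|_| + 1 in near_C; have B10 : 0 <= B1 by rewrite addr_ge0.
exists (t * B1 * (t + 1) + 2 * B * B * B); split.
  by rewrite addr_ge0// !mulr_ge0// ?addr_ge0// ltW.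
have H : \forall y \near y0, [/\ img a y, `|C (phi_inv a y)| <= B1 &
    forall w, c * `|w| ^+ 2 <= metric_sq a y w <= C0 * `|w| ^+ 2].
  by apply: filterS3 near_a near_C Hm => y *; split.
apply: filterS2 H HB => y [ay hC my] [h1 h2 _] w i.
have my' (v : V) : metric_sq a y v <= t ^+ 2 * `|v| ^+ 2 by rewrite tC; have /andP[] := my v.
have := dual_norm_bound (d_v_L_c_bound (of_coord a y w)) (gnorm_basis_le i ay t0 my').
rewrite -d_v_of_coord// d_v_chart_L_c//; last exact: Q_lin.
rewrite d_v_chartZ// -[Q (K _)]/(form_K a y).
have lq := in_chart_form_scalar ay Q_lin; rewrite (scalar_funZ lq).
have gw : Defs.gnorm g (of_coord a y w) <= t * `|w|.
  by apply: gnorm_of_coord_le => //; [rewrite mulr_ge0// ltW|rewrite exprMn].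
have ei := h2 (e_ i); have ei1 : `|in_chart Q a y (e_ i)| <= B.
  by rewrite (le_trans ei)// ler_piMr// norm_delta_row.
move=> H0; have H1 : C (phi_inv a y) * (Defs.gnorm g (of_coord a y w) + 1) <= B1 * (t * `|w| + 1).
  apply: (@le_trans _ _ (B1 * (Defs.gnorm g (of_coord a y w) + 1))).
    by rewrite ler_wpM2r// ?addr_ge0 ?sqrtr_ge0// (le_trans (ler_norm _)).
  by rewrite ler_wpM2l// lerD2r.
by apply: d_v_bound_arith (le_trans H0 H1) h1 (h2 w) ei1.
Qed.

(** The derivative of Q^2 / Q(K) in x is quadratic in w, the growth allowed by the condition on
    [L_c]. *)
Lemma near_d_x_bound : exists B, 0 <= B /\ \forall y \near y0, forall w i,
  `|d_x_chart L a y w (e_ i)| <= B * (`|w| ^+ 2 + 1).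
Proof.
have [c [C0 [c0 C00 Hm]]] := metric_local_bounds ay0.
have [B [B0 HB]] := near_form_bounds.
pose t := Num.sqrt C0; have t0 : 0 < t by rewrite sqrtr_gt0.
have tC : t ^+ 2 = C0 by rewrite sqr_sqrtr// ltW.
have near_a := near_img ay0; have [ax _] := img_dom ay0.
have [B1 HB1] := Ca_bounded ax.
have near_C : \forall y \near y0, Ca (phi_inv a y) <= B1.
  have cp : {for y0, continuous (phi_inv a)} by exact: phi_inv_continuous.
  exact: cp HB1.
exists (t * `|B1| * (C0 + 1) + (2 * B * B * B + B ^+ 2 * B ^+ 2 * B)); split.
  by rewrite !addr_ge0// !mulr_ge0// ?sqr_ge0// ?addr_ge0// ltW.
have H : \forall y \near y0, [/\ img a y, Ca (phi_inv a y) <= B1 &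
    forall w, c * `|w| ^+ 2 <= metric_sq a y w <= C0 * `|w| ^+ 2].
  by apply: filterS3 near_a near_C Hm => y *; split.
apply: filterS2 H HB => y [ay hC my] [h1 h2 h3] w i.
have my' (v : V) : metric_sq a y v <= t ^+ 2 * `|v| ^+ 2 by rewrite tC; have /andP[] := my v.
have [ay' ey] := img_dom ay.
have := dual_norm_bound (d_x_L_c_bound (of_coord a y w) ay') (gnorm_basis_le i ay t0 my').
rewrite !coord_of_coordK// ey d_x_chart_L_c//.
have [_ CQ] := Q_C1.
rewrite d_x_chartZ// !deriveZdir; [|exact: (form_K_sum_C1 a).1|exact: (CQ a w).1].
rewrite gnorm_of_coord// => H0; have /andP[_ mw] := my w.
have [h4 h5] := h3 i.
have H1 : Ca (phi_inv a y) * (metric_sq a y w + 1) <= `|B1| * (C0 * `|w| ^+ 2 + 1).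
  have m0 : 0 <= metric_sq a y w by rewrite -gnorm_of_coord// sqr_ge0.
  apply: (@le_trans _ _ (`|B1| * (metric_sq a y w + 1))).
    by rewrite ler_wpM2r// ?addr_ge0// (le_trans hC)// ler_norm.
  by rewrite ler_wpM2l// lerD2r.
by apply: d_x_bound_arith (ltW C00) (le_trans H0 H1) h1 (h2 w) h4 (h5 w).
Qed.

Definition legendre (b : chart M) (y w : V) : V := \row_i d_v_chart L b y w (e_ i).

Lemma d_v_chart_legendre b y w u : img b y ->
  d_v_chart L b y w u = \sum_i u 0 i * legendre b y w 0 i.
Proof.
move=> bY; rewrite d_v_chartE//.
have lf : scalar (fun u : V => 'd (chart_lagrangian L b) (y, w) (0 : V, u)).
  move=> c u1 u2; rewrite -[c * _]linearZ -linearD; congr ('d _ _ (_, _)).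
  by rewrite /= scaler0 addr0.
rewrite (scalar_expand u lf); apply: eq_bigr => i _.
by rewrite mxE d_v_chartE.
Qed.

(* By the Noether identity, the fibre derivative of L_c is obtained from that
   of L by an affine map depending on y only, so that the strong monotonicity
   of the former makes the Legendre transform of L expansive. *)
Lemma near_legendre_expansive : exists A, 0 <= A /\ \forall y \near y0, forall w1 w2 : V,
  `|w2 - w1| <= A * `|legendre a y w2 - legendre a y w1|.
Proof.
have [lam lam0 Hlam] := near_L_c_monotone.
have [B [B0 HB]] := near_form_bounds.
have near_a := near_img ay0.
have near_k : \forall y \near y0, forall i, `|coord_K a y 0 i| <= `|coord_K a y0 0 i| + 1.
  apply: near_forall1 => i; apply: (near_bounded (f := fun y => coord_K a y 0 i)).
  by apply: (Ck1_continuous _ ay0); apply: Ck1_coord; [exact: img_open|exact: K_C1].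
pose k0 := \sum_i (`|coord_K a y0 0 i| + 1).
have k00 : 0 <= k0 by apply: sumr_ge0 => i _; rewrite addr_ge0.
(* The first summand bounds the difference of momenta on w2 - w1, the second the term that the
   Noether identity brings in, through its value on K. *)
exists ((m.+1%:R + 2 * k0 * B * B) / lam); split.
  by rewrite divr_ge0 ?addr_ge0 ?mulr_ge0// ltW.
have H : \forall y \near y0, img a y /\ forall i, `|coord_K a y 0 i| <= `|coord_K a y0 0 i| + 1.
  by apply: filterI.
apply: filterS3 H Hlam HB => y [ay hk] hm [hB1 hB2 _] w1 w2.
set u := w2 - w1; set p := legendre a y w2 - legendre a y w1.
have := hm w1 w2; rewrite -/u !(d_v_chart_L_c_momentum ay L_C1 Q_lin noether).
rewrite -[coord a (K _)]/(coord_K a y) -[Q (K _)]/(form_K a y) -[in_chart _ _ _ _]/(in_chart Q a y u).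
have E v : d_v_chart L a y w2 v = d_v_chart L a y w1 v + \sum_i v 0 i * p 0 i.
  rewrite !d_v_chart_legendre// -big_split/=; apply: eq_bigr => i _.
  have -> : p 0 i = legendre a y w2 0 i - legendre a y w1 0 i by exact: row_subE.
  by rewrite mulrBr addrC subrK.
rewrite !E => hm'.
have hu : `|\sum_i u 0 i * p 0 i| <= m.+1%:R * (`|u| * `|p|).
  rewrite (le_trans (ler_norm_sum _ _ _))// mulr_natl -[X in _ *+ X](card_ord m.+1) -sumr_const.
  by apply: ler_sum => i _; rewrite normrM; apply: ler_pM => //; exact: norm_coord_le.
have hk' : `|\sum_i coord_K a y 0 i * p 0 i| <= k0 * `|p|.
  rewrite (le_trans (ler_norm_sum _ _ _))// /k0 mulr_suml.
  by apply: ler_sum => i _; rewrite normrM; apply: ler_pM => //; exact: norm_coord_le.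
have [->|u0] := eqVneq u 0.
  by rewrite normr0 !mulr_ge0 ?invr_ge0 ?addr_ge0// ?mulr_ge0// ltW.
have u0' : 0 < `|u| by rewrite normr_gt0.
exact: legendre_arith lam0 u0' B0 (normr_ge0 p) k00 hm' hu hk' hB1 (hB2 u).
Qed.

End local_bounds.

(** * Regularity *)

Section implicit_speed.
Context {R : realType} {n : nat}.
Notation mu := (@lebesgue_measure R).
Notation V := 'rV[R]_n.+1.
Context (s1 s2 A : R) (P : V -> V -> V) (Y p w : R -> V).
Hypothesis s12 : s1 < s2.
Hypothesis cY : continuous Y.
Hypothesis cp : continuous p.
Hypothesis cP : forall r v, {for (Y r, v), continuous (fun yw : V * V => P yw.1 yw.2)}.
Hypothesis A0 : 0 <= A.
Hypothesis PA : forall r w1 w2, `|w2 - w1| <= A * `|P (Y r) w2 - P (Y r) w1|.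
Hypothesis wp : {ae mu, forall r, s1 < r < s2 -> P (Y r) (w r) = p r}.

Lemma continuous_P v : continuous (fun r => P (Y r) v).
Proof.
move=> r; apply: (@continuous_comp _ _ _ (fun r => (Y r, v)) (fun yw : V * V => P yw.1 yw.2)).
  by apply: continuous_at_pair; [exact: cY|exact: cvg_cst].
exact: cP.
Qed.

(** Times where w solves the equation have full measure in []s1, s2[], so they accumulate at r0.
    Expansiveness keeps w bounded along them; a cluster point W exists by compactness and solves the
    equation at r0 by continuity. *)
Lemma implicit_speed_exists r0 : s1 <= r0 <= s2 -> exists W, P (Y r0) W = p r0.
Proof.
move=> r0s.
pose S : set R := [set r | s1 < r < s2 /\ P (Y r) (w r) = p r].
pose F : set_system R := within S (nbhs r0).
have dense (e : R) : 0 < e -> exists r, `|r0 - r| < e /\ S r.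
  move=> e0; have /andP[h1 h2] := r0s.
  have l12 : Num.max s1 (r0 - e) < Num.min s2 (r0 + e).
    rewrite gt_max !lt_min; apply/andP; split; apply/andP; split => //; lra.
  have [r [/andP[h3 h4] Pr]] := ae_itv_exists l12 wp.
  move: h3 h4; rewrite gt_max lt_min => /andP[h3 h4] /andP[h5 h6].
  have rs : s1 < r < s2 by rewrite h3.
  exists r; split; last by split => //; exact: Pr.
  by rewrite ltr_norml; apply/andP; split; lra.
have FF : ProperFilter F.
  apply: Build_ProperFilter_ex => U [e /= e0 HU].
  by have [r [r1 r2]] := dense e e0; exists r; exact: HU.
have [C [C0 HC]] : exists C, 0 <= C /\ \forall r \near F, `|w r| <= C.
  (* At good times, expansiveness between the vectors 0 and w r bounds w r by A times this
     continuous function. *)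
  pose f r := p r - P (Y r) 0.
  have cf : {for r0, continuous f} by apply: cvgB; [exact: cp|exact: continuous_P].
  have H1 : \forall r \near r0, `|f r0 - f r| < 1.
    by have /cvgrPdist_lt := cf; apply; exact: ltr01.
  exists (A * (`|f r0| + 1)); split; first by rewrite mulr_ge0// addr_ge0.
  apply: filterS H1 => r H [_ Sr]; rewrite -[w r]subr0 (le_trans (PA r _ _))//.
  rewrite ler_wpM2l// Sr -/(f r) -[f r](subrK (f r0)) addrC (le_trans (ler_normD _ _))//.
  by rewrite lerD// distrC ltW.
have cB : compact [set v : V | `|v| <= C].
  apply: bounded_closed_compact.
    by exists C; split; [exact: num_real|move=> M CM v /= vC; exact: le_trans vC (ltW CM)].
  have -> : [set v : V | `|v| <= C] = (fun v : V => `|v|) @^-1` [set x | x <= C] by [].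
  by apply: closed_comp => [v _|]; [exact: norm_continuous|exact: closed_le].
have wF : (w @ F) [set v : V | `|v| <= C] by exact: HC.
have [W [_ Wc]] := cB _ (fmap_proper_filter w FF) wF.
exists W; apply/eqP; rewrite -subr_eq0 -normr_eq0; apply/eqP; apply: contrapT => /eqP ne0.
pose f (rv : R * V) := `|P (Y rv.1) rv.2 - p rv.1|.
have cf : {for (r0, W), continuous f}.
  apply: cvg_norm; apply: cvgB.
    apply: (@continuous_comp _ _ _ (fun rv : R * V => (Y rv.1, rv.2)) (fun yw : V * V => P yw.1 yw.2)).
      apply: continuous_at_pair; last exact: cvg_snd.
      by apply: (@continuous_comp _ _ _ (fun rv : R * V => rv.1) Y); [exact: cvg_fst|exact: cY].
    exact: cP.
  by apply: (@continuous_comp _ _ _ (fun rv : R * V => rv.1) p); [exact: cvg_fst|exact: cp].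
have f0 : 0 < f (r0, W) by rewrite lt_neqAle eq_sym ne0 normr_ge0.
have : \forall rv \near (r0, W), 0 < f rv by have /cvgr_gt := cf; apply.
move=> [[U O] /= [Ur0 OW] HUO].
have wFU : (w @ F) (w @` (U `&` S)).
  rewrite /fmap/=; rewrite /F /within/=.
  have Ur : \forall r \near r0, U r by exact: Ur0.
  by apply: filterS Ur => r Ur Sr; exists r.
have [v [[r [Ur [_ Sr]] <-] Owr]] := Wc _ _ wFU OW.
have := HUO (r, w r) (conj Ur Owr).
by rewrite /f/= Sr subrr normr0 ltxx.
Qed.

Lemma implicit_speed :
  (forall r, Y r = Y (clamp s1 s2 r)) -> (forall r, p r = p (clamp s1 s2 r)) ->
  exists W : R -> V, [/\ continuous W, forall r, P (Y r) (W r) = p r &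
    {ae mu, forall r, s1 < r < s2 -> w r = W r}].
Proof.
move=> Yc pc.
have /choice[W HW] : forall r, exists v, P (Y r) v = p r.
  by move=> r; rewrite Yc pc; apply/implicit_speed_exists/clamp_itv/ltW.
exists W; split=> //.
  move=> r0; apply/cvgrPdist_lt => e e0.
  (* Expansiveness at the time r, for W r0 and W r, bounds their distance by A times the norm of f
     r, and f is continuous with f r0 = 0. *)
  pose f r := p r - P (Y r) (W r0).
  have cf : {for r0, continuous f} by apply: cvgB; [exact: cp|exact: continuous_P].
  have fr0 : f r0 = 0 by rewrite /f HW subrr.
  have H1 : \forall r \near r0, `|f r0 - f r| < e / (A + 1).
    by have /cvgrPdist_lt := cf; apply; rewrite divr_gt0// ltr_wpDl.
  apply: filterS H1 => r; rewrite fr0 sub0r normrN => H.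
  rewrite distrC (le_lt_trans (PA r _ _))// HW -/(f r).
  have A1 : 0 < A + 1 by rewrite ltr_wpDl.
  apply: (@le_lt_trans _ _ ((A + 1) * `|f r|)); first by rewrite ler_wpM2r// lerDl.
  by rewrite mulrC -ltr_pdivlMr.
apply: ae_imp wp => r H /H Pr; apply/eqP; rewrite -subr_eq0 -normr_le0.
by rewrite (le_trans (PA r _ _))// Pr HW subrr normr0 mulr0.
Qed.

End implicit_speed.

(** * Primitives and monotonicity from one side *)

Section primitives.
Context {R : realType}.
Notation mu := (@lebesgue_measure R).

(** f is extended to a primitive F based at s1 - 1, so that even at s1 and s2 the slopes of F
    converge from both sides. *)
Lemma primitive_slope (s1 s2 : R) (f h : R -> R) : continuous h ->
  (forall x, s1 <= x <= s2 -> f x = f s1 + (\int[mu]_(t in `[s1, x]) h t)%R) ->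
  exists F : R -> R, (forall x, s1 <= x <= s2 -> F x = f x) /\
    forall r, s1 <= r -> slope (V := R) F r t @[t --> r^'] --> h r.
Proof.
move=> ch fh; pose H x := (\int[mu]_(t in `[s1 - 1, x]) h t)%R.
have ih u : mu.-integrable `[s1 - 1, u] (EFin \o h).
  apply: continuous_compact_integrable; first exact: segment_compact.
  by apply: continuous_subspaceT; exact: ch.
exists (fun x => f s1 + H x - H s1); split.
  move=> x /[dup] xs /andP[s1x xs2]; rewrite (fh x)// -addrA; congr (_ + _).
  have lt1 : s1 - 1 <= s1 by rewrite lerBlDr lerDl.
  rewrite /H Rintegral_itvB ?bnd_simp//.
  rewrite Rintegral_itv_obnd_cbnd//; apply: (integrableS _ _ _ (ih x)) => //.
  by move=> t; rewrite /= !in_itv/= => /andP[h1 ->]; rewrite andbT (le_trans lt1)// ltW.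
move=> r s1r.
have lt1 : s1 - 1 < r by lra.
have lt2 : r < r + 1 by rewrite ltrDl.
have [dH H'] := continuous_FTC1_closed lt2 (ih _) lt1 (ch r).
rewrite derive1E in H'.
have sH : slope (V := R) H r t @[t --> r^'] --> h r.
  by apply: is_derive_slope; apply: DeriveDef; [exact: dH|exact: H'].
apply: cvg_near_eq sH; near=> t; rewrite /slope; congr (_ *: _); ring.
Unshelve. all: by end_near. Qed.

(** Let c be the supremum of the x with f a <= f x. By continuity f a <= f c, and if c < b the
    hypothesis at c yields a larger such point. *)
Lemma right_nondecreasing (f : R -> R) (a b : R) : a <= b ->
  {within `[a, b], continuous f} ->
  (forall x, a <= x < b -> \forall y \near x, x <= y -> y <= b -> f x <= f y) ->
  f a <= f b.
Proof.
move=> ab cf Hf.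
pose S : set R := [set x | a <= x <= b /\ f a <= f x].
have Sa : S a by split; [rewrite lexx|].
have supS : has_sup S by split; [exists a|exists b => x [/andP[_ xb] _]].
pose c := sup S.
have ac : a <= c by apply: sup_upper_bound.
have cb : c <= b by apply: ge_sup; [exists a|move=> x [/andP[_ xb] _]].
have fc : f a <= f c.
  rewrite leNgt; apply/negP => fca.
  have := (subspace_continuousP _ _).1 cf c.
  rewrite /= in_itv/= ac cb => /(_ isT) /cvgr_lt /(_ _ fca) [e /= e0 He].
  have [x Sx cx] := sup_adherent e0 supS.
  have [/andP[ax xb] fx] := Sx.
  have xc : x <= c by apply: sup_upper_bound.
  have : f x < f a.
    apply: He => /=; last by rewrite in_itv/= ax.
    by rewrite ger0_norm ?subr_ge0// ltrBlDr addrC -ltrBlDr.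
  by rewrite ltNge fx.
have [cb'|] := ltP c b; last by move=> bc; rewrite (_ : b = c)//; apply/eqP; rewrite eq_le bc cb.
have [e /= e0 He] := Hf c (introT andP (conj ac cb')).
pose y := Num.min b (c + e / 2).
have cy : c < y by rewrite lt_min cb' ltrDl divr_gt0.
have yb : y <= b by rewrite ge_min lexx.
have fy : f c <= f y.
  apply: He => //=; last exact: ltW.
  rewrite ltr0_norm ?subr_lt0// opprB ltrBlDl (le_lt_trans (_ : y <= c + e / 2))// ?ge_min ?lexx ?orbT//.
  by rewrite ltrD2l ltr_pdivrMr// mulr_natr mulr2n ltrDl.
have Sy : S y by split; [rewrite yb (le_trans ac) ?ltW//|exact: le_trans fc fy].
by have := sup_upper_bound supS Sy; rewrite leNgt cy.
Qed.

(** Lower tangents bound f from below on both sides of each point, so after adding e x both f and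
    its reflection increase to the right. The isometry u stands for the identity or for x |-> s - x,
    which treats the two directions together. *)
Lemma lower_tangents_le (f u : R -> R) (s e : R) : {within `[0, 1], continuous f} ->
  (forall s : R, 0 <= s <= 1 -> forall e : R, 0 < e ->
    \forall t \near within `[0, 1] (nbhs s), f s - e * `|t - s| <= f t) ->
  0 <= s -> 0 < e -> continuous u -> (forall x, 0 <= x <= s -> 0 <= u x <= 1) ->
  (forall x y, `|u x - u y| = `|x - y|) -> f (u 0) <= f (u s) + e * s.
Proof.
move=> cf Hf s0 e0 cu u01 ulip.
have cg : {within `[0, s], continuous (fun x => f (clamp 0 1 (u x)) + e * x)}.
  apply: continuous_subspaceT => x; apply: cvgD; last by apply: cvgMr; exact: cvg_id.
  apply: (@continuous_comp _ _ _ u (f \o clamp 0 1)); first exact: cu.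
  by apply: continuous_comp_clamp cf _; exact: ler01.
have := right_nondecreasing s0 cg.
have c0 : clamp 0 1 (u 0) = u 0 by rewrite clamp_id// u01// lexx.
have cs : clamp 0 1 (u s) = u s by rewrite clamp_id// u01// lexx s0.
rewrite c0 cs mulr0 addr0; apply=> x /andP[x0 xs].
have ux := u01 x (introT andP (conj x0 (ltW xs))).
have [del /= del0 Hdel] := Hf (u x) ux e e0.
exists del => //= y xy xley ys.
have uy : 0 <= u y <= 1 by rewrite u01// (le_trans x0 xley).
rewrite !clamp_id//.
have := Hdel (u y); rewrite /= in_itv/= => /(_ _ uy).
rewrite ulip => /(_ xy).
by rewrite ulip [X in e * X]ger0_norm ?subr_ge0// mulrBr lerBlDr => H; rewrite -lerBrDr; lra.
Qed.

Lemma constant_of_lower_tangents (f : R -> R) : {within `[0, 1], continuous f} ->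
  (forall s : R, 0 <= s <= 1 -> forall e : R, 0 < e ->
    \forall t \near within `[0, 1] (nbhs s), f s - e * `|t - s| <= f t) ->
  forall s, 0 <= s <= 1 -> f s = f 0.
Proof.
move=> cf Hf s /andP[s0 s1].
have small (x y : R) : (forall e, 0 < e -> x <= y + e * s) -> x <= y.
  move=> H; apply/ler_addgt0Pr => e e0; apply: le_trans (H e e0) _.
  by rewrite lerD2l ler_piMr// ltW.
apply/eqP; rewrite eq_le; apply/andP; split; apply: small => e e0.
  have := lower_tangents_le (u := fun x => s - x) cf Hf s0 e0.
  rewrite subr0 subrr; apply.
  - by move=> x; apply: cvgB; [exact: cvg_cst|exact: cvg_id].
  - by move=> x /andP[x0 xs]; rewrite subr_ge0 xs/= lerBlDr (le_trans s1)// lerDl.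
  - by move=> x y; rewrite opprB addrC subrKA distrC.
apply: (lower_tangents_le (u := id) cf Hf s0 e0) => //; first by move=> x; exact: cvg_id.
by move=> x /andP[-> xs]; rewrite (le_trans xs).
Qed.

End primitives.

Section local_regularity.
Context {R : realType} {m : nat} {M : manifold R m.+1}.
Notation mu := (@lebesgue_measure R).
Notation V := 'rV[R]_m.+1.
Notation coord := (@Defs.coord R m.+1 M).
Notation e_ := (delta_mx 0).
#[local] Opaque derive.

Lemma in_chart_eq (F : forall x : M, tangent x -> R) a x (w : V) (v : tangent x) :
  dom a x -> v = of_coord a (phi a x) w :> V -> F x v = in_chart F a (phi a x) w.
Proof.
move=> ax vw; pose Ft (x : M) (u : V) : R := @F x u.
by rewrite -[LHS]/(Ft x v) vw -[RHS]/(Ft (phi_inv a (phi a x)) (of_coord a (phi a x) w)) phiK.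
Qed.

Lemma velocity_of_coord (z : R -> M) a r : {within `[0, 1], continuous z} -> 0 <= r <= 1 ->
  dom a (z r) -> derivable01 (phi a \o z) r ->
  velocity z r = of_coord a (phi a (z r)) (deriv01 (phi a \o z) r) :> V.
Proof.
move=> cz r01 azr dz.
have sl := derivable01_slope dz.
have H := slope_phi_transition cz r01 azr (chart_at_dom (z r)) sl.
have [_ E] := deriv01_slope r01 H.
by apply: (etrans E); rewrite of_coordE phiK.
Qed.

Context (g : forall x : M, tangent x -> tangent x -> R).
Hypothesis hg : riemannian_metric g.

Lemma metric_ge0 x (v : tangent x) : 0 <= g v v.
Proof.
have [g_lin _ g_gt0 _] := hg; have [->|v0] := eqVneq v 0; last exact/ltW/g_gt0.
by rewrite (scalar_fun0 (@g_lin _ _)).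
Qed.

Context (z : R -> M).
Hypothesis cz : {within `[0, 1], continuous z}.
Hypothesis acz : forall b s t, segment_in z b s t -> abs_cont s t (phi b \o z).
Hypothesis finite_energy : (\int[mu]_(s in `[0%R, 1%R])
         (g (velocity z s) (velocity z s))%:E < +oo)%E.

Section segment.
Context (a : chart M) (s1 s2 : R) (w : R -> V) (N : set R).
Hypothesis s12 : s1 < s2.
Hypothesis azs : segment_in z a s1 s2.
Let Y (r : R) : V := phi a (z (clamp s1 s2 r)).
Hypothesis sw : speed s1 s2 Y w N.

Lemma img_Y r : img a (Y r).
Proof. by exists (z (clamp s1 s2 r)) => //; exact: (dom_clamp s12 azs). Qed.

Lemma measurable_speed_sq : measurable_fun setT (fun r => `|w r| ^+ 2).
Proof.
apply: (speed_measurable (Phi := fun yw : V * V => `|yw.2| ^+ 2) sw); first exact: continuous_curve_clamp.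
move=> r v; apply: cvgM; by apply: cvg_norm; exact: cvg_snd.
Qed.

(** The energy density is not known to be measurable, but w is a Borel function vanishing off the
    good times, and at these c times its squared norm is at most the energy density. *)
Lemma integrable_speed_sq (c : R) : 0 < c ->
  (forall r v, c * `|v| ^+ 2 <= metric_sq g a (Y r) v) ->
  mu.-integrable setT (EFin \o (fun r => `|w r| ^+ 2)).
Proof.
move=> c0 Hc.
have i1 : mu.-integrable setT (EFin \o (fun r => c * `|w r| ^+ 2)).
  apply/integrableP; split.
    by apply/measurable_EFinP; apply: measurable_funM => //; exact: measurable_speed_sq.
  apply: le_lt_trans finite_energy.
  pose D : set R := [set r | s1 < r < s2 /\ ~ N r].
  rewrite (_ : (\int[mu]_(x in _) _)%E = (\int[mu]_(r in D) (c * `|w r| ^+ 2)%R%:E)%E); last first.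
    apply: ae_eq_integral_restrict; apply: aeW => r.
    rewrite restrict_in// /= ger0_norm ?mulr_ge0 ?sqr_ge0 ?(ltW c0)//.
    have [rD|nrD] := pselect (D r); first by rewrite restrict_in.
    by rewrite restrict_out// (speed_off sw nrD) normr0 expr0n/= mulr0.
  apply: ge0_ae_le_integral.
  - by move=> r _; rewrite lee_fin mulr_ge0 ?sqr_ge0 ?(ltW c0).
  - by move=> r _; rewrite lee_fin metric_ge0.
  - apply: aeW => r [rs nN]; have [r01 azr] := mem_segment azs rs.
    split; first by rewrite /= in_itv.
    rewrite lee_fin; have [dz1 dz2] := deriv01_speed azs sw rs nN.
    have rcl : clamp s1 s2 r = r by rewrite clamp_id//; case/andP: rs => *; rewrite !ltW.
    have := Hc r (w r); rewrite /Y rcl => H; apply: (le_trans H).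
    rewrite /metric_sq -[leLHS]/(in_chart (fun x (v : tangent x) => g v v) a (phi a (z r)) (w r)).
    have E := @in_chart_eq (fun x (v : tangent x) => g v v) a (z r) (w r) (velocity z r) azr.
    have Ev : velocity z r = of_coord a (phi a (z r)) (w r) :> V.
      by rewrite (velocity_of_coord cz r01 azr dz1) dz2.
    by rewrite -(E Ev).
have := integrableZl measurableT c^-1 i1; apply: eq_integrable => // r _ /=.
by rewrite -EFinM mulKf// gt_eqF.
Qed.

Hypothesis iw : mu.-integrable setT (EFin \o (fun r => `|w r| ^+ 2)).

Lemma integrable_of_speed_bound (f : R -> R) (B : R) : measurable_fun setT f ->
  (forall r, `|f r| <= B * (`|w r| ^+ 2 + 1)) ->
  mu.-integrable setT (EFin \o (f \_ `[s1, s2])).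
Proof.
move=> mf fB; rewrite -restrict_EFin -integrable_mkcond//.
have mI : measurable (`[s1, s2]%classic : set (measurableTypeR R)) by exact: measurable_itv.
have i1 : mu.-integrable `[s1, s2] (EFin \o (fun r => `|w r| ^+ 2)) by exact: integrable_itv.
have i2 := integrable_itv_cst1 s1 s2.
have i3 := integrableZl mI B (integrableD mI i1 i2).
apply: (le_integrable mI _ _ i3).
  by apply/measurable_EFinP; exact: measurable_funS mf.
move=> r _ /=; rewrite lee_fin (le_trans (fB r))//; exact: ler_norm.
Qed.

Context (L : forall x : M, tangent x -> R).
Hypothesis L_C1 : C1_TM L.
Hypothesis crit : critical_point L z.
Context (B A : R).
Hypothesis B0 : 0 <= B.
Hypothesis A0 : 0 <= A.
Hypothesis d_v_bound : forall r v i, `|d_v_chart L a (Y r) v (e_ i)| <= B * (`|v| + 1).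
Hypothesis d_x_bound : forall r v i, `|d_x_chart L a (Y r) v (e_ i)| <= B * (`|v| ^+ 2 + 1).
Hypothesis expansive : forall r w1 w2,
  `|w2 - w1| <= A * `|legendre L a (Y r) w2 - legendre L a (Y r) w1|.

Lemma Y_continuous : continuous Y.
Proof. exact: continuous_curve_clamp cz s12 azs. Qed.

Lemma Y_clamp r : Y r = Y (clamp s1 s2 r).
Proof. by rewrite /Y (clamp_id (clamp_itv r (ltW s12))). Qed.

Lemma d_x_continuous r v u : {for (Y r, v), continuous (fun yw : V * V => d_x_chart L a yw.1 yw.2 u)}.
Proof.
have H := (L_C1 a).2 (u, 0) (Y r, v) (img_Y r).
rewrite (_ : (fun yw => _) = (fun yw => 'D_(u, 0) (chart_lagrangian L a) yw)); first exact: H.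
by apply/funext => -[y1 w1]; rewrite derive_pair_fst.
Qed.

Lemma d_v_continuous r v u : {for (Y r, v), continuous (fun yw : V * V => d_v_chart L a yw.1 yw.2 u)}.
Proof.
have H := (L_C1 a).2 (0, u) (Y r, v) (img_Y r).
rewrite (_ : (fun yw => _) = (fun yw => 'D_(0, u) (chart_lagrangian L a) yw)); first exact: H.
by apply/funext => -[y1 w1]; rewrite derive_pair_snd.
Qed.

Lemma legendre_continuous r v :
  {for (Y r, v), continuous (fun yw : V * V => legendre L a yw.1 yw.2)}.
Proof.
apply: continuous_at_row => i.
rewrite (_ : (fun yw => _) = (fun yw : V * V => d_v_chart L a yw.1 yw.2 (e_ i))); first exact: d_v_continuous.
by apply/funext => yw; rewrite mxE.
Qed.

Let X i r := d_x_chart L a (Y r) (w r) (e_ i).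

Lemma integrable_X i : mu.-integrable setT (EFin \o (X i \_ `[s1, s2])).
Proof.
apply: (@integrable_of_speed_bound _ B).
  apply: (speed_measurable (Phi := fun yw : V * V => d_x_chart L a yw.1 yw.2 (e_ i)) sw Y_continuous).
  by move=> r v; exact: d_x_continuous.
by move=> r; exact: d_x_bound.
Qed.

Lemma integrable_P i : mu.-integrable setT (EFin \o ((fun r => d_v_chart L a (Y r) (w r) (e_ i)) \_ `[s1, s2])).
Proof.
apply: (@integrable_of_speed_bound _ (2 * B)).
  apply: (speed_measurable (Phi := fun yw : V * V => d_v_chart L a yw.1 yw.2 (e_ i)) sw Y_continuous).
  by move=> r v; exact: d_v_continuous.
move=> r; apply: le_trans (d_v_bound r (w r) i) _.
rewrite [2 * B]mulrC -mulrA ler_wpM2l//.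
have := sqr_ge0 (`|w r| - 1); have := normr_ge0 (w r); move: `|w r| => t t0 h; nra.
Qed.

Lemma momentum_primitive : exists p : R -> V, [/\ continuous p, forall r, p r = p (clamp s1 s2 r),
  {ae mu, forall r, s1 < r < s2 -> legendre L a (Y r) (w r) = p r} &
  forall i x, s1 <= x <= s2 -> p x 0 i = p s1 0 i + (\int[mu]_(t in `[s1, x]) X i t)%R].
Proof.
have /choice[c Hc] : forall i, exists c, {ae mu, forall r, s1 < r < s2 ->
    d_v_chart L a (Y r) (w r) (e_ i) = c + (\int[mu]_(t in `[s1, r]) X i t)%R}.
  by move=> i; exact: (euler_lagrange_ae cz acz s12 azs sw iw L_C1 crit (integrable_X i) (integrable_P i)).
have iX i : mu.-integrable `[s1, s2] (EFin \o X i).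
  have := integrable_X i; rewrite -restrict_EFin -integrable_mkcond//.
pose G i x := (\int[mu]_(t in `[s1, x]) X i t)%R.
have cG i : continuous (G i \o clamp s1 s2).
  apply: continuous_comp_clamp (ltW s12) _.
  exact: (parameterized_integral_continuous (ltW s12) (iX i)).
have ccl r : clamp s1 s2 (clamp s1 s2 r) = clamp s1 s2 r by rewrite (clamp_id (clamp_itv r (ltW s12))).
exists (fun r => \row_i (c i + G i (clamp s1 s2 r))); split.
- move=> r; apply: continuous_at_row => i.
  rewrite (_ : (fun r => _) = (fun r => c i + (G i \o clamp s1 s2) r)); last by apply/funext => t; rewrite mxE.
  by apply: cvgD; [exact: cvg_cst|exact: cG].
- by move=> r; apply/rowP => i; rewrite !mxE ccl.
- have : {ae mu, forall r, forall i, s1 < r < s2 -> d_v_chart L a (Y r) (w r) (e_ i) = c i + G i r}.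
    by apply: filter_forall.
  apply: ae_imp => r H rs; apply/rowP => i; rewrite !mxE H// clamp_id//.
  by case/andP: rs => *; rewrite !ltW.
- move=> i x xs; rewrite !mxE (clamp_id xs) clamp_id; last by rewrite lexx ltW.
  have -> : G i s1 = 0 by rewrite /G set_itv1 Rintegral_set1.
  by rewrite addr0.
Qed.

(** F and p extend the curve and its momentum so that two-sided slopes exist up to the ends of the
    segment, from which the derivatives relative to [[0, 1]] are later read. *)
Lemma segment_regularity : exists W F p : R -> V, [/\ continuous W,
  forall r, s1 <= r <= s2 -> F r = phi a (z r) /\ p r = legendre L a (phi a (z r)) (W r),
  forall r, s1 <= r <= s2 -> slope F r t @[t --> r^'] --> W r &
  forall r, s1 <= r <= s2 -> slope p r t @[t --> r^'] -->
     (\row_i d_x_chart L a (phi a (z r)) (W r) (e_ i) : V)].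
Proof.
have [p [cp pc wp pE]] := momentum_primitive.
have [W [cW HW wW]] := implicit_speed s12 Y_continuous cp (@legendre_continuous) A0 expansive wp Y_clamp pc.
(* Under the integral, w may be replaced by its continuous version W; the integrands become
   continuous and the primitives C^1. *)
have intE (Phi : V * V -> R) x : s1 <= x <= s2 ->
    (\int[mu]_(t in `[s1, x]) Phi (Y t, w t))%R = (\int[mu]_(t in `[s1, x]) Phi (Y t, W t))%R.
  move=> /andP[s1x xs2]; congr fine; apply: ae_eq_integral_restrict.
  apply: ae_imp (ae_and wW (ae_notin_seq [:: s1; s2])) => r [H].
  rewrite !inE negb_or => /andP[rs1 rs2].
  have [rI|nrI] := pselect (`[s1, x]%classic r); last by rewrite !restrict_out.
  rewrite !restrict_in//; move: rI; rewrite /= in_itv/= => /andP[h1 h2].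
  rewrite H// !lt_neqAle eq_sym rs1 h1 rs2/=; exact: le_trans h2 xs2.
have YE r : s1 <= r <= s2 -> Y r = phi a (z r) by move=> rs; rewrite /Y clamp_id.
have /choice[F HF] : forall i, exists F : R -> R, (forall x, s1 <= x <= s2 -> F x = Y x 0 i) /\
    forall r, s1 <= r -> slope (V := R) F r t @[t --> r^'] --> W r 0 i.
  move=> i; apply: primitive_slope; first by move=> r; apply: continuous_at_coord; exact: cW.
  move=> x xs; rewrite -(intE (fun yw => yw.2 0 i))// -(speed_primitive sw)//.
  by rewrite addrC subrK.
have /choice[P HP] : forall i, exists F : R -> R, (forall x, s1 <= x <= s2 -> F x = p x 0 i) /\
    forall r, s1 <= r -> slope (V := R) F r t @[t --> r^'] --> d_x_chart L a (Y r) (W r) (e_ i).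
  move=> i; apply: primitive_slope.
    move=> r; apply: (@continuous_comp _ _ _ (fun r => (Y r, W r)) (fun yw : V * V => d_x_chart L a yw.1 yw.2 (e_ i))).
      by apply: continuous_at_pair; [exact: Y_continuous|exact: cW].
    exact: d_x_continuous.
  move=> x xs; rewrite -(intE (fun yw : V * V => d_x_chart L a yw.1 yw.2 (e_ i)))//.
  exact: pE.
exists W, (fun r => \row_i F i r), (fun r => \row_i P i r); split => // r rs.
- split; apply/rowP => i; rewrite mxE; first by rewrite (HF i).1// YE.
  by rewrite (HP i).1// -HW YE.
- apply: slope_row => i; case/andP: rs => s1r _.
  apply: cvg_trans ((HF i).2 r s1r); rewrite /slope.
  by under eq_fun do rewrite !mxE.
- apply: slope_row => i; rewrite mxE; case/andP: (rs) => s1r _; rewrite -YE//.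
  apply: cvg_trans ((HP i).2 r s1r); rewrite /slope.
  by under eq_fun do rewrite !mxE.
Qed.

End segment.

End local_regularity.

Lemma slope_row_coord {R : realType} n (s : R) (F : set_system R) {FF : ProperFilter F}
    (f : R -> 'rV[R]_n) (c : 'I_n -> R) i :
  slope f s r @[r --> F] --> (\row_i c i : 'rV[R]_n) ->
  slope (V := R) (fun t => f t 0 i) s r @[r --> F] --> c i.
Proof. by move=> H; have := slope_coord (i := i) H; rewrite mxE; exact. Qed.

(** * Regularity of critical curves *)

Section critical_curve.
Context {R : realType} {m : nat} {M : manifold R m.+1}.
Notation mu := (@lebesgue_measure R).
Notation V := 'rV[R]_m.+1.
Notation coord := (@Defs.coord R m.+1 M).
Notation e_ := (delta_mx 0).
#[local] Opaque derive.

Context (g : forall x : M, tangent x -> tangent x -> R).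
Hypothesis hg : riemannian_metric g.
Context (L : forall x : M, tangent x -> R) (K : forall x : M, tangent x)
  (Q : forall x : M, tangent x -> R) (d : M -> R).
Hypothesis L_C1 : C1_TM L.
Hypothesis K_C1 : C1_vector_field K.
Hypothesis Q_C1 : C1_one_form Q.
Hypothesis d_C1 : C1_function d.
Hypothesis noether : forall x (v : tangent x), d_v L v (K x) = Q v + d x.
Hypothesis QK_lt0 : forall x, Q (K x) < 0.
Hypothesis hG : cond_G g (L_c L K Q).
Context (p q : M) (z : R -> M).
Hypothesis hz : Omega12 g p q z.
Hypothesis crit : critical_point L z.

Lemma curve_continuous : {within `[0, 1], continuous z}.
Proof. by have [] := hz. Qed.

Lemma near_regular_segment (a : chart M) s0 (P : V -> Prop) : 0 <= s0 <= 1 -> dom a (z s0) ->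
  (\forall y \near phi a (z s0), P y) ->
  exists s1 s2, [/\ s1 < s2, segment_in z a s1 s2,
    \forall t \near within `[0, 1] (nbhs s0), s1 <= t <= s2 &
    forall r, s1 <= r <= s2 -> P (phi a (z r))].
Proof.
move=> s01 azs HP; have cz := curve_continuous.
have H1 : \forall t \near within `[0, 1] (nbhs s0), dom a (z t) by exact: near_dom_curve.
have cphi : (phi a \o z) t @[t --> within `[0, 1] (nbhs s0)] --> phi a (z s0).
  apply: (@cvg_comp _ _ _ z (phi a) _ (nbhs (z s0))); last exact: phi_continuous.
  exact: ((subspace_continuousP _ _).1 cz).
have H2 : \forall t \near within `[0, 1] (nbhs s0), P (phi a (z t)) by exact: cphi HP.
have : \forall t \near within `[0, 1] (nbhs s0), dom a (z t) /\ P (phi a (z t)) by exact: filterI.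
move=> [del /= del0 H].
have {}H t : 0 <= t <= 1 -> `|s0 - t| < del -> dom a (z t) /\ P (phi a (z t)).
  by move=> t01 td; apply: H => //=; rewrite in_itv.
move: s01 => /andP[s00 s01].
(* Cutting at 0 and 1 keeps the segment nondegenerate and still a neighbourhood of s0 relative to
   [[0, 1]], even if s0 is an endpoint. *)
exists (Num.max 0 (s0 - del / 2)), (Num.min 1 (s0 + del / 2)).
have HI t : Num.max 0 (s0 - del / 2) <= t <= Num.min 1 (s0 + del / 2) -> 0 <= t <= 1 /\ `|s0 - t| < del.
  rewrite ge_max le_min => /andP[/andP[h1 h2] /andP[h3 h4]]; split; first by rewrite h1.
  by rewrite ltr_norml; apply/andP; split; lra.
split.
- by rewrite gt_max !lt_min; apply/andP; split; apply/andP; split; lra.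
- split; first by rewrite le_max lexx.
  + by rewrite ge_max !le_min; apply/andP; split; apply/andP; split; lra.
  + by rewrite ge_min lexx.
  + by move=> r /HI[r01 rd]; have [] := H r r01 rd.
- exists (del / 2) => /=; first by rewrite divr_gt0.
  move=> t /=; rewrite in_itv/= => td /andP[t0 t1].
  rewrite ge_max le_min t0 t1/=; move: td; rewrite ltr_norml => /andP[h1 h2].
  by apply/andP; split; lra.
- by move=> r /HI[r01 rd]; have [] := H r r01 rd.
Qed.

Lemma local_solution (a : chart M) s0 : 0 <= s0 <= 1 -> dom a (z s0) ->
  exists s1 s2 (W F P : R -> V), [/\ segment_in z a s1 s2,
    \forall t \near within `[0, 1] (nbhs s0), s1 <= t <= s2, continuous W,
    forall r, s1 <= r <= s2 -> F r = phi a (z r) /\ P r = legendre L a (phi a (z r)) (W r) &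
    forall r, s1 <= r <= s2 -> slope F r t @[t --> r^'] --> W r /\
      slope P r t @[t --> r^'] --> (\row_i d_x_chart L a (phi a (z r)) (W r) (e_ i) : V)].
Proof.
move=> s01 azs; have cz := curve_continuous.
have [z0 z1 _ acz en] := hz.
have ay : img a (phi a (z s0)) by exists (z s0).
have [C [lambda [[C_cont _] [l_cont l_gt0] _ hX [hV hM]]]] := hG.
have [Ca Ca_bd d_x_bd] := hX a.
have [B1 [B10 H1]] := near_d_v_bound hg L_C1 K_C1 Q_C1 QK_lt0 C_cont hV ay.
have [B2 [B20 H2]] := near_d_x_bound hg L_C1 K_C1 Q_C1 QK_lt0 Ca_bd d_x_bd ay.
have [A [A0 H3]] := near_legendre_expansive hg L_C1 K_C1 Q_C1 noether QK_lt0 l_cont l_gt0 hM ay.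
have [c [C0 [c0 C00 H4]]] := metric_local_bounds hg ay.
pose P y := [/\ forall w i, `|d_v_chart L a y w (e_ i)| <= (B1 + B2) * (`|w| + 1),
  forall w i, `|d_x_chart L a y w (e_ i)| <= (B1 + B2) * (`|w| ^+ 2 + 1),
  forall w1 w2 : V, `|w2 - w1| <= A * `|legendre L a y w2 - legendre L a y w1| &
  forall w, c * `|w| ^+ 2 <= metric_sq g a y w].
have nP : \forall y \near phi a (z s0), P y.
  have nF : Filter (nbhs (phi a (z s0))) by exact: nbhs_filter.
  have H12 := @filterI _ _ nF _ _ H1 H2; have H34 := @filterI _ _ nF _ _ H3 H4.
  apply: filterS2 H12 H34 => y [h1 h2] [h3 h4]; split.
  - by move=> w i; apply: le_trans (h1 w i) _; apply: ler_wpM2r; [rewrite addr_ge0|rewrite lerDl].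
  - move=> w i; apply: le_trans (h2 w i) _; apply: ler_wpM2r; last by rewrite lerDr.
    by rewrite addr_ge0// sqr_ge0.
  - exact: h3.
  - by move=> w; have /andP[] := h4 w.
have [s1 [s2 [s12 sg near_s HP]]] := near_regular_segment s01 azs nP.
have HPY r : P (phi a (z (clamp s1 s2 r))) by apply/HP/clamp_itv/ltW.
have [w [N sw]] : exists w N, speed s1 s2 (fun r => phi a (z (clamp s1 s2 r))) w N.
  apply: abs_cont_speed => //; exact: (abs_cont_comp_clamp _ _ (ltW s12) (acz _ _ _ sg)).
have iw := integrable_speed_sq hg cz en s12 sg sw c0 (fun r v => let: And4 _ _ _ h := HPY r in h v).
have B0 : 0 <= B1 + B2 by rewrite addr_ge0.
have [W [F [G [h1 h2 h3 h4]]]] := segment_regularity cz acz s12 sg sw iw L_C1 crit B0 A0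
  (fun r => let: And4 h _ _ _ := HPY r in h) (fun r => let: And4 _ h _ _ := HPY r in h)
  (fun r => let: And4 _ _ h _ := HPY r in h).
exists s1, s2, W, F, G; split => //.
by move=> r rs; split; [exact: h3|exact: h4].
Qed.

Lemma near_within_join (s0 : R) (P : R -> Prop) :
  (\forall t \near within `[0, 1] (nbhs s0), P t) ->
  \forall t \near within `[0, 1] (nbhs s0), \forall t' \near within `[0, 1] (nbhs t), P t'.
Proof.
move=> H; have H' : \forall t \near s0, \forall t' \near t, `[0, 1]%classic t' -> P t' by exact: near_join.
by apply: filterS H' => t Ht _.
Qed.

Lemma within01_self (s0 : R) (P : R -> Prop) : 0 <= s0 <= 1 ->
  (\forall t \near within `[0, 1] (nbhs s0), P t) -> P s0.
Proof. by move=> s01 H; apply: (nbhs_singleton H); rewrite /= in_itv. Qed.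

Lemma near_within_itv (s0 : R) : \forall t \near within `[0, 1] (nbhs s0), 0 <= t <= 1.
Proof. by exists 1 => /=; [exact: ltr01|move=> t _; rewrite in_itv]. Qed.

Definition legendre_curve (a : chart M) (t : R) : V :=
  legendre L a (phi a (z t)) (deriv01 (phi a \o z) t).

(** The slope of [legendre_curve] at t involves [deriv01] at all times near t, so the velocity must
    be identified with W around each t and not only at t: hence the iterated neighbourhoods. *)
Lemma local_regular_curve (a : chart M) s0 : 0 <= s0 <= 1 -> dom a (z s0) ->
  exists W : R -> V, continuous W /\
    \forall t \near within `[0, 1] (nbhs s0), [/\ 0 <= t <= 1, dom a (z t),
      slope (phi a \o z) t r @[r --> within `[0, 1] t^'] --> W t,
      deriv01 (phi a \o z) t = W t &
      slope (legendre_curve a) t r @[r --> within `[0, 1] t^'] -->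
        (\row_i d_x_chart L a (phi a (z t)) (W t) (e_ i) : V)].
Proof.
move=> s01 azs; have [s1 [s2 [W [F [P [sg nI cW hFP hsl]]]]]] := local_solution s01 azs.
exists W; split; first exact: cW.
have nI2 := near_within_join nI.
have H0 : \forall t \near within `[0, 1] (nbhs s0), [/\ 0 <= t <= 1, s1 <= t <= s2,
    \forall t' \near within `[0, 1] (nbhs t), s1 <= t' <= s2 &
    slope (phi a \o z) t r @[r --> within `[0, 1] t^'] --> W t /\ deriv01 (phi a \o z) t = W t].
  apply: filterS3 (near_within_itv s0) nI nI2 => t t01 ts nt; split => //.
  have [slF _] := hsl t ts.
  have pF := within01_proper t01.
  have sl : slope (phi a \o z) t r @[r --> within `[0, 1] t^'] --> W t.
    apply: slope_eq (slope_within01 slF); last by rewrite (hFP t ts).1.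
    by apply: filterS (near_within_dnbhs nt) => r rs; rewrite (hFP r rs).1.
  by split => //; have [_] := deriv01_slope t01 sl.
have H1 := near_within_join H0.
apply: filterS2 H0 H1 => t [t01 ts nt [sl dE]] nt'.
have pF := within01_proper t01.
split; [exact: t01| |exact: sl|exact: dE|].
  by have [_ _ _] := sg; apply.
have [_ slP] := hsl t ts.
apply: slope_eq (slope_within01 slP).
  apply: filterS (near_within_dnbhs nt') => r [_ rs _ [_ rE]].
  by rewrite (hFP r rs).2 /legendre_curve rE.
by rewrite (hFP t ts).2 /legendre_curve dE.
Qed.

Lemma critical_C1_curve : C1_curve z.
Proof.
split; first exact: curve_continuous.
move=> a s [s01 azs]; have [W [cW H]] := local_regular_curve s01 azs.
have [_ _ sl dE _] := within01_self s01 H.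
have [dz _] := deriv01_slope s01 sl.
split; first exact: dz.
rewrite dE; have cWs : W t @[t --> within `[0, 1] (nbhs s)] --> W s.
  by apply: cvg_trans (cW s); apply: cvg_fmap2; exact: cvg_within.
by apply: cvg_near_eq cWs; apply: filterS H => t [_ _ _ -> _].
Qed.

Lemma phi_curve_cvg (a : chart M) s : 0 <= s <= 1 -> dom a (z s) ->
  phi a (z t) @[t --> within `[0, 1] (nbhs s)] --> phi a (z s).
Proof.
move=> s01 azs; apply: (@cvg_comp _ _ _ z (phi a) _ (nbhs (z s))); last exact: phi_continuous.
by apply: ((subspace_continuousP _ _).1 curve_continuous); rewrite /= in_itv.
Qed.

Lemma near_momentum (a : chart M) i s0 : 0 <= s0 <= 1 -> dom a (z s0) ->
  exists W : R -> V, continuous W /\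
  \forall s \near within `[0, 1] (nbhs s0), [/\ deriv01 (phi a \o z) s = W s,
    derivable01 (momentum L z a i) s &
    deriv01 (momentum L z a i) s = d_x_chart L a (phi a (z s)) (W s) (e_ i)].
Proof.
move=> s01 azs; have [W [cW H]] := local_regular_curve s01 azs; exists W; split => //.
apply: filterS H => s [t01 azt _ dE sl].
have pF := within01_proper t01.
have H2 : slope (V := R) (momentum L z a i) s r @[r --> within `[0, 1] s^'] -->
    d_x_chart L a (phi a (z s)) (W s) (e_ i).
  rewrite (_ : momentum L z a i = (fun t => legendre_curve a t 0 i)); first exact: slope_row_coord sl.
  by apply/funext => t; rewrite mxE.
by have [h1 h2] := deriv01_slope t01 H2; split.
Qed.

Lemma critical_momentum_C1 (a : chart M) i :
  C1_on01 [set s | 0 <= s <= 1 /\ dom a (z s)] (momentum L z a i).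
Proof.
move=> s [s01 azs]; have [W [cW H]] := near_momentum i s01 azs.
have [_ h1 h2] := within01_self s01 H; split; first exact: h1.
rewrite h2.
have cWs : W t @[t --> within `[0, 1] (nbhs s)] --> W s.
  by apply: cvg_trans (cW s); apply: cvg_fmap2; exact: cvg_within.
have cyW : (phi a (z t), W t) @[t --> within `[0, 1] (nbhs s)] --> (phi a (z s), W s).
  exact: (cvg_pair (phi_curve_cvg s01 azs) cWs).
have ay : img a (phi a (z s)) by exists (z s).
have cX := (L_C1 a).2 (e_ i, 0) (phi a (z s), W s) ay.
have := cvg_comp _ _ cyW cX; rewrite derive_pair_fst => H2.
apply: cvg_near_eq H2; apply: filterS H => t [_ _ ->].
exact: (derive_pair_fst (chart_lagrangian L a)).
Qed.

Lemma critical_euler_lagrange (a : chart M) i s : 0 <= s <= 1 -> dom a (z s) ->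
  d_x_chart L a (phi a (z s)) (deriv01 (phi a \o z) s) (e_ i) =
  deriv01 (momentum L z a i) s.
Proof.
move=> s01 azs; have [W [cW H]] := near_momentum i s01 azs.
by have [-> _ ->] := within01_self s01 H.
Qed.

End critical_curve.

(** * Convexity along the fibres *)

Lemma convexity_arith {R : realType} (l0 l1 p q0 q1 k : R) :
  l0 - q0 ^+ 2 * k + (p - 2 * q0 * (q1 - q0) * k) <= l1 - q1 ^+ 2 * k ->
  l0 + p + (q1 - q0) ^+ 2 * k <= l1.
Proof. lra. Qed.

Lemma homogeneity_arith {R : realType} (c p q1 q2 k : R) :
  c * p - 2 * q1 * (c * q2) / k = c * (p - 2 * q1 * q2 / k).
Proof. ring. Qed.

Lemma mean_value_arith {R : realType} (h0 h1 l0 l1 p dc : R) :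
  h1 - h0 = dc * (1 - 0) -> h0 = l0 -> h1 = l1 -> p <= dc -> l0 + p <= l1.
Proof. lra. Qed.

Lemma scaled_le_arith {R : realType} (c A B : R) : 0 <= c -> (c = 0 -> A = B) ->
  0 <= c * A - c * B -> B <= A.
Proof.
rewrite le_eqVlt => /orP[/eqP/esym c0 /(_ c0) ->//|c0 _].
by rewrite -mulrBr pmulr_rge0// subr_ge0.
Qed.

(** On the segment from w0 to w1 = w0 + u, the increment of f is df (w0 + c u) u for some c, and
    monotonicity between w0 and w0 + c u, divided by c, compares it with df w0 u. *)
Lemma convex_of_monotone_derive {R : realType} {V : normedModType R} (f : V -> R)
    (df : V -> V -> R) (w0 w1 : V) :
  (forall w u, is_derive w u f (df w u)) ->
  (forall w u c, df w (c *: u) = c * df w u) ->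
  (forall w w', 0 <= df w' (w' - w) - df w (w' - w)) ->
  f w0 + df w0 (w1 - w0) <= f w1.
Proof.
move=> f_df dfZ df_mono; pose u := w1 - w0.
have dhP (t : R) : is_derive t (1 : R) (fun t => f (w0 + t *: u)) (df (w0 + t *: u) u).
  by apply: is_derive_line; exact: f_df.
have h1 : f (w0 + 1 *: u) = f w1 by rewrite scale1r addrC subrK.
have h0 : f (w0 + 0 *: u) = f w0 by rewrite scale0r addr0.
have [c /andP[c0 _] E] := MVT_closed (@ltr01 R) (fun s _ => dhP s).
apply: (mean_value_arith E h0 h1).
(* [MVT_closed] does not exclude c = 0; the two derivatives then coincide. *)
apply: (scaled_le_arith c0).
  by move=> c_eq0; rewrite c_eq0 scale0r addr0.
rewrite -(dfZ w0 u c) -(dfZ _ u c).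
have := df_mono w0 (w0 + c *: u).
by rewrite (_ : w0 + c *: u - w0 = c *: u)// addrAC subrr add0r.
Qed.

Section fibre_convexity.
Context {R : realType} {m : nat} {M : manifold R m.+1}.
Notation V := 'rV[R]_m.+1.
Notation e_ := (delta_mx 0).
#[local] Opaque derive.
Context (L : forall x : M, tangent x -> R) (K : forall x : M, tangent x)
  (Q : forall x : M, tangent x -> R).
Hypothesis L_C1 : C1_TM L.
Hypothesis Q_linear : forall x, scalar (@Q x).
Hypothesis monotone : forall x (v1 v2 : tangent x),
  0 <= d_v (L_c L K Q) v2 (v2 - v1) - d_v (L_c L K Q) v1 (v2 - v1).
Context (a : chart M) (y : V).
Hypothesis ay : img a y.

Lemma derivable_in_chart_L_c (w u : V) : derivable (in_chart (L_c L K Q) a y) w u.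
Proof.
have lq := in_chart_form_scalar ay Q_linear.
have dq : is_derive w u (in_chart Q a y) (in_chart Q a y u) by exact: is_derive_scalar.
have dL : derivable (in_chart L a y) w u by exact: derivable_in_chart.
rewrite (_ : in_chart _ a y = in_chart L a y - in_chart Q a y * in_chart Q a y * cst (form_K K Q a y)^-1).
  apply: derivableB; first exact: dL.
  exact: ex_derive.
by apply/funext => v; rewrite /in_chart /L_c expr2.
Qed.

Lemma d_v_chart_L_cZ (w u : V) c :
  d_v_chart (L_c L K Q) a y w (c *: u) = c * d_v_chart (L_c L K Q) a y w u.
Proof.
have lq := in_chart_form_scalar ay Q_linear.
rewrite !(d_v_chart_L_c ay K L_C1 Q_linear) (d_v_chartZ _ _ _ L_C1 ay) (scalar_funZ lq).
exact: homogeneity_arith.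
Qed.

Lemma L_c_fibre_convex (w0 w1 : V) :
  in_chart (L_c L K Q) a y w0 + d_v_chart (L_c L K Q) a y w0 (w1 - w0) <=
  in_chart (L_c L K Q) a y w1.
Proof.
apply: (convex_of_monotone_derive (df := d_v_chart (L_c L K Q) a y)).
- by move=> w u; apply: DeriveDef; [exact: derivable_in_chart_L_c|].
- by move=> w u c; exact: d_v_chart_L_cZ.
move=> w w'; have := monotone (of_coord a y w) (of_coord a y w').
have -> : of_coord a y w' - of_coord a y w = of_coord a y (w' - w).
  exact: (esym (of_coordB ay _ _)).
by rewrite -!(d_v_of_coord ay).
Qed.

(** Expanding the convexity of [L_c] at w0 leaves exactly the square of Q(w1 - w0) over Q(K): the
    defect of convexity of L is of second order. *)
Lemma L_fibre_convex (w0 w1 : V) :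
  in_chart L a y w0 + d_v_chart L a y w0 (w1 - w0) +
    in_chart Q a y (w1 - w0) ^+ 2 / form_K K Q a y <= in_chart L a y w1.
Proof.
have lq := in_chart_form_scalar ay Q_linear.
have := L_c_fibre_convex w0 w1; rewrite (d_v_chart_L_c ay K L_C1 Q_linear).
have E w : in_chart (L_c L K Q) a y w = in_chart L a y w - in_chart Q a y w ^+ 2 / form_K K Q a y by [].
rewrite !E (scalar_funB lq) -[Q (K _)]/(form_K K Q a y).
exact: convexity_arith.
Qed.

End fibre_convexity.

(** * Conservation of the energy *)

Section lower_tangents.
Context {R : realType} (s : R) (F : set_system R) {FF : ProperFilter F}.
Lemma slopeB (f h : R -> R) (l k : R) :
  slope (V := R) f s t @[t --> F] --> l -> slope (V := R) h s t @[t --> F] --> k ->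
  slope (V := R) (fun t => f t - h t) s t @[t --> F] --> l - k.
Proof.
move=> Hf Hh; apply: cvg_near_eq (cvgB Hf Hh); near=> t.
rewrite -[LHS]/(slope (V := R) f s t - slope (V := R) h s t) /slope -scalerBr; congr (_ *: _).
ring.
Unshelve. all: by end_near. Qed.

Hypothesis Fs : punctured_at s F.

(** The derivative of psi^2 is 2 psi psi', which vanishes where psi does, whatever the derivatives
    of psi and c. *)
Lemma slope_square_correction (A psi c : R -> R) (l k : R) :
  slope (V := R) A s t @[t --> F] --> (0 : R) ->
  slope (V := R) psi s t @[t --> F] --> l -> psi s = 0 ->
  slope (V := R) c s t @[t --> F] --> k ->
  slope (V := R) (fun t => A t + psi t * psi t * c t) s t @[t --> F] --> (0 : R).
Proof.
move=> HA Hpsi psi0 Hc.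
have H1 : slope (V := R) (fun t => psi t * psi t) s t @[t --> F] --> (0 : R).
  have H : slope (V := R) (fun t => psi t *: psi t) s t @[t --> F] --> l *: psi s + psi s *: l.
    exact: slopeZ.
  by rewrite psi0 scaler0 scale0r addr0 in H.
have H2 : slope (V := R) (fun t => psi t * psi t * c t) s t @[t --> F] --> (0 : R).
  have H : slope (V := R) (fun t => (psi t * psi t) *: c t) s t @[t --> F] -->
    0 *: c s + (psi s * psi s) *: k by exact: slopeZ.
  by rewrite psi0 mul0r !scale0r addr0 in H.
have H3 : slope (V := R) (fun t => A t + psi t * psi t * c t) s t @[t --> F] --> (0 + 0 : R).
  exact: slopeD.
by rewrite addr0 in H3.
Qed.

End lower_tangents.

Lemma lower_tangent_of_slope {R : realType} (E theta : R -> R) (s e : R) : 0 <= s <= 1 ->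
  slope (V := R) theta s t @[t --> within `[0, 1] s^'] --> (0 : R) -> theta s = E s ->
  (\forall t \near within `[0, 1] (nbhs s), theta t <= E t) -> 0 < e ->
  \forall t \near within `[0, 1] (nbhs s), E s - e * `|t - s| <= E t.
Proof.
move=> s01 sl ths Hth e0.
have H1 : \forall t \near within `[0, 1] s^', `|slope (V := R) theta s t| < e.
  have /cvgrPdist_lt := sl => /(_ e e0).
  by apply: filterS => t; rewrite sub0r normrN.
have H2 : \forall t \near within `[0, 1] (nbhs s), t != s -> `|slope (V := R) theta s t| < e.
  move: H1; rewrite /within /dnbhs /=; case=> del /= del0 Hd.
  by exists del => //= t td t01 ts; exact: Hd.
apply: filterS2 H2 Hth => t Ht; apply: le_trans.
have [->|ts] := eqVneq t s; first by rewrite subrr normr0 mulr0 subr0 ths.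
have := Ht ts; rewrite /slope normrZ normfV -ths.
have ts0 : 0 < `|t - s| by rewrite normr_gt0 subr_eq0.
rewrite mulrC ltr_pdivrMr// ltr_norml => /andP[H _].
by rewrite lerBlDl -lerBlDr -lerN2 opprB -opprB lerN2 ltW// -opprB ltrNl.
Qed.

Lemma fenchel_arith {R : realType} (l1 l0 pv pw q0 q1 k : R) :
  l0 + (pv - pw) + (q1 - q0) ^+ 2 / k <= l1 -> pv - l1 + (q1 - q0) ^+ 2 / k <= pw - l0.
Proof. lra. Qed.

Lemma d_x_chart_expand {R : realType} {m : nat} {M : manifold R m.+1}
    (L : forall x : M, tangent x -> R) (a : chart M) (y w u : 'rV[R]_m.+1) :
  C1_TM L -> img a y ->
  d_x_chart L a y w u = \sum_i u 0 i * d_x_chart L a y w (delta_mx 0 i).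
Proof.
move=> L_C1 ay; rewrite d_x_chartE//.
have lf : scalar (fun u : 'rV[R]_m.+1 => 'd (chart_lagrangian L a) (y, w) (u, 0 : 'rV[R]_m.+1)).
  move=> c u1 u2; rewrite -[c * _]linearZ -linearD; congr ('d _ _ (_, _)).
  by rewrite /= scaler0 addr0.
rewrite (scalar_expand u lf); apply: eq_bigr => i _.
by rewrite d_x_chartE.
Qed.

Section energy.
Context {R : realType} {m : nat} {M : manifold R m.+1}.
Notation V := 'rV[R]_m.+1.
Notation e_ := (delta_mx 0).
#[local] Opaque derive.

Context (g : forall x : M, tangent x -> tangent x -> R).
Hypothesis hg : riemannian_metric g.
Context (L : forall x : M, tangent x -> R) (K : forall x : M, tangent x)
  (Q : forall x : M, tangent x -> R) (d : M -> R).
Hypothesis L_C1 : C1_TM L.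
Hypothesis K_C1 : C1_vector_field K.
Hypothesis Q_C1 : C1_one_form Q.
Hypothesis d_C1 : C1_function d.
Hypothesis noether : forall x (v : tangent x), d_v L v (K x) = Q v + d x.
Hypothesis QK_lt0 : forall x, Q (K x) < 0.
Hypothesis hG : cond_G g (L_c L K Q).

Lemma L_c_monotone x (v1 v2 : tangent x) :
  0 <= d_v (L_c L K Q) v2 (v2 - v1) - d_v (L_c L K Q) v1 (v2 - v1).
Proof.
have [C [lambda [_ [_ l0] _ _ [_ hM]]]] := hG.
by apply: le_trans (hM x v1 v2); rewrite mulr_ge0 ?sqr_ge0// ltW.
Qed.

(** Fenchel-Young inequality with a defect, in which the Noether identity expresses Q(w) by the
    momentum. For a frozen v, the left side then depends on y and the momentum only, both
    differentiable along the curve. *)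
Lemma fenchel_young a y w v : img a y ->
  d_v_chart L a y w v - in_chart L a y v +
    (in_chart Q a y v - (d_v_chart L a y w (coord_K K a y) - d (phi_inv a y))) ^+ 2 / form_K K Q a y <=
  d_v_chart L a y w w - in_chart L a y w.
Proof.
move=> ay; have Ql := Q_lin Q_C1.
have := L_fibre_convex L_C1 Ql L_c_monotone ay w v.
have lq := in_chart_form_scalar ay Ql.
have -> : d_v_chart L a y w (v - w) = d_v_chart L a y w v - d_v_chart L a y w w.
  by rewrite (d_v_chartD _ _ _ L_C1 ay) -scaleN1r (d_v_chartZ _ _ _ L_C1 ay) mulN1r.
rewrite (scalar_funB lq) (d_v_chart_noether ay noether) addrK.
exact: fenchel_arith.
Qed.

Context (p q : M) (z : R -> M).
Hypothesis hz : Omega12 g p q z.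
Hypothesis crit : critical_point L z.

Definition energy (t : R) : R := d_v L (velocity z t) (velocity z t) - L (velocity z t).

(** [velocity z t] is expressed in the chart selected at z t, which may change abruptly with t; a
    fixed chart makes energies at different times comparable. *)
Lemma energy_chart a t w : 0 <= t <= 1 -> dom a (z t) ->
  slope (phi a \o z) t r @[r --> within `[0, 1] t^'] --> w ->
  energy t = d_v_chart L a (phi a (z t)) w w - in_chart L a (phi a (z t)) w.
Proof.
move=> t01 azt sl; have [dz dE] := deriv01_slope t01 sl.
have vE := velocity_of_coord (curve_continuous hz) t01 azt dz.
rewrite dE in vE.
have H := @in_chart_eq _ _ _ (fun x (v : tangent x) => d_v L v v - L v) a (z t) w (velocity z t) azt vE.
apply: (etrans H).
have ay : img a (phi a (z t)) by exists (z t).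
by rewrite (d_v_of_coord ay).
Qed.

(* With v = W s frozen, [fenchel_young] bounds the energy at t from below by a
   function of t which is differentiable at s with derivative 0: its first term
   has derivative 0 by the Euler-Lagrange equation, and psi vanishes at s by the
   Noether identity. *)
Section tangent_at.
Context (a : chart M) (s : R) (W : R -> V).
Hypothesis s01 : 0 <= s <= 1.
Hypothesis azs : dom a (z s).
Hypothesis cW : continuous W.
Hypothesis regular : \forall t \near within `[0, 1] (nbhs s), [/\ 0 <= t <= 1, dom a (z t),
      slope (phi a \o z) t r @[r --> within `[0, 1] t^'] --> W t,
      deriv01 (phi a \o z) t = W t &
      slope (legendre_curve L z a) t r @[r --> within `[0, 1] t^'] -->
        (\row_i d_x_chart L a (phi a (z t)) (W t) (e_ i) : V)].

Let y t := phi a (z t).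
Let lam := legendre_curve L z a.
Let v := W s.
Let psi t := in_chart Q a (y t) v - (\sum_i coord_K K a (y t) 0 i * lam t 0 i - d (phi_inv a (y t))).
Let A t := \sum_i v 0 i * lam t 0 i - in_chart L a (y t) v.
Let theta t := A t + psi t * psi t * (form_K_sum K Q a (y t))^-1.

Lemma theta_le : \forall t \near within `[0, 1] (nbhs s), theta t <= energy t.
Proof.
apply: filterS regular => t [t01 azt sl dE _].
have ay : img a (y t) by exists (z t).
rewrite (energy_chart t01 azt sl) /theta form_K_sumE//.
have := fenchel_young (W t) v ay.
by rewrite !(d_v_chart_legendre L_C1 _ _ ay) /A /psi expr2 /lam /legendre_curve dE.
Qed.

Lemma psi_s : psi s = 0.
Proof.
have [_ _ sl dE _] := within01_self s01 regular.
have ay : img a (y s) by exists (z s).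
have := d_v_chart_noether ay noether (W s); rewrite (d_v_chart_legendre L_C1 _ _ ay) => H.
by rewrite /psi /lam /legendre_curve dE H /v addrK subrr.
Qed.

Lemma theta_s : theta s = energy s.
Proof.
have [_ _ sl dE _] := within01_self s01 regular.
have ay : img a (y s) by exists (z s).
rewrite (energy_chart s01 azs sl) /theta psi_s mul0r mul0r addr0 /A.
by rewrite (d_v_chart_legendre L_C1 _ _ ay) /lam /legendre_curve dE.
Qed.

Lemma theta_slope : slope (V := R) theta s t @[t --> within `[0, 1] s^'] --> (0 : R).
Proof.
have [_ _ sl _ sl_lam] := within01_self s01 regular.
have pF := within01_proper s01; have pu := punctured_at_within01 s.
have ay : img a (y s) by exists (z s).
have sl_i i : slope (V := R) (fun t => lam t 0 i) s t @[t --> within `[0, 1] s^'] -->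
  d_x_chart L a (y s) v (e_ i) by exact: slope_row_coord sl_lam.
have comp (f : V -> R) : differentiable f (y s) ->
    slope (V := R) (fun t => f (y t)) s t @[t --> within `[0, 1] s^'] --> 'D_v f (y s).
  by move=> df; exact: (slope_comp pu sl df).
have HA : slope (V := R) A s t @[t --> within `[0, 1] s^'] --> (0 : R).
  have H1 : slope (V := R) (fun t => \sum_i v 0 i * lam t 0 i) s t @[t --> within `[0, 1] s^'] -->
      \sum_i v 0 i * d_x_chart L a (y s) v (e_ i).
    apply: slope_sum => i.
    have H := slopeZ pu (slope_cst s (v 0 i : R)) (sl_i i).
    by rewrite scale0r add0r in H; exact: H.
  have H2 : slope (V := R) (fun t => in_chart L a (y t) v) s t @[t --> within `[0, 1] s^'] -->
      d_x_chart L a (y s) v v.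
    have H : slope (chart_lagrangian L a \o (fun t => (y t, v))) s t @[t --> within `[0, 1] s^'] -->
        'D_(v, 0) (chart_lagrangian L a) (y s, v).
      apply: (slope_comp pu); first exact: slope_pair sl (slope_cst s v).
      exact: differentiable_chart_lagrangian.
    by rewrite derive_pair_fst in H.
  have := slopeB H1 H2; rewrite -(d_x_chart_expand _ _ L_C1 ay) subrr; exact.
have [l Hl] : exists l : R, slope (V := R) psi s t @[t --> within `[0, 1] s^'] --> l.
  eexists; apply: slopeB.
    by apply: (comp (fun y => in_chart Q a y v)); have [_ CQ] := Q_C1; exact: (CQ a v).1.
  apply: slopeB.
    apply: slope_sum => i; apply: (slopeZ pu _ (sl_i i)).
    apply: (comp (fun y => coord_K K a y 0 i)).
    by apply: (Ck1_coord i (@img_open _ _ M a) (K_C1 a)).1.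
  by apply: (comp (d \o phi_inv a)); exact: (d_C1 a).1.
have [k Hk] : exists k : R, slope (V := R) (fun t => (form_K_sum K Q a (y t))^-1) s t @[t --> within `[0, 1] s^'] --> k.
  eexists; apply: (comp (fun y => (form_K_sum K Q a y)^-1)).
  apply: differentiableV; first exact: (form_K_sum_C1 K_C1 Q_C1 a).1.
  by rewrite form_K_sumE// lt_eqF// QK_lt0.
exact: (slope_square_correction pu HA Hl psi_s Hk).
Qed.

End tangent_at.

Lemma energy_lower_tangent (s e : R) : 0 <= s <= 1 -> 0 < e ->
  \forall t \near within `[0, 1] (nbhs s), energy s - e * `|t - s| <= energy t.
Proof.
move=> s01 e0; have azs := chart_at_dom (z s).
have [W [cW H]] := local_regular_curve hg L_C1 K_C1 Q_C1 noether QK_lt0 hG hz crit s01 azs.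
have h1 := theta_slope s01 azs H; have h2 := theta_s s01 azs H; have h3 := theta_le H.
exact: (@lower_tangent_of_slope _ energy _ s e s01 h1 h2 h3 e0).
Qed.

Lemma energy_continuous : {within `[0, 1], continuous energy}.
Proof.
apply/subspace_continuousP => s; rewrite /= in_itv/= => s01; have azs := chart_at_dom (z s).
set a := chart_at (z s) in azs *.
have [W [cW H]] := local_regular_curve hg L_C1 K_C1 Q_C1 noether QK_lt0 hG hz crit s01 azs.
have [_ _ sls _ sl_lam] := within01_self s01 H.
have pF := within01_proper s01.
have cWs : W t @[t --> within `[0, 1] (nbhs s)] --> W s.
  by apply: cvg_trans (cW s); apply: cvg_fmap2; exact: cvg_within.
have ay : img a (phi a (z s)) by exists (z s).
have cyW : (phi a (z t), W t) @[t --> within `[0, 1] (nbhs s)] --> (phi a (z s), W s).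
  exact: (cvg_pair (phi_curve_cvg hz s01 azs) cWs).
have cX u := (L_C1 a).2 (0, u) (phi a (z s), W s) ay.
have cL : {for (phi a (z s), W s), continuous (chart_lagrangian L a)}.
  by apply: differentiable_continuous; exact: differentiable_chart_lagrangian.
have H1 := cvg_comp _ _ cyW cL.
have H2 i : d_v_chart L a (phi a (z t)) (W t) (e_ i) @[t --> within `[0, 1] (nbhs s)] -->
    d_v_chart L a (phi a (z s)) (W s) (e_ i).
  have := cvg_comp _ _ cyW (cX (e_ i)); rewrite derive_pair_snd.
  by apply: cvg_near_eq; near=> t; exact: (derive_pair_snd (chart_lagrangian L a)).
have H3 : \sum_i W t 0 i * d_v_chart L a (phi a (z t)) (W t) (e_ i) @[t --> within `[0, 1] (nbhs s)] -->
    \sum_i W s 0 i * d_v_chart L a (phi a (z s)) (W s) (e_ i).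
  apply: cvg_sum_ord => i; have Wi : W t 0 i @[t --> within `[0, 1] (nbhs s)] --> W s 0 i by exact: cvg_coord cWs.
  exact: (cvgM Wi (H2 i)).
change (energy t @[t --> within `[0, 1] (nbhs s)] --> energy s).
rewrite (energy_chart s01 azs sls) (d_v_chart_legendre L_C1 _ _ ay).
have H4 : (\sum_i W t 0 i * d_v_chart L a (phi a (z t)) (W t) (e_ i)) -
    in_chart L a (phi a (z t)) (W t) @[t --> within `[0, 1] (nbhs s)] -->
    (\sum_i W s 0 i * d_v_chart L a (phi a (z s)) (W s) (e_ i)) - in_chart L a (phi a (z s)) (W s).
  exact: (cvgB H3 H1).
rewrite [X in _ --> X - _](_ : _ = \sum_i W s 0 i * d_v_chart L a (phi a (z s)) (W s) (e_ i)); last first.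
  by apply: eq_bigr => i _; rewrite mxE.
apply: cvg_near_eq H4; apply: filterS H => t [t01 azt sl _ _].
have ayt : img a (phi a (z t)) by exists (z t).
rewrite (energy_chart t01 azt sl) (d_v_chart_legendre L_C1 _ _ ayt).
rewrite -[LHS]/(_ - _); congr (_ - _).
by apply: eq_bigr => i _; rewrite mxE.
Unshelve. all: by end_near. Qed.

Lemma energy_conserved s : 0 <= s <= 1 -> energy s = energy 0.
Proof.
apply: constant_of_lower_tangents; first exact: energy_continuous.
by move=> t t01 e e0; exact: energy_lower_tangent.
Qed.

End energy.

Theorem propositionA1 (R : realType) (m : nat) (hm : (1 <= m)%N)
    (M : manifold R m.+1) (hM : connected [set: M])
    (g : forall x : M, tangent x -> tangent x -> R)
    (hg : riemannian_metric g) (hgc : complete_metric g)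
    (L : forall x : M, tangent x -> R)
    (K : forall x : M, tangent x) (D : set (R * M)) (psi : R -> M -> M)
    (Q : forall x : M, tangent x -> R) (d : M -> R)
    (hS : cond_S L K D psi Q d) (hG : cond_G g (L_c L K Q))
    (p q : M) (z : R -> M) (hz : Omega12 g p q z) (hcrit : critical_point L z) :
  [/\ C1_curve z,
      forall (a : chart M) (i : 'I_m.+1),
        C1_on01 [set s | 0 <= s <= 1 /\ dom a (z s)] (momentum L z a i),
      forall (a : chart M) (i : 'I_m.+1) (s : R), 0 <= s <= 1 -> dom a (z s) ->
        d_x_chart L a (phi a (z s)) (deriv01 (phi a \o z) s) (delta_mx 0 i) =
        deriv01 (momentum L z a i) s
    & exists E : R, forall s : R, 0 <= s <= 1 ->
        d_v L (velocity z s) (velocity z s) - L (z s) (velocity z s) = E].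
Proof.
have [L_C1 K_C1 _ _ Q_C1 d_C1 noether _ QK_lt0] := hS.
split.
- exact: (critical_C1_curve hg L_C1 K_C1 Q_C1 noether QK_lt0 hG hz hcrit).
- exact: (critical_momentum_C1 hg L_C1 K_C1 Q_C1 noether QK_lt0 hG hz hcrit).
- exact: (critical_euler_lagrange hg L_C1 K_C1 Q_C1 noether QK_lt0 hG hz hcrit).
exists (energy L z 0) => s s01.
exact: (energy_conserved hg L_C1 K_C1 Q_C1 d_C1 noether QK_lt0 hG hz hcrit s01).
Qed.
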